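(* Let $1\le q<p<\infty$ and let $\Omega\subset\mathbb{R}^N$ be an open bounded convex set. Then \[ \lambda_{p,q}(\Omega)\,|\Omega|^{\frac{p-q}{q}}\ge\Big(\frac{\pi_{p,q}}{2}\Big)^p\frac{1}{r_\Omega^p}. \] Moreover, the estimate is sharp: $\inf\big\{\lambda_{p,q}(\Omega)|\Omega|^{\frac{p-q}{q}}r_\Omega^p\big\}=(\pi_{p,q}/2)^p$, the infimum being over all open bounded convex $\Omega\subset\mathbb{R}^N$.
   Context: $\lambda_{p,q}(\Omega)=\inf_{\psi\in C^\infty_0(\Omega)}\{\int_\Omega|\nabla\psi|^p\,dx:\int_\Omega|\psi|^q\,dx=1\}$; $|\Omega|$ is the Lebesgue measure; $r_\Omega=\sup\{r>0:\exists x_0\in\Omega,\ B_r(x_0)\subset\Omega\}$ is the inradius; $\pi_{p,q}=\inf\{\|u'\|_{L^p(0,1)}:u\in C^\infty_0((0,1)),\ \|u\|_{L^q(0,1)}=1\}$. *)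

(* Defs.v *)
From HB Require Import structures.
From mathcomp Require Import all_boot all_order all_algebra.
From mathcomp Require Import all_classical all_reals all_analysis.
Set Implicit Arguments. Unset Strict Implicit. Unset Printing Implicit Defensive.
Import Order.TTheory GRing.Theory Num.Theory.
Import numFieldNormedType.Exports.
Local Open Scope classical_set_scope.
Local Open Scope ring_scope.

(* N-dimensional integral of a nonnegative (extended-real) function on R^N,
   as iterated one-dimensional Lebesgue integrals (Tonelli). *)
Fixpoint iint (R : realType) (N : nat) : ('rV[R]_N -> \bar R) -> \bar R :=
  match N with
  | 0 => fun f => f 0
  | n.+1 => fun f =>
      (\int[@lebesgue_measure R]_t
          iint (fun v : 'rV[R]_n => f (row_mx (\row_(_ < 1) t) v)))%E
  end.

Definition integral_on (R : realType) (N : nat) (A : set 'rV[R]_N)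
  (g : 'rV[R]_N -> R) : \bar R :=
  iint (fun x => ((\1_A x) * g x)%:E).

Definition volume (R : realType) (N : nat) (A : set 'rV[R]_N) : \bar R :=
  iint (fun x => (\1_A x)%:E).

Definition enorm (R : realType) (N : nat) (v : 'rV[R]_N) : R :=
  Num.sqrt (\sum_(i < N) v ord0 i ^+ 2).

Definition eball (R : realType) (N : nat) (x0 : 'rV[R]_N) (r : R) :=
  [set y : 'rV[R]_N | enorm (y - x0) < r].

Definition inradius (R : realType) (N : nat) (O : set 'rV[R]_N) : R :=
  sup [set r : R | 0 < r /\ exists2 x0, O x0 & eball x0 r `<=` O].

Fixpoint iter_dderive (R : realType) (N : nat) (vs : seq 'rV[R]_N)
  (f : 'rV[R]_N -> R) : 'rV[R]_N -> R :=
  match vs with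
  | [::] => f
  | v :: vs' => fun x => 'D_v (iter_dderive vs' f) x
  end.

Definition smooth (R : realType) (N : nat) (f : 'rV[R]_N -> R) :=
  forall vs : seq 'rV[R]_N,
    continuous (iter_dderive vs f) /\
    forall x v, derivable (iter_dderive vs f) x v.

Definition Cc_infty (R : realType) (N : nat) (O : set 'rV[R]_N) :=
  [set f : 'rV[R]_N -> R | smooth f /\
     exists2 K : set 'rV[R]_N, compact K /\ K `<=` O &
       forall x, ~ K x -> f x = 0].

Definition grad_norm (R : realType) (N : nat) (f : 'rV[R]_N -> R) x : R :=
  enorm (\row_(i < N) 'D_(delta_mx ord0 i) f x).

Definition lambda_pq (R : realType) (N : nat) (p q : R) (O : set 'rV[R]_N)
  : \bar R :=
  ereal_inf [set integral_on O (fun x => grad_norm psi x `^ p) |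
             psi in [set psi | Cc_infty O psi /\
                     integral_on O (fun x => `|psi x| `^ q) = 1%E]].

Definition smooth1 (R : realType) (f : R -> R) :=
  forall k, continuous (derive1n k f) /\ forall x, derivable (derive1n k f) x 1.

Definition Cc_infty1 (R : realType) (O : set R) :=
  [set f : R -> R | smooth1 f /\
     exists2 K : set R, compact K /\ K `<=` O & forall x, ~ K x -> f x = 0].

Definition Lnorm01 (R : realType) (p : R) (g : R -> R) : \bar R :=
  ((\int[@lebesgue_measure R]_(x in `]0%R, 1%R[) (`|g x| `^ p)%:E) `^ p^-1)%E.

Definition pi_pq (R : realType) (p q : R) : \bar R :=
  ereal_inf [set Lnorm01 p (derive1 u) |
             u in [set u | Cc_infty1 `]0, 1[ u /\ Lnorm01 q u = 1%E]].

(* Main.v *)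
Require Import Defs.
From HB Require Import structures.
From mathcomp Require Import all_boot all_order all_algebra.
From mathcomp Require Import all_classical all_reals all_analysis.
From mathcomp Require Import measurable_realfun ring lra.
Set Implicit Arguments. Unset Strict Implicit. Unset Printing Implicit Defensive.
Import Order.TTheory GRing.Theory Num.Theory.
Import numFieldNormedType.Exports.
Local Open Scope classical_set_scope.
Local Open Scope ring_scope.

                                                                           
                                                                              
                                                                               
                                                                                 
                                                                               
                                                                                 
                                                                               
                                                                          
                                                                                   
                                            

                                                                                  
                                                                              
                                                                                 

                                        

(** Lower bound. Fix a test function [psi] supported in a compact [K] inside [O]. Convexity allows
    finitely many half-spaces to be fitted so that their intersection lies between [K] and [O]
    ([polytope_between]). This polytope is cut according to the nearest bounding hyperplane, and
    each piece is sliced by segments perpendicular to its hyperplane ([piece], [piece_line]). A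
    point of such a segment at distance t from the hyperplane is the centre of a ball of radius t
    inside [O], so the segment is at most as long as the inradius ([piece_radius]). Along it [psi]
    vanishes near the hyperplane and is unconstrained at the far end. Reflecting across the free end
    produces a competitor for [pi_pq] on an interval twice as long, which is where the factor 1/2
    comes from ([one_sided_ineq]).

    On a slice this bounds the power p/q of the mean of |psi|^q by the mean of the p-th power of the
    derivative, which is at most the gradient norm. To add up slices of different lengths, the
    convex power is replaced by its tangent line at one common point ([powR_tangent_le],
    [slice_ineq]). The estimate becomes affine in the integrals and in the length, so it can be
    integrated over parallel lines ([le_iint_lines]) and summed over the pieces
    ([integral_piece_le]). The tangent point 1/|O|, the mean value of |psi|^q, gives the claimed
    constant ([energy_lower_bound]): this is Jensen's inequality in linearised form.

    Sharpness. On the slab (0,1) x (0,L)^n take u(x_0) times cut-offs in the other variables that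
    equal 1 except within distance 2 of the ends. Up to a fraction of the volume that vanishes as L
    grows, the gradient is u'(x_0), while the inradius is at most 1/2. The quotient is therefore
    asymptotically at most 2^-p times the energy of u ([slab_energy], [hersch_quotient_slab_le]),
    and the infimum over u is (pi/2)^p. *)

Definition rv_display : measure_display. Proof. exact: default_measure_display. Qed.

(** * Lebesgue measure on row vectors behind the iterated integral *)

Section measurable_rv.
Context {R : realType} {n : nat}.

(** Generators of the product sigma-algebra: measurability of a map into row vectors can be tested
    coordinate by coordinate. *)
Definition rv_cylinders : set (set 'rV[R]_n) :=
  \bigcup_(i in [set: 'I_n])
    preimage_set_system setT (fun x : 'rV[R]_n => x ord0 i) measurable.

Definition rv_measurable : set (set 'rV[R]_n) := <<s rv_cylinders >>.

Let rv_set0 : rv_measurable set0.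
Proof. exact: sigma_algebra0. Qed.

Let rv_setC A : rv_measurable A -> rv_measurable (~` A).
Proof. exact: sigma_algebraC. Qed.

Let rv_bigcup (F : _^nat) : (forall i, rv_measurable (F i)) ->
  rv_measurable (\bigcup_i (F i)).
Proof. exact: sigma_algebra_bigcup. Qed.

HB.instance Definition _ := @isMeasurable.Build rv_display
  'rV[R]_n rv_measurable rv_set0 rv_setC rv_bigcup.

Lemma measurable_coord (i : 'I_n) :
  measurable_fun [set: 'rV[R]_n] (fun x => x ord0 i).
Proof.
move=> _ A mA; apply: sub_sigma_algebra; exists i => //.
by exists A.
Qed.

Lemma measurable_to_rv {d} {T : measurableType d} (f : T -> 'rV[R]_n) :
  (forall i, measurable_fun [set: T] (fun x => f x ord0 i)) ->
  measurable_fun [set: T] f.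
Proof.
move=> mf; apply: (@measurability _ _ _ _ setT f rv_cylinders) => //.
move=> _ [B [i _ [C mC <-]] <-].
have := mf i measurableT C mC.
by rewrite !setTI.
Qed.

(** The rational cubes contained in an open set cover it, and there are only countably many of
    them. *)
Lemma open_rv_measurable (A : set 'rV[R]_n) : open A -> measurable A.
Proof.
move=> oA.
pose box (c : 'rV[rat]_n) (k : nat) : set 'rV[R]_n :=
  [set x | forall i, `|x ord0 i - ratr (c ord0 i)| < k.+1%:R^-1].
have mbox c k : measurable (box c k).
  have -> : box c k = \bigcap_(i in [set: 'I_n])
      ((fun x : 'rV[R]_n => x ord0 i) @^-1`
         [set y | `|y - ratr (c ord0 i)| < k.+1%:R^-1]).
    by apply/seteqP; split => x bx i; [move=> _; exact: bx|exact: (bx i I)].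
  apply: fin_bigcap_measurable => // i _.
  rewrite -[X in measurable X]setTI; apply: measurable_coord => //.
  have -> : [set y : R | `|y - ratr (c ord0 i)| < k.+1%:R^-1] =
      `]ratr (c ord0 i) - k.+1%:R^-1, ratr (c ord0 i) + k.+1%:R^-1[%classic.
    by apply/seteqP; split => y /=; rewrite in_itv /= ltr_distl.
  exact: measurable_itv.
pose F (p : 'rV[rat]_n * nat) : set 'rV[R]_n :=
  if `[< box p.1 p.2 `<=` A >] then box p.1 p.2 else set0.
have -> : A = \bigcup_p F p.
  apply/seteqP; split => [x Ax|x [p _]]; last first.
    by rewrite /F; case: asboolP => // + bx; exact.
  have /nbhs_ballP[e /= e0 xeA] := open_nbhs_nbhs (conj oA Ax).
  have [k ke] : exists k, k.+1%:R^-1 + k.+1%:R^-1 < e :> R.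
    have e20 : 0 < e / 2 by lra.
    have [k _ /(_ k (leqnn k)) /= ke] := near_infty_natSinv_lt (PosNum e20).
    by exists k; move: ke => /=; move: (k.+1%:R^-1) => a; lra.
  have k0 : 0 < k.+1%:R^-1 :> R by rewrite invr_gt0.
  have /choice[c hc] : forall i : 'I_n, exists q : rat,
      `|x ord0 i - ratr q| < k.+1%:R^-1.
    move=> i.
    have /rat_in_itvoo[q] : x ord0 i - k.+1%:R^-1 < x ord0 i + k.+1%:R^-1.
      by rewrite ltrD2l gtrN.
    by rewrite in_itv /= -ltr_distl distrC; exists q.
  exists (\row_i c i, k) => //; rewrite /F /=; case: asboolP => [_ i|[]].
    by rewrite mxE.
  move=> y yb; apply: xeA; split => // i j; rewrite ord1.
  have := yb j; have := hc j; rewrite mxE /ball /= => h1 h2.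
  rewrite (_ : x 0 j - y 0 j = (x 0 j - ratr (c j)) - (y 0 j - ratr (c j)));
    last by ring.
  by apply: le_lt_trans (ler_normB _ _) (lt_trans (ltrD h1 h2) ke).
apply: countable_bigcupT_measurable => [|p]; first exact: countableP.
by rewrite /F; case: asboolP.
Qed.

Lemma continuous_rv_measurable (f : 'rV[R]_n -> R) :
  continuous f -> measurable_fun setT f.
Proof.
move=> cf; apply: (measurability _ (RGenOInfty.measurableE R)) => //.
move=> _ [_ [a ->] <-]; rewrite setTI.
apply: open_rv_measurable.
by apply: open_comp => // x _; exact: cf.
Qed.
End measurable_rv.

Section lebesgue_rv.
Context {R : realType}.

(** The identification of R x R^n with R^(n+1) that the recursion of [iint] performs. *)
Definition rcons_rv {n} (p : R * 'rV[R]_n) : 'rV[R]_n.+1 :=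
  row_mx (\row_(_ < 1) p.1) p.2.

Lemma rcons_rv0 n (p : R * 'rV[R]_n) : rcons_rv p ord0 ord0 = p.1.
Proof.
by rewrite /rcons_rv mxE; case: splitP => //= j _; rewrite mxE.
Qed.

Lemma rcons_rvS n (p : R * 'rV[R]_n) i :
  rcons_rv p ord0 (lift ord0 i) = p.2 ord0 i.
Proof.
rewrite /rcons_rv mxE; case: splitP => [j|j] /=; first by rewrite ord1.
by rewrite /bump leq0n => -[/val_inj ->].
Qed.

Definition rv_split {n} (x : 'rV[R]_n.+1) : R * 'rV[R]_n :=
  (x ord0 ord0, \row_i x ord0 (lift ord0 i)).

Lemma rcons_rvK n : cancel (@rcons_rv n) rv_split.
Proof.
move=> [t v]; rewrite /rv_split rcons_rv0; congr pair.
by apply/rowP => i; rewrite mxE rcons_rvS.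
Qed.

Lemma measurable_rcons_rv n : measurable_fun setT (@rcons_rv n).
Proof.
apply: measurable_to_rv => i.
have [j ->|->] := unliftP ord0 i.
- rewrite [X in measurable_fun _ X](_ : _ =
      (fun x : 'rV_n => x ord0 j) \o snd); last first.
    by apply/funext => x; rewrite rcons_rvS.
  by apply: measurableT_comp => //; exact: measurable_coord.
- rewrite [X in measurable_fun _ X](_ : _ = fst)//.
  by apply/funext => x; rewrite rcons_rv0.
Qed.

Lemma measurable_rv_split n : measurable_fun setT (@rv_split n).
Proof.
apply/measurable_fun_pairP; split; first exact: measurable_coord.
apply: measurable_to_rv => i; rewrite /=.
under eq_fun do rewrite mxE.
exact: measurable_coord.
Qed.

End lebesgue_rv.

Section iint_measure.
Context {R : realType}.
Local Open Scope ereal_scope.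

(** Opens the theory of integration (monotonicity, additivity, Tonelli) to [iint]. By induction on
    the dimension, Tonelli's theorem identifies the iterated integral with the integral against the
    product measure carried over to row vectors. *)
Lemma iint_measure n :
  exists mu : {sigma_finite_measure set 'rV[R]_n -> \bar R},
    forall f, measurable_fun setT f -> (forall x, 0 <= f x) ->
      iint f = \int[mu]_x f x.
Proof.
elim: n => [|n [mu muE]].
  exists (dirac (0%R : 'rV[R]_0)) => f mf f0 /=.
  by rewrite integral_dirac// diracT mul1e.
                                                                               
                                                           
(* The image of the product measure under [rcons_rv]; sigma-finiteness is transported through the
   inverse [rv_split], using rectangles built from two exhausting sequences. *)
pose nu := measure_function_pushforward__canonical__measure_function_Measure
  (@lebesgue_measure R \x mu) (@measurable_rcons_rv R n).
have nu_sf : sigma_finite setT nu.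
  have /sigma_finiteP[F [TF ndF Foo]] := sigma_finiteT (@lebesgue_measure R).
  have /sigma_finiteP[G [TG ndG Goo]] := sigma_finiteT mu.
  exists (fun i => rv_split @^-1` (F i `*` G i)).
    rewrite -preimage_bigcup (_ : \bigcup_i (F i `*` G i) = setT)//.
    apply/seteqP; split => // -[x y] _.
    have [i _ Fx] : (\bigcup_i F i) x by rewrite -TF.
    have [j _ Gy] : (\bigcup_i G i) y by rewrite -TG.
    exists (maxn i j) => //; split => /=.
    - by move: x Fx; exact/subsetPset/ndF/leq_maxl.
    - by move: y Gy; exact/subsetPset/ndG/leq_maxr.
  move=> i; have [mFi Fioo] := Foo i; have [mGi Gioo] := Goo i; split.
    rewrite -[X in measurable X]setTI; apply: measurable_rv_split => //.
    exact: measurableX.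
  rewrite /nu /= /pushforward -comp_preimage.
  rewrite (_ : rv_split \o rcons_rv = id); last first.
    by apply/funext => x; exact: rcons_rvK.
  by rewrite preimage_id product_measure1E// lte_mul_pinfty// ge0_fin_numE.
pose nus : {sigma_finite_measure set 'rV[R]_n.+1 -> \bar R} :=
  HB.pack (nu : set _ -> _) (Measure.on nu)
    (Measure_isSigmaFinite.Build _ _ _ (nu : set _ -> _) nu_sf).
exists nus => f mf f0.
rewrite [RHS](_ : _ = \int[nu]_x f x)//.
have mfr : measurable_fun setT (f \o rcons_rv).
  by apply: measurableT_comp => //; exact: measurable_rcons_rv.
rewrite ge0_integral_pushforward//; last exact: measurable_rcons_rv.
rewrite preimage_setT (@fubini_tonelli1 _ _ _ _ R lebesgue_measure mu)//=.
apply: eq_integral => t _; rewrite muE//.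
exact: (measurable_fun_pair2 t mfr).
Qed.

End iint_measure.

(** * Changes of variables and integration along parallel lines *)

Section affine.
Context {R : realType}.
Local Open Scope ereal_scope.
Notation mu := (@lebesgue_measure R).

Lemma measurable_affine (c b : R) :
  measurable_fun [set: measurableTypeR R]
    (fun x : R => (c * x + b)%R : measurableTypeR R).
Proof.
apply: continuous_measurable_fun => x.
by apply: cvgD; [apply: cvgM; [exact: cvg_cst|exact: cvg_id]|exact: cvg_cst].
Qed.

(** Lebesgue measure coincides with |c| times its image under the affine map, because the two agree
    on half-open intervals. *)
Lemma ge0_integral_affine (c b : R) (G : measurableTypeR R -> \bar R) : c != 0%R ->
  measurable_fun setT G -> (forall x, 0 <= G x) ->
  \int[mu]_x G x = `|c|%:E * \int[mu]_x G (c * x + b)%R.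
Proof.
move=> c0 mG G0.
have c0' : (0 < `|c|)%R by rewrite normr_gt0.
pose nu := measure_function_pushforward__canonical__measure_function_Measure
  mu (measurable_affine c b).
pose k : {nonneg R} := NngNum (ltW c0').
pose m : {measure set (measurableTypeR R) -> \bar R} := mscale k nu.
have muE A : measurable A -> mu A = m A.
  apply: lebesgue_measure_unique => X /ocitvP[->|[[u v] /= uv ->]].
    by rewrite !measure0.
  rewrite lebesgue_measure_itv/= lte_fin uv /m /mscale /nu /= /pushforward /=.
  have [cp|cn|] := ltrgt0P c; last by move/eqP; rewrite (negbTE c0).
  - rewrite (_ : _ @^-1` _ = [set` `](u - b) / c, (v - b) / c]%R]); last first.
      apply/seteqP; split => x /=; rewrite !in_itv /= ltr_pdivrMr// ler_pdivlMr//.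
        by move=> /andP[? ?]; apply/andP; split; lra.
      by move=> /andP[? ?]; apply/andP; split; lra.
    rewrite lebesgue_measure_itv/= lte_fin ltr_pM2r ?invr_gt0// ltrD2r uv.
    by rewrite -EFinD -EFinD -EFinM; congr EFin; field; rewrite gt_eqF.
  (* A negative factor reverses the interval, so its closed end moves to the left. *)
  - rewrite (_ : _ @^-1` _ = [set` `[(v - b) / c, (u - b) / c[%R]); last first.
      apply/seteqP; split => x /=; rewrite !in_itv /= ler_ndivrMr// ltr_ndivlMr//.
        by move=> /andP[? ?]; apply/andP; split; lra.
      by move=> /andP[? ?]; apply/andP; split; lra.
    rewrite lebesgue_measure_itv/= lte_fin ltr_nM2r ?invr_lt0// ltrD2r uv.
    by rewrite -EFinD -EFinD -EFinM; congr EFin; field; rewrite lt_eqF.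
rewrite (eq_measure_integral m); last by move=> A mA _; exact: muE.
rewrite ge0_integral_mscale//= ge0_integral_pushforward//.
exact: measurable_affine.
Qed.

End affine.

Section iint_theory.
Context {R : realType}.
Local Open Scope ereal_scope.
Notation mu := (@lebesgue_measure R).

Definition lebesgue_rv n : {sigma_finite_measure set 'rV[R]_n -> \bar R} :=
  sval (cid (@iint_measure R n)).

Lemma iintE n (f : 'rV[R]_n -> \bar R) :
  measurable_fun setT f -> (forall x, 0 <= f x) ->
  iint f = \int[@lebesgue_rv n]_x f x.
Proof. by move=> mf f0; rewrite /lebesgue_rv; case: cid => m /= ->. Qed.

Lemma iint_ge0 n (f : 'rV[R]_n -> \bar R) : (forall x, 0 <= f x) -> 0 <= iint f.
Proof.
elim: n f => [f f0 /=|n IH f f0 /=]; first exact: f0.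
by apply: integral_ge0 => t _; exact: IH.
Qed.

Lemma eq_iint n (f g : 'rV[R]_n -> \bar R) : f =1 g -> iint f = iint g.
Proof. by move=> /funext ->. Qed.

Lemma le_iint n (f g : 'rV[R]_n -> \bar R) :
  measurable_fun setT f -> measurable_fun setT g -> (forall x, 0 <= f x) ->
  (forall x, f x <= g x) -> iint f <= iint g.
Proof.
move=> mf mg f0 fg; have g0 x : 0 <= g x by exact: le_trans (fg x).
by rewrite !iintE//; apply: ge0_le_integral.
Qed.

Lemma iintD n (f g : 'rV[R]_n -> \bar R) :
  measurable_fun setT f -> measurable_fun setT g ->
  (forall x, 0 <= f x) -> (forall x, 0 <= g x) ->
  iint (fun x => f x + g x) = iint f + iint g.
Proof.
move=> mf mg f0 g0; rewrite !iintE//; first exact: ge0_integralD.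
- exact: emeasurable_funD.
- by move=> x; exact: adde_ge0.
Qed.

Lemma iintZl n (k : R) (f : 'rV[R]_n -> \bar R) :
  measurable_fun setT f -> (forall x, 0 <= f x) -> (0 <= k)%R ->
  iint (fun x => k%:E * f x) = k%:E * iint f.
Proof.
move=> mf f0 k0; rewrite !iintE//; first exact: ge0_integralZl.
- exact: measurable_funeM.
- by move=> x; exact: mule_ge0.
Qed.

Lemma iint_sum n (I : Type) (s : seq I) (F : I -> 'rV[R]_n -> \bar R) :
  (forall i, measurable_fun setT (F i)) -> (forall i x, 0 <= F i x) ->
  iint (fun x => \sum_(i <- s) F i x) = \sum_(i <- s) iint (F i).
Proof.
move=> mF F0; rewrite iintE//.
- rewrite ge0_integral_sum//.
  by apply: eq_bigr => i _; rewrite iintE.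
- exact: emeasurable_sum.
- by move=> x; exact: sume_ge0.
Qed.

Lemma measurable_iint d (T : measurableType d) n (F : T * 'rV[R]_n -> \bar R) :
  measurable_fun setT F -> (forall x, 0 <= F x) ->
  measurable_fun setT (fun x => iint (fun v => F (x, v))).
Proof.
move=> mF F0.
rewrite (_ : (fun x => _) = fun x => \int[@lebesgue_rv n]_v F (x, v)).
  exact: measurable_fun_fubini_tonelli_F.
by apply/funext => x; rewrite iintE//; exact: measurable_fun_pair2.
Qed.

Lemma iint_swap n (F : measurableTypeR R * 'rV[R]_n -> \bar R) :
  measurable_fun setT F -> (forall x, 0 <= F x) ->
  \int[mu]_t iint (fun v => F (t, v)) = iint (fun v => \int[mu]_t F (t, v)).
Proof.
move=> mF F0; rewrite iintE.
- rewrite -(@fubini_tonelli _ _ _ _ R mu (@lebesgue_rv n) F)//.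
  by apply: eq_integral => t _; rewrite iintE//; exact: measurable_fun_pair2.
- exact: (@measurable_fun_fubini_tonelli_G _ _ _ _ R mu F).
- by move=> v; exact: integral_ge0.
Qed.

Lemma iint_translate n (w : 'rV[R]_n) (f : 'rV[R]_n -> \bar R) :
  measurable_fun setT f -> (forall x, 0 <= f x) ->
  iint (fun v => f (v + w)%R) = iint f.
Proof.
elim: n w f => [w f mf f0 /=|n IH w f mf f0 /=].
  by congr f; apply/rowP => -[].
have mfr : measurable_fun setT (f \o rcons_rv).
  by apply: measurableT_comp => //; exact: measurable_rcons_rv.
pose G t := iint (fun v => f (rcons_rv (t, v))).
have mG : measurable_fun [set: measurableTypeR R] G.
  apply: (@measurable_iint _ (measurableTypeR R) _ (f \o rcons_rv)) => //.
  by move=> x; exact: f0.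
have G0 t : 0 <= G t by exact: iint_ge0.
rewrite -[RHS]/(\int[mu]_t G t).
rewrite (@ge0_integral_affine _ 1 (w ord0 ord0) G) ?oner_neq0// normr1 mul1e.
apply: eq_integral => t _; rewrite /G.
rewrite -(IH (rv_split w).2 (fun v => f (rcons_rv ((1 * t + w ord0 ord0)%R, v))))//.
  apply: eq_iint => v; congr f; apply/rowP => i.
  have [j ->|->] := unliftP ord0 i.
    by rewrite mxE !(rcons_rvS (_, _)) !mxE.
  by rewrite mxE !(rcons_rv0 (_, _)) /= mul1r.
exact: (measurable_fun_pair2 _ mfr).
Qed.

Lemma measurable_lines n (f : 'rV[R]_n.+1 -> \bar R) (d : 'rV[R]_n.+1) (c : R) :
  measurable_fun setT f ->
  measurable_fun setT (fun p : measurableTypeR R * 'rV[R]_n =>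
    f (rcons_rv (0, p.2) + (p.1 / c) *: d)%R).
Proof.
move=> mf; apply: (@measurableT_comp _ _ _ _ _ _ f) => //.
apply: measurable_to_rv => i; under eq_fun do rewrite mxE [X in (_ + X)%R]mxE.
apply: measurable_funD; last by do 2 apply: measurable_funM => //.
have [j ->|->] := unliftP ord0 i.
- rewrite [X in measurable_fun _ X](_ : _ =
    (fun x : 'rV_n => x ord0 j) \o snd); last first.
    by apply/funext => x; rewrite (rcons_rvS (_, _)).
  by apply: measurableT_comp => //; exact: measurable_coord.
- rewrite [X in measurable_fun _ X](_ : _ = cst 0%R)//.
  by apply/funext => x; rewrite (rcons_rv0 (_, _)).
Qed.

(** A shear: translating the slice at first coordinate t by t/d_0 times the tail of [d] leaves its
    integral unchanged, and after this translation t moves along lines parallel to [d]. The lines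
    must cross the hyperplane of vanishing first coordinate, hence the condition on
    [d ord0 ord0]. *)
Lemma iint_lines n (f : 'rV[R]_n.+1 -> \bar R) (d : 'rV[R]_n.+1) :
  measurable_fun setT f -> (forall x, 0 <= f x) -> d ord0 ord0 != 0%R ->
  iint f =
  iint (fun v => \int[mu]_t f (rcons_rv (0, v) + (t / d ord0 ord0) *: d)%R).
Proof.
move=> mf f0 d0.
have mfr : measurable_fun setT (f \o rcons_rv).
  by apply: measurableT_comp => //; exact: measurable_rcons_rv.
rewrite -(@iint_swap _ (fun p : measurableTypeR R * 'rV[R]_n =>
    f (rcons_rv (0, p.2) + (p.1 / d ord0 ord0) *: d)%R))//; last first.
  exact: measurable_lines.
apply: eq_integral => t _.
rewrite -[LHS]/(iint (fun v => f (rcons_rv (t, v)))).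
rewrite -(@iint_translate n (t / d ord0 ord0 *: (rv_split d).2)
  (fun v => f (rcons_rv (t, v))))//; last first.
  exact: (measurable_fun_pair2 (t : R) mfr).
apply: eq_iint => v; congr f; apply/rowP => i.
have [j ->|->] := unliftP ord0 i.
  by rewrite (rcons_rvS (_, _)) [RHS]mxE (rcons_rvS (_, _)) /= !mxE.
by rewrite (rcons_rv0 (_, _)) [RHS]mxE (rcons_rv0 (_, _)) /= mxE divfK// add0r.
Qed.

(** Two integrals may be compared line by line, with an origin [a v] chosen on each line. In the
    application [a v] places the origin on a bounding hyperplane and t is the distance from it,
    measured inwards. The affine change of parameter contributes the same factor |d_0| on both
    sides. *)
Lemma le_iint_lines n (f g : 'rV[R]_n.+1 -> \bar R) (d : 'rV[R]_n.+1)
    (a : 'rV[R]_n -> R) :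
  measurable_fun setT f -> measurable_fun setT g ->
  (forall x, 0 <= f x) -> (forall x, 0 <= g x) -> d ord0 ord0 != 0%R ->
  (forall v, \int[mu]_t f (rcons_rv (0, v) + (a v - t) *: d)%R <=
             \int[mu]_t g (rcons_rv (0, v) + (a v - t) *: d)%R) ->
  iint f <= iint g.
Proof.
move=> mf mg f0 g0 d0 fg.
have lineE (h : 'rV[R]_n.+1 -> \bar R) v : measurable_fun setT h ->
    (forall x, 0 <= h x) ->
    \int[mu]_t h (rcons_rv (0, v) + (t / d ord0 ord0) *: d)%R =
    `|d ord0 ord0|%:E * \int[mu]_t h (rcons_rv (0, v) + (a v - t) *: d)%R.
  move=> mh h0; have nd0 : (- d ord0 ord0 != 0)%R by rewrite oppr_eq0.
  rewrite (ge0_integral_affine (d ord0 ord0 * a v) nd0) ?normrN//; last first.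
    exact: (measurable_fun_pair1 v (measurable_lines _ _ mh)).
  congr *%E; apply: eq_integral => t _; congr (h (_ + _ *: _)%R).
  by field.
have mint (h : 'rV[R]_n.+1 -> \bar R) : measurable_fun setT h ->
    (forall x, 0 <= h x) -> measurable_fun setT
     (fun v => \int[mu]_t h (rcons_rv (0, v) + (t / d ord0 ord0) *: d)%R).
  move=> mh h0.
  exact: (@measurable_fun_fubini_tonelli_G _ _ _ _ R mu _ (measurable_lines d _ mh)).
rewrite !(iint_lines _ _ d0)//; apply: le_iint.
- exact: mint.
- exact: mint.
- by move=> v; exact: integral_ge0.
- by move=> v; rewrite !lineE// lee_pmul2l// lte_fin normr_gt0.
Qed.

End iint_theory.

                                         

(** * Smooth functions of one variable and a smooth step *)

Section smooth_functions_of_one_variable.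
Context {R : realType}.
Implicit Types (f g : R -> R) (x : R).

(** The recursion peels off a derivative that is given as a witness, so the sum, product, chain and
    quotient rules yield closure properties by induction on [k]. *)
Fixpoint diffk (k : nat) f : Prop :=
  if k is k'.+1 then
    exists2 g, (forall x, is_derive x (1 : R) f (g x)) & diffk k' g
  else True.

Lemma diffk_le k f : diffk k.+1 f -> diffk k f.
Proof.
elim: k f => [//|k IH] f [g fg /IH gk].
by exists g.
Qed.

Lemma derive1_is_derive f g : (forall x, is_derive x (1 : R) f (g x)) ->
  derive1 f = g.
Proof. by move=> fg; apply/funext => x; rewrite derive1E derive_val. Qed.

Lemma smooth1P f : smooth1 f <-> forall k, diffk k f.
Proof.
split=> [sf k|].
  suff : forall j, diffk k (derive1n j f) by move=> /(_ 0%N).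
  elim: k => [//|k IH] j; exists (derive1n j.+1 f) => // x.
  rewrite derive1nS derive1E; apply: derivableP.
  by have [_] := sf j.
move=> sf k.
have : diffk 1 (derive1n k f).
  elim: k f sf => [f /(_ 1%N)//|k IH f sf].
  rewrite /derive1n iterSr; apply: IH => k'.
  have [g fg gk] := sf k'.+1.
  by rewrite (derive1_is_derive fg).
move=> [g kg _]; split.
  move=> x; apply: differentiable_continuous; apply/derivable1_diffP.
  exact: ex_derive.
by move=> x; exact: ex_derive.
Qed.

Lemma diffk_cst k (c : R) : diffk k (fun=> c).
Proof.
elim: k c => [//|k IH] c; exists (fun=> 0) => // x.
exact: is_derive_cst.
Qed.

Lemma diffk_id k : diffk k (fun x => x).
Proof.
case: k => [//|k]; exists (fun=> 1); last exact: diffk_cst.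
by move=> x; exact: is_derive_id.
Qed.

Lemma diffkD k f g : diffk k f -> diffk k g -> diffk k (fun x => f x + g x).
Proof.
elim: k f g => [//|k IH] f g [f' ff' kf] [g' gg' kg].
exists (fun x => f' x + g' x); last exact: IH.
by move=> x; exact: is_deriveD.
Qed.

Lemma diffkM k f g : diffk k f -> diffk k g -> diffk k (fun x => f x * g x).
Proof.
elim: k f g => [//|k IH] f g kf kg.
have := diffk_le kf; have := diffk_le kg.
case: kf kg => f' ff' kf [g' gg' kg] kg0 kf0.
exists (fun x => f x * g' x + g x * f' x).
  by move=> x; exact: is_deriveM.
by apply: diffkD; exact: IH.
Qed.

Lemma diffkN k f : diffk k f -> diffk k (fun x => - f x).
Proof.
move=> kf; rewrite (_ : (fun _ => _) = fun x => -1 * f x).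
  by apply: diffkM => //; exact: diffk_cst.
by apply/funext => x; rewrite mulN1r.
Qed.

Lemma diffk_comp k f g : diffk k f -> diffk k g -> diffk k (f \o g).
Proof.
elim: k f g => [//|k IH] f g [f' ff' kf] kg.
have kg0 := diffk_le kg; case: kg => g' gg' kg.
exists (fun x => f' (g x) * g' x).
  by move=> x; exact: is_derive1_comp.
by apply: diffkM => //; exact: IH.
Qed.

Lemma diffkV k f : (forall x, f x != 0) -> diffk k f ->
  diffk k (fun x => (f x)^-1).
Proof.
move=> f0; elim: k f f0 => [//|k IH] f f0 kf.
have kf0 := diffk_le kf; case: kf => f' ff' kf.
exists (fun x => - ((f x)^-1 * (f x)^-1) * f' x).
  move=> x; rewrite -invfM -expr2.
  exact: is_deriveV.
by apply: diffkM => //; apply: diffkN; apply: diffkM; exact: IH.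
Qed.

Lemma diffk_sqrt k f : (forall x, 0 < f x) -> diffk k f ->
  diffk k (fun x => Num.sqrt (f x)).
Proof.
move=> f0; elim: k f f0 => [//|k IH] f f0 kf.
have kf0 := diffk_le kf; case: kf => f' ff' kf.
exists (fun x => (2 * Num.sqrt (f x))^-1 * f' x).
  move=> x; apply: (@is_derive1_comp _ Num.sqrt f) => //.
  exact: is_derive1_sqrt.
apply: diffkM => //; apply: diffkV.
  by move=> x; rewrite gt_eqF// mulr_gt0// sqrtr_gt0.
by apply: diffkM; [exact: diffk_cst|exact: IH].
Qed.

Lemma smooth1_cst (c : R) : smooth1 (fun _ : R => c).
Proof. by apply/smooth1P => k; exact: diffk_cst. Qed.

Lemma smooth1_id : smooth1 (fun x : R => x).
Proof. by apply/smooth1P => k; exact: diffk_id. Qed.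

Lemma smooth1D f g : smooth1 f -> smooth1 g -> smooth1 (fun x => f x + g x).
Proof. by move=> /smooth1P sf /smooth1P sg; apply/smooth1P => k; exact: diffkD. Qed.

Lemma smooth1M f g : smooth1 f -> smooth1 g -> smooth1 (fun x => f x * g x).
Proof. by move=> /smooth1P sf /smooth1P sg; apply/smooth1P => k; exact: diffkM. Qed.

Lemma smooth1N f : smooth1 f -> smooth1 (fun x => - f x).
Proof. by move=> /smooth1P sf; apply/smooth1P => k; exact: diffkN. Qed.

Lemma smooth1_comp f g : smooth1 f -> smooth1 g -> smooth1 (f \o g).
Proof. by move=> /smooth1P sf /smooth1P sg; apply/smooth1P => k; exact: diffk_comp. Qed.

Lemma smooth1V f : (forall x, f x != 0) -> smooth1 f ->
  smooth1 (fun x => (f x)^-1).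
Proof. by move=> f0 /smooth1P sf; apply/smooth1P => k; exact: diffkV. Qed.

Lemma smooth1_sqrt f : (forall x, 0 < f x) -> smooth1 f ->
  smooth1 (fun x => Num.sqrt (f x)).
Proof. by move=> f0 /smooth1P sf; apply/smooth1P => k; exact: diffk_sqrt. Qed.

Lemma smooth1_continuous f : smooth1 f -> continuous f.
Proof. by move=> /(_ 0%N)[]. Qed.

Lemma smooth1_is_derive f x : smooth1 f -> is_derive x (1 : R) f (derive1 f x).
Proof. by move=> /(_ 0%N)[_ df]; rewrite derive1E; exact: derivableP. Qed.

Lemma smooth1_derive1 f : smooth1 f -> smooth1 (derive1 f).
Proof. by move=> sf k; have := sf k.+1; rewrite /derive1n iterSr. Qed.

End smooth_functions_of_one_variable.

Section smooth_step.
Context {R : realType}.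
Implicit Types (P Q : {poly R}) (x y : R).

Lemma poly_expRN_bounded P :
  exists C : R, forall y, 0 <= y -> `|P.[y]| * expR (- y) <= C.
Proof.
have mono i y : 0 <= y -> y ^+ i <= i`!%:R * expR y.
  case: i => [|i] y0; first by rewrite expr0 mul1r -expR0 ler_expR.
  have i0 : 0 < i.+1`!%:R :> R by rewrite ltr0n fact_gt0.
  rewrite mulrC -ler_pdivrMr//; apply: le_trans (expR_ge1Dxn i y0).
  by rewrite lerDr.
exists (\sum_(i < size P) `|P`_i| * i`!%:R) => y y0.
rewrite horner_coef expRN ler_pdivrMr ?expR_gt0//.
apply: le_trans (ler_norm_sum _ _ _) _.
rewrite mulr_suml; apply: ler_sum => i _.
by rewrite normrM (ger0_norm (exprn_ge0 _ y0)) -mulrA ler_wpM2l// mono.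
Qed.

Lemma is_derive_le_sqr (f : R -> R) (C : R) :
  (forall h, `|f h| <= C * h ^+ 2) -> is_derive (0 : R) (1 : R) f 0.
Proof.
move=> fC.
have f0 : f 0 = 0.
  by apply/eqP; rewrite -normr_le0 (le_trans (fC 0))// expr0n mulr0.
have cvgf : h^-1 *: (f (h *: 1 + 0) - f 0) @[h --> (0 : R)^'] --> (0 : R).
  apply/cvgr0Pnorm_le => e e0.
  near=> h.
  have h0 : h != 0 by near: h; exact: nbhs_dnbhs_neq.
  rewrite f0 subr0 addr0 [_ *: 1]mulr1 normrM normfV ler_pdivrMl ?normr_gt0//.
  apply: le_trans (fC h) _; rewrite -real_normK ?num_real// expr2 mulrA [leLHS]mulrC.
  rewrite ler_wpM2l// mulrC.
  have C1 : 0 < `|C| + 1 by rewrite ltr_pwDr.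
  have : `|h| <= e / (`|C| + 1).
    by near: h; apply: dnbhs0_le; rewrite divr_gt0.
  rewrite ler_pdivlMr// => he.
  apply: le_trans he; rewrite ler_wpM2l//.
  by rewrite (le_trans (ler_norm _))// lerDl.
by apply: DeriveDef; [apply/cvg_ex; exists 0|exact: cvg_lim cvgf].
Unshelve. all: by end_near. Qed.

(** The functions P(1/x) exp(-1/x), extended by 0, form a family that is stable under
    differentiation. All of them are therefore smooth at once; P = 1 is the classical flat
    function. *)
Definition flat P x : R := if 0 < x then P.[x^-1] * expR (- x^-1) else 0.

Lemma is_derive_flat P x :
  is_derive x (1 : R) (flat P) (flat ('X^2 * (P - P^`())) x).
Proof.
have [x0|x0|->] := ltrgt0P x.
- have fE : {near x, flat P =1 (fun y => P.[y^-1] * expR (- y^-1))}.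
    near=> y; rewrite /flat ifT//; near: y.
    exact: lt_nbhsr.
  apply: (@near_eq_is_derive _ _ _ (fun y => P.[y^-1] * expR (- y^-1))).
    near=> y; rewrite /flat ifT//; near: y; exact: lt_nbhsr.
  have dV : is_derive x (1 : R) (fun y => y^-1) (- x ^- 2 *: (1 : R)).
    by apply: is_deriveV; rewrite gt_eqF.
  have dN : is_derive x (1 : R) (fun y => - y^-1) (- (- x ^- 2 *: (1 : R))).
    exact: is_deriveN.
  have d1 := is_derive1_comp (is_derive_poly P x^-1) dV.
  have d2 := @is_derive1_comp _ expR (fun y => - y^-1) _ _ _ (is_derive_expR (- x^-1)) dN.
  have := is_deriveM d1 d2.
  set a := (X in is_derive _ _ _ X -> _); move=> d12.
  rewrite (_ : flat _ x = a)// /a /flat x0 !hornerE.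
  rewrite /GRing.scale /=; set u := x^-1; set E := expR _.
  rewrite exprVn -/u; ring.
- apply: (@near_eq_is_derive _ _ _ (cst 0)).
    near=> y; rewrite /flat ifF//; apply/negbTE; rewrite -leNgt.
    by apply: ltW; near: y; exact: lt_nbhsl.
  by rewrite /flat ltNge (ltW x0) /=; exact: is_derive_cst.
- rewrite [X in is_derive _ _ _ X](_ : _ = 0); last by rewrite /flat ltxx.
  (* The extra factor ['X^2] turns the boundedness of polynomial times exponential into a bound C
     h^2 near the origin, which forces the derivative there to be 0. *)
  have [C HC] := poly_expRN_bounded (P * 'X^2).
  apply: (@is_derive_le_sqr _ C) => h; rewrite /flat.
  have [h0|h0] := ltP 0 h; last first.
    rewrite normr0 mulr_ge0 ?sqr_ge0//.
    by apply: le_trans (HC 0 _) => //; rewrite mulr_ge0// ltW// expR_gt0.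
  have := HC h^-1; rewrite invr_ge0 (ltW h0) => /(_ isT).
  rewrite -ler_pdivrMr ?exprn_gt0//.
  apply: le_trans; rewrite hornerM hornerXn !normrM -exprVn.
  have hV : 0 <= h^-1 by rewrite invr_ge0 ltW.
  by rewrite (ger0_norm (ltW (expR_gt0 _))) (ger0_norm hV) mulrAC.
Unshelve. all: by end_near. Qed.

Lemma smooth1_flat P : smooth1 (flat P).
Proof.
apply/smooth1P => k; elim: k P => [//|k IH] P.
exists (flat ('X^2 * (P - P^`()))) => // x.
exact: is_derive_flat.
Qed.

Let e := flat 1.

Let e_gt0 x : 0 < x -> 0 < e x.
Proof. by move=> x0; rewrite /e /flat x0 hornerC mul1r expR_gt0. Qed.

Let e_eq0 x : x <= 0 -> e x = 0.
Proof. by move=> x0; rewrite /e /flat ltNge x0. Qed.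

Let e_ge0 x : 0 <= e x.
Proof. by have [/e_eq0 ->//|/e_gt0/ltW] := leP x 0. Qed.

Definition smooth_step x : R := flat 1 x / (flat 1 x + flat 1 (1 - x)).

Let den_gt0 x : 0 < e x + e (1 - x).
Proof.
have [x0|x0] := ltP 0 x; first by rewrite ltr_wpDr// e_gt0.
by rewrite ltr_pwDr// e_gt0//; lra.
Qed.

Lemma smooth1_smooth_step : smooth1 smooth_step.
Proof.
apply: smooth1M; first exact: smooth1_flat.
apply: smooth1V => [x|]; first by rewrite gt_eqF// den_gt0.
apply: smooth1D; first exact: smooth1_flat.
apply: (@smooth1_comp _ (flat 1) (fun x => 1 - x)); first exact: smooth1_flat.
by apply: smooth1D; [exact: smooth1_cst|apply: smooth1N; exact: smooth1_id].
Qed.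

Lemma smooth_step_eq0 x : x <= 0 -> smooth_step x = 0.
Proof. by move=> x0; rewrite /smooth_step -/e e_eq0// mul0r. Qed.

Lemma smooth_step_eq1 x : 1 <= x -> smooth_step x = 1.
Proof.
move=> x1; rewrite /smooth_step -/e [e (1 - x)]e_eq0 ?addr0 ?divff ?gt_eqF//.
  by apply: e_gt0; lra.
by lra.
Qed.

Lemma smooth_step_ge0 x : 0 <= smooth_step x.
Proof. by rewrite divr_ge0// ltW// den_gt0. Qed.

Lemma smooth_step_le1 x : smooth_step x <= 1.
Proof. by rewrite ler_pdivrMr ?den_gt0// mul1r lerDl e_ge0. Qed.

End smooth_step.

                                       

(** * The one-dimensional constant and the inequality with a free endpoint *)

Section one_dimensional_constant.
Context {R : realType}.
Implicit Types (f g u w : R -> R) (a b p q : R).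
Local Notation mu := (@lebesgue_measure R).

Lemma continuous_norm_powR p : 0 < p -> continuous (fun x : R => `|x| `^ p).
Proof.
move=> p0 x; have [->|x0] := eqVneq x 0; last first.
  have nx0 : 0 < `|x| by rewrite normr_gt0.
  apply: (@continuous_comp R R R (fun x : R => `|x|) (fun y : R => y `^ p)).
    exact: norm_continuous.
  apply/differentiable_continuous/derivable1_diffP/derivable_powR.
  by rewrite in_itv /= nx0.
rewrite /continuous_at normr0 powR0 ?gt_eqF//; apply/cvgr0Pnorm_le => e e0.
have d0 : 0 < e `^ p^-1 by exact: powR_gt0.
near=> y; rewrite ger0_norm ?powR_ge0//.
have /(ge0_ler_powR (ltW p0)) : `|y| <= e `^ p^-1.
  by near: y; exact: (@nbhs0_le _ R^o).
rewrite !nnegrE => /(_ (normr_ge0 _) (powR_ge0 _ _)).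
by rewrite -powRrM mulVf ?gt_eqF// powRr1// ltW.
Unshelve. all: by end_near. Qed.

Lemma continuous_powR_comp p f : 0 < p -> continuous f ->
  continuous (fun x => `|f x| `^ p).
Proof.
move=> p0 cf x; apply: (@continuous_comp _ _ _ f (fun x => `|x| `^ p)).
  exact: cf.
exact: continuous_norm_powR.
Qed.

Lemma continuous_bounded_itv (f : R -> R) (a b : R) : continuous f ->
  exists C : R, 0 <= C /\ forall x, a <= x -> x <= b -> `|f x| <= C.
Proof.
move=> cf.
have : compact (f @` `[a, b]%classic).
  apply: continuous_compact; last exact: segment_compact.
  exact: continuous_subspaceT.
move=> /compact_bounded[M [Mr HM]].
exists (`|M| + 1); split=> [|x ax xb]; first by rewrite addr_ge0.
have M1 : M < `|M| + 1 by rewrite (le_lt_trans (ler_norm _))// ltrDl.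
by apply: (HM _ M1); exists x => //=; rewrite in_itv /= ax.
Qed.

Lemma continuous_integral_fin a b f : continuous f ->
  (\int[mu]_(x in `]a, b[) (f x)%:E)%E \is a fin_num.
Proof.
move=> cf; apply: integrable_fin_num => //.
apply: (@integrableS _ _ _ mu `[a, b]%classic) => //.
  by apply: subset_itvW; rewrite bnd_simp.
apply: continuous_compact_integrable; first exact: segment_compact.
exact: continuous_subspaceT.
Qed.

Lemma continuous_EFin_measurable f (D : set R) : measurable D -> continuous f ->
  measurable_fun (D : set (measurableTypeR R)) (EFin \o f).
Proof.
move=> mD cf; apply: measurable_funS measurableT _ _ => //.
by apply/measurable_EFinP; exact: continuous_measurable_fun.
Qed.

Lemma Lnorm01_ge0 p u : (0 <= Lnorm01 p u)%E.
Proof. exact: poweR_ge0. Qed.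

Lemma pi_pq_ge0 p q : (0 <= pi_pq p q :> \bar R)%E.
Proof. by apply: le_ereal_inf_tmp => _ [u _ <-]; exact: Lnorm01_ge0. Qed.

Lemma derive1Z_smooth (c : R) u : smooth1 u ->
  derive1 (fun x => c * u x) = fun x => c * derive1 u x.
Proof.
move=> su; apply: derive1_is_derive => x.
have := is_deriveZ c (smooth1_is_derive x su).
by [].
Qed.

(** The homogeneous form of the definition of [pi_pq], free of the normalisation of u: a function of
    nonzero norm is rescaled by c = (int |u|^q)^(-1/q), and for zero norm the left side vanishes. *)
Lemma pi_pq_le p q u : 0 < p -> 0 < q -> Cc_infty1 `]0, 1[ u ->
  (pi_pq p q `^ p * (\int[mu]_(x in `]0%R, 1%R[) (`|u x| `^ q)%:E) `^ (p / q) <=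
   \int[mu]_(x in `]0%R, 1%R[) (`|derive1 u x| `^ p)%:E)%E.
Proof.
move=> p0 q0 [su [K cK uK]].
set A := (\int[mu]_(x in _) _)%E; set B := (\int[mu]_(x in _) _)%E.
have A0 : (0 <= A)%E by apply: integral_ge0 => x _; rewrite lee_fin powR_ge0.
have B0 : (0 <= B)%E by apply: integral_ge0 => x _; rewrite lee_fin powR_ge0.
have Afin : A \is a fin_num.
  apply: (@continuous_integral_fin _ _ (fun x => `|u x| `^ q)).
  by apply: continuous_powR_comp => //; exact: smooth1_continuous.
have Bfin : B \is a fin_num.
  apply: (@continuous_integral_fin _ _ (fun x => `|derive1 u x| `^ p)).
  by apply: continuous_powR_comp => //; exact/smooth1_continuous/smooth1_derive1.
have [Az|An] := eqVneq A 0%E.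
  by rewrite Az poweR0r ?mule0// mulf_neq0 ?invr_eq0 ?gt_eqF.
have [a aE] : exists a, A = a%:E by exists (fine A); exact: esym (fineK Afin).
have [b bE] : exists b, B = b%:E by exists (fine B); exact: esym (fineK Bfin).
have a0 : 0 < a by move: An A0; rewrite aE eqe lee_fin le0r => /negPf ->.
have b0 : 0 <= b by rewrite -lee_fin -bE.
pose c := a `^ (- q^-1); have c0 : 0 < c by exact: powR_gt0.
have LE r g : 0 < r -> continuous g ->
    (\int[mu]_(x in `]0%R, 1%R[) (`|c * g x| `^ r)%:E =
    (c `^ r)%:E * \int[mu]_(x in `]0%R, 1%R[) (`|g x| `^ r)%:E)%E.
  move=> r0 cg; rewrite -ge0_integralZl//.
  - by apply: eq_integral => x _; rewrite normrM powRM// (gtr0_norm c0).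
  - apply: (@continuous_EFin_measurable (fun x => `|g x| `^ r)) => //.
    exact: continuous_powR_comp.
  - by rewrite lee_fin powR_ge0.
have cadm : Cc_infty1 `]0, 1[ (fun x => c * u x).
  split; first exact: (smooth1M (smooth1_cst c) su).
  by exists K => // x /uK ->; rewrite mulr0.
have cnorm : Lnorm01 q (fun x => c * u x) = 1%E.
  rewrite /Lnorm01 (LE q _ q0 (smooth1_continuous su)).
  rewrite -/A aE -EFinM poweR_EFin; congr EFin.
  rewrite /c -powRrM mulNr mulVf ?gt_eqF// powR_inv1 ?ltW//.
  by rewrite mulVf ?gt_eqF// powR1.
have : (pi_pq p q <= Lnorm01 p (derive1 (fun x => (c * u x)%R)))%E.
  by apply: ereal_inf_lbound; exists (fun x => c * u x).
have cdu := smooth1_continuous (smooth1_derive1 su).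
rewrite (derive1Z_smooth c su) /Lnorm01 (LE p _ p0 cdu).
rewrite -/B bE -EFinM poweR_EFin => pile.
have pi0 := pi_pq_ge0 p q.
have pifin : pi_pq p q \is a fin_num.
  by rewrite ge0_fin_numE// (le_lt_trans pile)// ltry.
have [P PE] : exists P, pi_pq p q = P%:E by exists (fine (pi_pq p q)); rewrite fineK.
move: pile pi0; rewrite aE PE !poweR_EFin -EFinM !lee_fin => pile P0.
have cb : 0 <= c `^ p * b by rewrite mulr_ge0// powR_ge0.
have : P `^ p <= c `^ p * b.
  have := ge0_ler_powR (ltW p0) P0 (powR_ge0 _ _) pile.
  by rewrite -powRrM mulVf ?gt_eqF// powRr1.
rewrite /c -powRrM mulNr powRN -[q^-1 * p]mulrC ler_pdivlMl ?powR_gt0//.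
by rewrite [leLHS]mulrC.
Qed.

End one_dimensional_constant.

Section plateau.
Context {R : realType}.
Implicit Types (L x : R).

(** A cut-off for (0,L) that is 1 on [2, L-2] and 0 off [1, L-1]. Its transitions have unit length
    for every L, so its slope is bounded independently of L. *)
Definition plateau L x : R := smooth_step (x - 1) * smooth_step (L - 1 - x).

Lemma smooth1_plateau L : smooth1 (plateau L).
Proof.
apply: smooth1M.
  apply: (@smooth1_comp _ smooth_step (fun x => x - 1)).
    exact: smooth1_smooth_step.
  exact: (smooth1D smooth1_id (smooth1_cst (- 1))).
apply: (@smooth1_comp _ smooth_step (fun x => (L - 1) - x)).
  exact: smooth1_smooth_step.
exact: (smooth1D (smooth1_cst (L - 1)) (smooth1N smooth1_id)).
Qed.

Lemma plateau_ge0 L x : 0 <= plateau L x.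
Proof. by rewrite mulr_ge0// smooth_step_ge0. Qed.

Lemma plateau_le1 L x : plateau L x <= 1.
Proof. by rewrite mulr_ile1// (smooth_step_ge0, smooth_step_le1). Qed.

Lemma plateau_eq1 L x : 2 <= x <= L - 2 -> plateau L x = 1.
Proof.
by move=> /andP[x2 xL]; rewrite /plateau !smooth_step_eq1 ?mulr1//; lra.
Qed.

Lemma plateau_eq0 L x : ~ `[1, L - 1]%classic x -> plateau L x = 0.
Proof.
rewrite /= in_itv /= => /negP; rewrite negb_and -!ltNge => /orP[x1|xL].
  by rewrite /plateau smooth_step_eq0 ?mul0r//; lra.
by rewrite /plateau (@smooth_step_eq0 _ (L - 1 - x)) ?mulr0//; lra.
Qed.

Lemma derive1_smooth_step_bounded :
  exists M : R, forall x, `|derive1 smooth_step x| <= M.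
Proof.
have sd := smooth1_derive1 (@smooth1_smooth_step R).
have [C [C0 HC]] := continuous_bounded_itv 0 1 (smooth1_continuous sd).
exists C => x.
have [|x01] := boolP (x \in `[0, 1]).
  by rewrite in_itv /= => /andP[]; exact: HC.
have loc (c : R) : (\forall y \near x, c = smooth_step y) -> derive1 smooth_step x = 0.
  move=> near_c; rewrite derive1E.
  by apply: derive_val; apply: near_eq_is_derive near_c (is_derive_cst c x 1).
rewrite (_ : derive1 _ x = 0) ?normr0//.
move: x01; rewrite in_itv /= negb_and -!ltNge => /orP[x0|x1].
  apply: (loc 0); near=> y; rewrite smooth_step_eq0//.
  by near: y; exact: lt_le_nbhsl.
apply: (loc 1); near=> y; rewrite smooth_step_eq1//.
by apply: ltW; near: y; exact: lt_nbhsr.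
Unshelve. all: by end_near. Qed.

Lemma derive1_plateau_bounded :
  exists M : R, forall L x, `|derive1 (plateau L) x| <= M.
Proof.
have [M HM] := derive1_smooth_step_bounded.
exists (M + M) => L x.
have d1 : is_derive x 1 (smooth_step \o (fun x => x - 1))
    (derive1 smooth_step (x - 1) * (1 - 0)).
  by apply: is_derive1_comp; exact: (smooth1_is_derive _ smooth1_smooth_step).
have d2 : is_derive x 1 (smooth_step \o (fun x => L - 1 - x))
    (derive1 smooth_step (L - 1 - x) * (0 - 1)).
  by apply: is_derive1_comp; exact: (smooth1_is_derive _ smooth1_smooth_step).
have d12 := is_deriveM d1 d2.
rewrite derive1E (@derive_val _ _ _ _ _ _ _ d12) /GRing.scale /=.
have key a b : `|b| <= M -> `|smooth_step a * b| <= M.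
  move=> bM; rewrite normrM (ger0_norm (smooth_step_ge0 _)).
  by apply: le_trans bM; rewrite ler_piMl// smooth_step_le1.
apply: le_trans (ler_normD _ _) _.
by apply: lerD; apply: key; rewrite ?subr0 ?sub0r ?mulr1 ?mulrN1 ?normrN.
Qed.

End plateau.

Section one_sided_inequality.
Context {R : realType}.
Implicit Types (f g u w F : R -> R) (a b p q : R).
Local Notation mu := (@lebesgue_measure R).

(** A single competitor of positive norm suffices, since an infinite constant would contradict
    [pi_pq_le] for it. The function [plateau 8] stretched by 8 is supported in [1/8, 7/8] and equals
    1 on [1/4, 3/4]. *)
Lemma pi_pq_fin_num p q : 0 < p -> 0 < q -> (pi_pq p q : \bar R) \is a fin_num.
Proof.
move=> p0 q0; rewrite ge0_fin_numE ?pi_pq_ge0//.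
pose u : R -> R := plateau 8 \o (fun x => 8 * x).
have su : smooth1 u.
  apply: smooth1_comp; first exact: smooth1_plateau.
  exact: (smooth1M (smooth1_cst 8) smooth1_id).
have cu : Cc_infty1 `]0, 1[ u.
  split=> //; exists `[8^-1, 1 - 8^-1]%classic.
    split; first exact: segment_compact.
    by move=> x /=; rewrite !in_itv /= => /andP[? ?]; apply/andP; split; lra.
  move=> x /= x8; apply: plateau_eq0; move: x8; rewrite /= !in_itv /=.
  by move=> H1 /andP[? ?]; apply: H1; apply/andP; split; lra.
have := pi_pq_le p0 q0 cu.
set A := (\int[mu]_(x in _) _)%E; set B := (\int[mu]_(x in _) _)%E => AB.
have Bfin : B \is a fin_num.
  apply: (@continuous_integral_fin _ _ _ (fun x => `|derive1 u x| `^ p)).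
  by apply: continuous_powR_comp => //; exact/smooth1_continuous/smooth1_derive1.
pose D : set R := `[4^-1, 1 - 4^-1]%classic.
have A0 : (0 < A)%E.
  apply: (@lt_le_trans _ _ (\int[mu]_(x in D) (1%:E))%E).
    rewrite integral_cst; last exact: measurable_itv.
    have muD : mu D = (2^-1)%:E.
      rewrite lebesgue_measure_itv /= lte_fin ifT; last lra.
      by rewrite -EFinB; congr EFin; lra.
    by rewrite [X in (_ * X)%E]muD mule_gt0// lte_fin; lra.
  apply: (@le_trans _ _ (\int[mu]_(x in D) (`|u x| `^ q)%:E)%E).
    rewrite le_eqVlt; apply/orP; left; apply/eqP; apply: eq_integral => x.
    rewrite inE /D /= in_itv /= => /andP[? ?].
    by rewrite /u /= plateau_eq1 ?normr1 ?powR1//; apply/andP; split; lra.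
  apply: ge0_subset_integral => //.
  - exact: measurable_itv.
  - exact: (continuous_EFin_measurable (measurable_itv _)
      (continuous_powR_comp q0 (smooth1_continuous su))).
  - by move=> x; rewrite /D /= !in_itv /= => /andP[? ?]; apply/andP; split; lra.
rewrite ltey; apply/negP => /eqP piy; move: AB.
rewrite piy poweRyr ?gt_eqF// gt0_mulye; last exact: poweR_gt0.
by rewrite leye_eq => /eqP By; move: Bfin; rewrite By.
Qed.

(** The tent runs through the unit interval twice, each time at speed 2. *)
Lemma ge0_integral_tent F : continuous F -> (forall x, 0 <= F x) ->
  (\int[mu]_(x in `]0%R, 1%R[) (F (1 - `|2 * x - 1|))%:E =
   \int[mu]_(x in `]0%R, 1%R[) (F x)%:E)%E.
Proof.
move=> cF F0.
have b1 (x : R) : x <= 2^-1 -> (0 < 2 * x + 0 <= 1) = (0 < x < 1).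
  by move=> ?; apply/idP/idP => /andP[? ?]; apply/andP; split; lra.
have b2 (x : R) : x <= 2^-1 -> (0 < - 2 * x + 2 < 1) = false.
  by move=> ?; apply/negP => /andP[? ?]; lra.
have b3 (x : R) : 2^-1 < x -> (0 < 2 * x + 0 <= 1) = false.
  by move=> ?; apply/negP => /andP[? ?]; lra.
have b4 (x : R) : 2^-1 < x -> (0 < - 2 * x + 2 < 1) = (0 < x < 1).
  by move=> ?; apply/idP/idP => /andP[? ?]; apply/andP; split; lra.
have t1 (x : R) : x <= 2^-1 -> 1 - `|2 * x - 1| = 2 * x + 0.
  by move=> ?; rewrite ler0_norm; lra.
have t2 (x : R) : 2^-1 < x -> 1 - `|2 * x - 1| = - 2 * x + 2.
  by move=> ?; rewrite ger0_norm; lra.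
have half : 2^-1 + 2^-1 = 1 :> R by lra.
pose G (D : set R) x := (\1_D x * F x)%:E.
(* The rising half takes the closed end and the falling half the open one, so that the midpoint 1/2
   is counted exactly once. *)
pose I1 : set R := `]0, 1]%classic; pose I2 : set R := `]0, 1[%classic.
have mG (D : set R) : measurable (D : set (measurableTypeR R)) ->
    measurable_fun [set: measurableTypeR R] (G D).
  move=> mD; apply/measurable_EFinP; apply: measurable_funM.
    exact: measurable_indic.
  exact: continuous_measurable_fun.
have G0 (D : set R) x : (0 <= G D x)%E by rewrite lee_fin mulr_ge0.
have intG (D : set R) : measurable (D : set (measurableTypeR R)) ->
    (\int[mu]_(x in D) (F x)%:E = \int[mu]_x G D x)%E.
  move=> mD; rewrite integral_mkcond; apply: eq_integral => x _.
  by rewrite patchE /G indicE; case: ifP => _; rewrite ?mul1r ?mul0r.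
have mI1 : measurable (I1 : set (measurableTypeR R)) by exact: measurable_itv.
have mI2 : measurable (I2 : set (measurableTypeR R)) by exact: measurable_itv.
have G12 : (\int[mu]_x G I1 x = \int[mu]_x G I2 x)%E.
  rewrite -!intG//; apply/esym/integral_itv_bndo_bndc.
  exact: continuous_EFin_measurable.
have ntw : - 2 != 0 :> R by rewrite oppr_eq0.
have tw : 2 != 0 :> R by [].
have e1 := ge0_integral_affine 0 tw (mG _ mI1) (G0 _).
have e2 := ge0_integral_affine 2 ntw (mG _ mI2) (G0 _).
rewrite [LHS](_ : _ =
    \int[mu]_x (G I1 (2 * x + 0)%R + G I2 (- 2 * x + 2)%R))%E; last first.
  rewrite integral_mkcond; apply: eq_integral => x _.
  rewrite patchE /G /I1 /I2 !indicE -EFinD mem_setE.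
  rewrite !mem_setE !in_itv /=.
  have [x2|x2] := leP x 2^-1.
    rewrite b1// b2// t1//.
    by case: ifP => _; rewrite !(mul0r, mul1r, addr0).
  rewrite b3// b4// t2//.
  by case: ifP => _; rewrite !(mul0r, mul1r, add0r).
rewrite ge0_integralD//; last 2 first.
- by apply: measurableT_comp (mG _ mI1) _; exact: measurable_affine.
- by apply: measurableT_comp (mG _ mI2) _; exact: measurable_affine.
rewrite intG//.
move: e1 e2; rewrite G12 normrN !normr_nat.
set X := (\int[mu]_x G I2 x)%E; set Y1 := (\int[mu]_x G I1 _)%E.
set Y2 := (\int[mu]_x G I2 (- 2 * x + 2)%R)%E => X1 X2.
have hX (Y : \bar R) : X = (2%:E * Y)%E -> Y = ((2^-1)%:E * X)%E.
  by move=> ->; rewrite muleA -EFinM mulVf// mul1e.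
rewrite (hX _ X1) (hX _ X2) -ge0_muleDl ?lee_fin//.
by rewrite -EFinD half mul1e.
Qed.

End one_sided_inequality.

Section one_sided_inequality_limit.
Context {R : realType}.
Implicit Types (f g u w F : R -> R) (p q e x : R).
Local Notation mu := (@lebesgue_measure R).

                                                                                 
(** The tent 1 - |2x - 1| with its corner rounded off. It stays below the tent and its slope stays
    within 2, so composing it with a function that vanishes near 0 and to its left gives an
    admissible competitor on (0,1). *)
Definition smooth_tent e x : R :=
  1 - Num.sqrt ((2 * x - 1) * (2 * x - 1) + e * e).

Let under_sqrt_gt0 e x : 0 < e -> 0 < (2 * x - 1) * (2 * x - 1) + e * e.
Proof. by move=> e0; rewrite ltr_wpDl ?mulr_gt0// -expr2 sqr_ge0. Qed.

Let under_sqrt_smooth e :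
  smooth1 (fun x : R => (2 * x - 1) * (2 * x - 1) + e * e).
Proof.
have s1 : smooth1 (fun x : R => 2 * x - 1).
  exact: (smooth1D (smooth1M (smooth1_cst 2) smooth1_id) (smooth1_cst (- 1))).
exact: (smooth1D (smooth1M s1 s1) (smooth1_cst (e * e))).
Qed.

Lemma smooth1_smooth_tent e : 0 < e -> smooth1 (smooth_tent e).
Proof.
move=> e0; apply: (smooth1D (smooth1_cst 1)); apply: smooth1N.
apply: smooth1_sqrt => //; move=> x; exact: under_sqrt_gt0.
Qed.

Lemma smooth_tent_le e x : smooth_tent e x <= 1 - `|2 * x - 1|.
Proof.
by rewrite lerD2l lerN2 -sqrtr_sqr expr2 ler_wsqrtr// lerDl -expr2 sqr_ge0.
Qed.

Lemma derive1_smooth_tent_le e x : 0 < e -> `|derive1 (smooth_tent e) x| <= 2.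
Proof.
move=> e0; have s0 := under_sqrt_gt0 x e0.
have d1 : is_derive x (1 : R) (fun x : R => 2 * x - 1) (2 *: 1 - 0).
  exact: is_deriveB.
have d2 := is_deriveD (is_deriveM d1 d1) (is_derive_cst (e * e) x (1 : R)).
have d3 := @is_derive1_comp _ Num.sqrt
  (fun x : R => (2 * x - 1) * (2 * x - 1) + e * e) _ _ _ (is_derive1_sqrt s0) d2.
have d4 := is_deriveB (is_derive_cst (1 : R) x (1 : R)) d3.
rewrite derive1E (@derive_val _ _ _ _ _ _ _ d4) /GRing.scale /=.
set y := 2 * x - 1 in s0 *; set s := y * y + e * e in s0 *.
have -> : 0 - (2 * Num.sqrt s)^-1 * (y * (2 * 1 - 0) + y * (2 * 1 - 0) + 0) =
    - (2 * (y / Num.sqrt s)).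
  by field; rewrite gt_eqF// sqrtr_gt0.
rewrite normrN normrM ger0_norm// -[leRHS]mulr1 ler_wpM2l//.
rewrite normrM normfV ler_pdivrMr ?normr_gt0 ?gt_eqF ?sqrtr_gt0//.
rewrite mul1r [leRHS]ger0_norm ?sqrtr_ge0// -sqrtr_sqr expr2.
by rewrite ler_wsqrtr// lerDl -expr2 sqr_ge0.
Qed.

(** Dominated convergence. The rounded tent takes negative values near the ends of the interval; the
    vanishing of F there is what gives a constant bound on all of its range. *)
Lemma cvg_integral_smooth_tent F : continuous F -> (forall x, 0 <= F x) ->
  (forall x, x <= 0 -> F x = 0) ->
  (\int[mu]_(x in `]0%R, 1%R[) (F (smooth_tent n.+1%:R^-1 x))%:E)%E @[n --> \oo]
  --> (\int[mu]_(x in `]0%R, 1%R[) (F x)%:E)%E.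
Proof.
move=> cF F0 Fneg.
have [M FM] : exists M, forall x, x <= 1 -> F x <= M.
  have [C [C0 FC]] := continuous_bounded_itv 0 1 cF; exists C => x x1.
  have [/Fneg ->//|x0] := leP x 0.
  by apply: le_trans (ler_norm _) _; exact: FC (ltW x0) x1.
rewrite -ge0_integral_tent//.
have ctent n : continuous (fun x => F (smooth_tent n.+1%:R^-1 x)).
  move=> x; apply: (@continuous_comp _ _ _ (smooth_tent n.+1%:R^-1) F).
    by apply: smooth1_continuous; exact: smooth1_smooth_tent.
  exact: cF.
apply: (@dominated_cvg _ _ _ mu _ (measurable_itv _) _ _ (cst M%:E)).
- by move=> n; apply: continuous_EFin_measurable => //; exact: ctent.
- move=> x _.
  have he : (n.+1%:R^-1 * n.+1%:R^-1 : R) @[n --> \oo] --> (0 : R).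
    by rewrite -[X in _ --> X](mulr0 0); apply: cvgM; exact: cvg_harmonic.
  have hs : ((2 * x - 1) * (2 * x - 1) + n.+1%:R^-1 * n.+1%:R^-1 : R) @[n --> \oo]
      --> ((2 * x - 1) ^+ 2 : R).
    rewrite -[X in _ --> X]addr0 expr2.
    exact: (cvgD (cvg_cst _) he).
  have hr := continuous_cvg _ (@sqrt_continuous R ((2 * x - 1) ^+ 2)) hs.
  rewrite sqrtr_sqr in hr.
  have ht : smooth_tent n.+1%:R^-1 x @[n --> \oo] --> (1 - `|2 * x - 1|).
    by rewrite /smooth_tent; apply: cvgB; [exact: cvg_cst|exact: hr].
  apply/fine_cvgP; split; first by apply: nearW => n.
  exact: (continuous_cvg _ (cF (1 - `|2 * x - 1|)) ht).
- by [].
- apply: (@integrableS _ _ _ mu `[0, 1]%classic) => //.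
    by apply: subset_itvW; rewrite bnd_simp.
  apply: (@continuous_compact_integrable _ (cst M)); first exact: segment_compact.
  by apply: continuous_subspaceT => x; exact: cvg_cst.
- move=> n x _; rewrite lee_fin /= ger0_norm//; apply: FM.
  apply: le_trans (smooth_tent_le _ _) _.
  by rewrite gerBl.
Qed.

Lemma le_integral_continuousZ (a b c : R) f g : continuous f -> continuous g ->
  0 <= c -> (forall x, 0 <= f x) -> (forall x, 0 <= g x) ->
  (forall x, f x <= c * g x) ->
  (\int[mu]_(x in `]a, b[) (f x)%:E <=
   c%:E * \int[mu]_(x in `]a, b[) (g x)%:E)%E.
Proof.
move=> cf cg c0 f0 g0 fg.
have mab : measurable (`]a, b[%classic : set (measurableTypeR R)).
  exact: measurable_itv.
have mf := continuous_EFin_measurable mab cf.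
have mg := continuous_EFin_measurable mab cg.
rewrite -ge0_integralZl//; last by move=> x _; rewrite lee_fin.
apply: (@ge0_le_integral _ _ _ mu) => //.
- by move=> x _; rewrite lee_fin.
- exact: measurable_funeM mg.
- by move=> x _; rewrite -EFinM lee_fin.
Qed.

(** Reflection across the free endpoint 1. The function w composed with the tent vanishes near both
    ends of (0,1), has the same L^q integral as w, and its derivative is at most 2|w'| composed with
    the tent. Since the tent is not smooth, the inequality is proved for [smooth_tent] with e =
    1/(n+1) and passed to the limit. *)
Lemma one_sided_ineq p q w (d a b : R) : 0 < p -> 0 < q -> smooth1 w -> 0 < d ->
  (forall t, t <= d -> w t = 0) ->
  (\int[mu]_(x in `]0%R, 1%R[) (`|w x| `^ q)%:E)%E = a%:E ->
  (\int[mu]_(x in `]0%R, 1%R[) (`|derive1 w x| `^ p)%:E)%E = b%:E ->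
  (fine (pi_pq p q) / 2) `^ p * a `^ (p / q) <= b.
Proof.
move=> p0 q0 sw d0 wd aE bE.
have sw' := smooth1_derive1 sw.
have w'0 t : t <= 0 -> derive1 w t = 0.
  move=> t0; rewrite derive1E; apply: derive_val.
  apply: near_eq_is_derive (is_derive_cst 0 t (1 : R)).
  near=> s; rewrite wd//; apply: ltW; near: s; apply: lt_nbhsl.
  exact: le_lt_trans d0.
pose A n := (\int[mu]_(x in `]0%R, 1%R[)
  (`|w (smooth_tent n.+1%:R^-1 x)| `^ q)%:E)%E.
pose B n := (\int[mu]_(x in `]0%R, 1%R[)
  (`|derive1 w (smooth_tent n.+1%:R^-1 x)| `^ p)%:E)%E.
have cA : A n @[n --> \oo] --> a%:E.
  rewrite -aE; apply: (@cvg_integral_smooth_tent (fun x => `|w x| `^ q)).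
  - exact: (continuous_powR_comp q0 (smooth1_continuous sw)).
  - by move=> x; exact: powR_ge0.
  - move=> x x0; rewrite wd ?normr0 ?powR0 ?gt_eqF//.
    exact: le_trans (ltW d0).
have cB : B n @[n --> \oo] --> b%:E.
  rewrite -bE; apply: (@cvg_integral_smooth_tent (fun x => `|derive1 w x| `^ p)).
  - exact: (continuous_powR_comp p0 (smooth1_continuous sw')).
  - by move=> x; exact: powR_ge0.
  - by move=> x x0; rewrite w'0 ?normr0 ?powR0 ?gt_eqF.
have cont_q := continuous_powR_comp q0 (smooth1_continuous sw).
have cont_p := continuous_powR_comp p0 (smooth1_continuous sw').
have key n : (fine (pi_pq p q)) `^ p * (fine (A n)) `^ (p / q) <=
    2 `^ p * fine (B n).
  set e : R := n.+1%:R^-1; have e0 : 0 < e by rewrite invr_gt0.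
  have st := smooth1_smooth_tent e0.
  have su : smooth1 (w \o smooth_tent e) by exact: smooth1_comp.
  have cu : Cc_infty1 `]0, 1[ (w \o smooth_tent e).
    split=> //; exists `[d / 2, 1 - d / 2]%classic.
      split; first exact: segment_compact.
      by move=> x /=; rewrite !in_itv /= => /andP[? ?]; apply/andP; split; lra.
    move=> x /= xd; apply: wd; apply: le_trans (smooth_tent_le _ _) _.
    (* Outside [d/2, 1 - d/2] the tent is at most d, where w vanishes. *)
    have [x2|x2] := leP (d / 2) x.
      rewrite lerBlDr -lerBlDl; apply: le_trans (ler_norm _).
      by move: xd; rewrite in_itv /= x2 /= => /negP; rewrite -ltNge => ?; lra.
    by rewrite lerBlDr -lerBlDl -normrN; apply: le_trans (ler_norm _); lra.
  have derE x : derive1 (w \o smooth_tent e) x =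
      derive1 w (smooth_tent e x) * derive1 (smooth_tent e) x.
    rewrite derive1E; apply: derive_val; apply: is_derive1_comp.
      exact: smooth1_is_derive.
    exact: smooth1_is_derive.
  have cwt : continuous (fun x => `|w (smooth_tent e x)| `^ q).
    exact: (continuous_powR_comp q0 (smooth1_continuous su)).
  have cw't : continuous (fun x => `|derive1 w (smooth_tent e x)| `^ p).
    have := smooth1_comp sw' st; move=> /smooth1_continuous.
    exact: continuous_powR_comp.
  have Afin : A n \is a fin_num by exact: (continuous_integral_fin _ _ cwt).
  have Bfin : B n \is a fin_num by exact: (continuous_integral_fin _ _ cw't).
  have := pi_pq_le p0 q0 cu; rewrite -[X in (_ * X `^ _)%E]/(A n).
  set B' := (\int[mu]_(x in _) _)%E => AB'.
  have cu' := continuous_powR_comp p0 (smooth1_continuous (smooth1_derive1 su)).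
  have B'B : (B' <= (2 `^ p)%:E * B n)%E.
    apply: (le_integral_continuousZ 0 1 cu' cw't); first exact: powR_ge0.
    - by move=> x; exact: powR_ge0.
    - by move=> x; exact: powR_ge0.
    - move=> x; rewrite derE normrM mulrC powRM//.
      rewrite ler_wpM2r ?powR_ge0//; apply: ge0_ler_powR.
      + exact: ltW.
      + by rewrite nnegrE.
      + by rewrite nnegrE.
      + exact: derive1_smooth_tent_le.
  have := le_trans AB' B'B.
  rewrite -{1}(fineK (pi_pq_fin_num p0 q0)) -{1}(fineK Afin) -{1}(fineK Bfin).
  by rewrite !poweR_EFin -!EFinM lee_fin.
have a0 : 0 <= a.
  rewrite -lee_fin -aE; apply: integral_ge0 => x _.
  by rewrite lee_fin powR_ge0.
have pq0 : 0 < p / q by rewrite divr_gt0.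
have A0 n : 0 <= fine (A n).
  by apply: fine_ge0; apply: integral_ge0 => x _; rewrite lee_fin powR_ge0.
have lA : (fine (pi_pq p q)) `^ p * `|fine (A n)| `^ (p / q) @[n --> \oo] -->
    (fine (pi_pq p q)) `^ p * `|a| `^ (p / q).
  apply: cvgM; first exact: cvg_cst.
  have h := continuous_cvg _ (@continuous_norm_powR R _ pq0 a) (fine_cvg cA).
  exact: h.
have lB : 2 `^ p * fine (B n) @[n --> \oo] --> 2 `^ p * b.
  by apply: cvgM; [exact: cvg_cst|exact: fine_cvg cB].
have := ler_cvg_to lA lB; rewrite ger0_norm// => h.
have {}h : fine (pi_pq p q) `^ p * a `^ (p / q) <= 2 `^ p * b.
  by apply: h; apply: nearW => n; rewrite ger0_norm.
have P0 : 0 <= fine (pi_pq p q) by exact/fine_ge0/pi_pq_ge0.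
rewrite powRM ?invr_ge0// -powR_inv1// -powRrM mulN1r powRN.
by rewrite mulrAC ler_pdivrMr ?powR_gt0// [b * _]mulrC.
Unshelve. all: by end_near. Qed.

End one_sided_inequality_limit.

Section slice_inequality.
Context {R : realType}.
Implicit Types (p q : R).
Local Notation mu := (@lebesgue_measure R).

(** Young's inequality for y and k^(s-1) with exponents s and s/(s-1). Geometrically, the convex
    function y^s lies above its tangent at k. *)
Lemma powR_tangent_le (s y k : R) : 1 < s -> 0 <= y -> 0 <= k ->
  s * k `^ (s - 1) * y <= y `^ s + (s - 1) * k `^ s.
Proof.
move=> s1 y0 k0.
have s0 : 0 < s by lra.
have s10 : 0 < s - 1 by lra.
have := @conjugate_powR R y (k `^ (s - 1)) s (s / (s - 1)) y0 (powR_ge0 _ _) s0.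
move=> /(_ (divr_gt0 s0 s10)).
have -> : s^-1 + (s / (s - 1))^-1 = 1 by field; rewrite ?gt_eqF.
move=> /(_ erefl); rewrite -powRrM.
have -> : (s - 1) * (s / (s - 1)) = s by field; rewrite gt_eqF.
rewrite -(ler_pM2l s0) => h; apply: le_trans (le_trans h _).
  by rewrite le_eqVlt; apply/orP; left; apply/eqP; ring.
by rewrite le_eqVlt; apply/orP; left; apply/eqP; field; rewrite ?gt_eqF.
Qed.

Lemma integral_scale_itv (l : R) (f : R -> R) : 0 < l -> continuous f ->
  (forall x, 0 <= f x) ->
  (\int[mu]_(x in `]0%R, l[) (f x)%:E =
   l%:E * \int[mu]_(x in `]0%R, 1%R[) (f (l * x)%R)%:E)%E.
Proof.
move=> l0 cf f0.
pose G (D : set R) x := (\1_D x * f x)%:E.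
pose I : set R := `]0, l[%classic.
have mI : measurable (I : set (measurableTypeR R)) by exact: measurable_itv.
have mG : measurable_fun [set: measurableTypeR R] (G I).
  apply/measurable_EFinP; apply: measurable_funM.
    exact: measurable_indic.
  exact: continuous_measurable_fun.
have lE (x : R) : (0 < l * x + 0 < l) = (0 < x < 1).
  by rewrite addr0 pmulr_rgt0// gtr_pMr.
have G0 x : (0 <= G I x)%E by rewrite lee_fin mulr_ge0.
have ln0 : l != 0 by rewrite gt_eqF.
transitivity (\int[mu]_x G I x)%E.
  rewrite integral_mkcond; apply: eq_integral => x _.
  by rewrite patchE /G /I indicE; case: ifP => _; rewrite ?mul1r ?mul0r.
rewrite (ge0_integral_affine 0 ln0 mG G0) gtr0_norm//; congr *%E.
rewrite [RHS]integral_mkcond; apply: eq_integral => x _.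
rewrite patchE /G /I indicE !mem_setE !in_itv /= lE addr0.
by case: ifP => _; rewrite ?mul1r ?mul0r.
Qed.

(** Let a and b be the means of |v|^q and |v'|^p over (0,l). Rescaling to the unit interval turns
    [one_sided_ineq] into (pi/2)^p a^(p/q) <= l^p b, and l <= r replaces l^p by r^p. Bounding
    a^(p/q) from below by its tangent at k and multiplying by l gives an estimate affine in the
    integrals and in l, with coefficients common to all slices. *)
Lemma slice_ineq p q (v : R -> R) (d l r k M : R) :
  1 <= q -> q < p -> smooth1 v -> 0 < d -> (forall t, t <= d -> v t = 0) ->
  0 < l -> l <= r -> 0 <= k ->
  M = (fine (pi_pq p q) / 2) `^ p * r `^ (- p) ->
  ((M * (p / q * k `^ (p / q - 1)))%:E *
     \int[mu]_(t in `]0%R, l[) (`|v t| `^ q)%:E <=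
   \int[mu]_(t in `]0%R, l[) (`|derive1 v t| `^ p)%:E +
   (M * ((p / q - 1) * k `^ (p / q)) * l)%:E)%E.
Proof.
move=> q1 qp sv d0 vd l0 lr k0 ME.
have q0 : 0 < q by lra.
have p0 : 0 < p by lra.
have s1 : 1 < p / q by rewrite ltr_pdivlMr// mul1r.
have r0 : 0 < r by exact: lt_le_trans l0 lr.
have cq := continuous_powR_comp q0 (smooth1_continuous sv).
have cp := continuous_powR_comp p0 (smooth1_continuous (smooth1_derive1 sv)).
have sl : smooth1 (fun x => l * x) by exact: (smooth1M (smooth1_cst l) smooth1_id).
have sw : smooth1 (v \o (fun x => l * x)) by exact: smooth1_comp.
have wE x : derive1 (v \o (fun x => l * x)) x = l * derive1 v (l * x).
  rewrite derive1E; apply: derive_val; rewrite mulrC.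
  apply: is_derive1_comp; first exact: smooth1_is_derive.
  have := is_deriveZ l (is_derive_id x (1 : R)).
  by rewrite /GRing.scale /= mulr1.
have wd t : t <= d / l -> (v \o (fun x => l * x)) t = 0.
  by move=> tl; rewrite /= vd// -ler_pdivlMl// mulrC.
have [a aE] : exists a, (\int[mu]_(x in `]0%R, 1%R[)
    (`|v (l * x)| `^ q)%:E)%E = a%:E.
  eexists; apply/esym/fineK.
  exact: (continuous_integral_fin _ _
    (continuous_powR_comp q0 (smooth1_continuous sw))).
have [b bE] : exists b, (\int[mu]_(x in `]0%R, 1%R[)
    (`|derive1 v (l * x)| `^ p)%:E)%E = b%:E.
  eexists; apply/esym/fineK.
  exact: (continuous_integral_fin _ _ (continuous_powR_comp p0
    (smooth1_continuous (smooth1_comp (smooth1_derive1 sv) sl)))).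
have bE' : (\int[mu]_(x in `]0%R, 1%R[)
    (`|derive1 (v \o (fun x => l * x)) x| `^ p)%:E)%E = (l `^ p * b)%:E.
  rewrite EFinM -bE -ge0_integralZl//.
  - by apply: eq_integral => x _; rewrite wE normrM powRM// (gtr0_norm l0).
  - apply: continuous_EFin_measurable; first exact: measurable_itv.
    exact: (continuous_powR_comp p0
      (smooth1_continuous (smooth1_comp (smooth1_derive1 sv) sl))).
  - by rewrite lee_fin powR_ge0.
have a0 : 0 <= a.
  rewrite -lee_fin -aE; apply: integral_ge0 => x _.
  by rewrite lee_fin powR_ge0.
have h := one_sided_ineq p0 q0 sw (divr_gt0 d0 l0) wd aE bE'.
rewrite (integral_scale_itv l0 cq); last by move=> x; exact: powR_ge0.
rewrite (integral_scale_itv l0 cp); last by move=> x; exact: powR_ge0.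
rewrite aE bE -!EFinM -EFinD lee_fin.
have M0 : 0 <= M by rewrite ME mulr_ge0 ?powR_ge0.
have Mb : M * a `^ (p / q) <= b.
  rewrite ME mulrAC powRN ler_pdivrMr ?powR_gt0//.
  apply: le_trans h _; rewrite mulrC ler_wpM2l//.
    rewrite -lee_fin -bE; apply: integral_ge0 => x _.
    by rewrite lee_fin powR_ge0.
  by apply: ge0_ler_powR => //; rewrite ?nnegrE ?ltW.
have tl := powR_tangent_le s1 a0 k0.
have {}tl : M * (p / q * k `^ (p / q - 1)) * a <=
    b + M * ((p / q - 1) * k `^ (p / q)).
  rewrite -mulrA; apply: le_trans (ler_wpM2l M0 tl) _.
  by rewrite mulrDr lerD2r.
rewrite mulrCA (mulrC _ l) -mulrDr.
by apply: ler_wpM2l => //; exact: ltW.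
Qed.

End slice_inequality.

                                

(** * Euclidean norm and directional derivatives *)

Section euclidean_norm.
Context {R : realType} {N : nat}.
Implicit Types u v : 'rV[R]_N.

Definition dot u v : R := \sum_(i < N) u ord0 i * v ord0 i.

Lemma enorm_ge0 v : 0 <= enorm v.
Proof. exact: sqrtr_ge0. Qed.

Lemma enorm_sqr v : enorm v ^+ 2 = \sum_(i < N) v ord0 i ^+ 2.
Proof. by rewrite sqr_sqrtr// sumr_ge0// => i _; exact: sqr_ge0. Qed.

(** The component of v orthogonal to u has nonnegative squared length |v|^2 - (u.v)^2. *)
Lemma dot_unit_le u v : enorm u = 1 -> `|dot u v| <= enorm v.
Proof.
move=> u1; rewrite -sqrtr_sqr ler_wsqrtr// -subr_ge0.
have <- : \sum_(i < N) (v ord0 i - dot u v * u ord0 i) ^+ 2 =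
    \sum_(i < N) v ord0 i ^+ 2 - dot u v ^+ 2.
  transitivity (\sum_(i < N) (v ord0 i ^+ 2 -
      2 * dot u v * (u ord0 i * v ord0 i) + dot u v ^+ 2 * u ord0 i ^+ 2)).
    by apply: eq_bigr => i _; ring.
  by rewrite big_split/= sumrB -!mulr_sumr -(enorm_sqr u) u1 -/(dot u v); ring.
by apply: sumr_ge0 => i _; exact: sqr_ge0.
Qed.

End euclidean_norm.

Section directional_derivatives.
Context {R : realType} {N : nat}.
Implicit Types (f g : 'rV[R]_N -> R) (x y u v w : 'rV[R]_N).

Lemma is_derive_line f y w (t : R) : derivable f (y + t *: w) w ->
  is_derive t (1 : R) (fun s => f (y + s *: w)) ('D_w f (y + t *: w)).
Proof.
move=> df.
have E : (fun h : R => h^-1 *: (((fun s => f (y + s *: w)) \o shift t) (h *: 1) -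
      f (y + t *: w))) =
    (fun h : R => h^-1 *: ((f \o shift (y + t *: w)) (h *: w) - f (y + t *: w))).
  apply/funext => h /=; congr (_ *: (f _ - _)).
  by rewrite [h *: 1]mulr1 scalerDl addrCA.
by apply: DeriveDef; [rewrite /derivable E|rewrite /derive E].
Qed.

Lemma smooth_dderive f v : smooth f -> smooth (fun x => 'D_v f x).
Proof.
move=> sf vs.
have : iter_dderive vs (fun x => 'D_v f x) = iter_dderive (rcons vs v) f.
  by elim: vs => [//|a vs IH] /=; rewrite IH.
by move=> ->; exact: sf.
Qed.

Lemma smooth_continuous f : smooth f -> continuous f.
Proof. by move=> /(_ [::])[]. Qed.

Lemma smooth_derivable f x v : smooth f -> derivable f x v.
Proof. by move=> /(_ [::])[_]; exact. Qed.

Lemma derive1_line f y w : smooth f ->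
  derive1 (fun s => f (y + s *: w)) = fun s => 'D_w f (y + s *: w).
Proof.
move=> sf; apply: derive1_is_derive => t.
by apply: is_derive_line; exact: smooth_derivable.
Qed.

Lemma smooth1_line f y w : smooth f -> smooth1 (fun s => f (y + s *: w)).
Proof.
move=> sf; apply/smooth1P => k; elim: k f sf => [//|k IH] f sf.
exists (fun s => 'D_w f (y + s *: w)); last exact: IH _ (@smooth_dderive f w sf).
by move=> t; apply: is_derive_line; exact: smooth_derivable.
Qed.

Lemma dderiveZ f x w (c : R) : smooth f -> 'D_(c *: w) f x = c * 'D_w f x.
Proof.
move=> sf.
have h1 := smooth1_is_derive 0 (smooth1_line x (c *: w) sf).
rewrite (derive1_line _ _ sf) scale0r addr0 in h1.
have h2 := smooth1_is_derive (c * 0) (smooth1_line x w sf).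
rewrite (derive1_line _ _ sf) mulr0 scale0r addr0 in h2.
have h3 : is_derive (0 : R) (1 : R) (fun t : R => c * t) c.
  have := is_deriveZ c (is_derive_id (0 : R) (1 : R)).
  by rewrite /GRing.scale /= mulr1.
have h4 : is_derive (0 : R) (1 : R)
    ((fun s => f (x + s *: w)) \o (fun t : R => c * t)) ('D_w f x * c).
  by apply: is_derive1_comp => //; rewrite mulr0.
rewrite (_ : (fun s => f (x + s *: (c *: w))) =
  ((fun s => f (x + s *: w)) \o (fun t : R => c * t))) in h1.
  by rewrite -(@derive_val _ _ _ _ _ _ _ h1) mulrC -(@derive_val _ _ _ _ _ _ _ h4).
by apply/funext => s /=; rewrite scalerA mulrC.
Qed.

(** Additivity in the direction rests on the continuity of the derivative along w: the increment
    along h(u + w) is the increment along hu plus, by the mean value theorem, h times the derivative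
    along w at a point close to x. Three errors of size e/3 remain. *)
Lemma dderiveD f x u w : smooth f ->
  'D_(u + w) f x = 'D_u f x + 'D_w f x.
Proof.
move=> sf; apply/eqP; rewrite -subr_eq0 -normr_le0.
apply/ler_addgt0Pl => e e0; rewrite addr0.
have e3 : 0 < e / 3 by lra.
have cvgd v : (h^-1 * (f (x + h *: v) - f x)) @[h --> (0 : R)^'+] --> 'D_v f x.
  apply: cvg_dnbhs_at_right.
  rewrite (_ : (fun h => _) = (fun h => h^-1 *: ((f \o shift x) (h *: v) - f x))).
    exact: (@smooth_derivable f x v sf).
  by apply/funext => h /=; rewrite [x + _]addrC.
have swf := smooth_dderive w sf.
have /nbhs_ballP[d /= d0 dw] : \forall y \near x, `|'D_w f x - 'D_w f y| <= e / 3.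
  by have /cvgrPdist_le := @smooth_continuous _ swf x; exact.
pose B := `|u| + `|w| + 1; have B0 : 0 < B.
  by rewrite ltr_wpDl// addr_ge0.
near (0 : R)^'+ => h.
have h0 : 0 < h by near: h; exact: nbhs_right_gt.
have hB : h * B < d.
  by rewrite -ltr_pdivlMr//; near: h; apply: nbhs_right_lt; rewrite divr_gt0.
have hu : `|'D_u f x - h^-1 * (f (x + h *: u) - f x)| <= e / 3.
  by near: h; have /cvgrPdist_le := cvgd u; exact.
have huw : `|'D_(u + w) f x - h^-1 * (f (x + h *: (u + w)) - f x)| <= e / 3.
  by near: h; have /cvgrPdist_le := cvgd (u + w); exact.
have [c] := @MVT_segment R (fun s => f (x + h *: u + s *: w))
    (fun s => 'D_w f (x + h *: u + s *: w)) 0 h (ltW h0)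
    (fun s _ => is_derive_line (@smooth_derivable f _ w sf))
    (continuous_subspaceT (smooth1_continuous (smooth1_line _ _ sf))).
rewrite in_itv /= scale0r addr0 subr0 => /andP[c0 ch] fE.
have hz : `|'D_w f x - 'D_w f (x + h *: u + c *: w)| <= e / 3.
  apply: dw; rewrite -ball_normE /ball_ /= -addrA opprD addNKr normrN.
  apply: le_lt_trans (ler_normD _ _) _; rewrite !normrZ (gtr0_norm h0) (ger0_norm c0).
  apply: le_lt_trans hB; rewrite /B !mulrDr mulr1.
  by have := ler_wpM2r (normr_ge0 w) ch; move: (h * `|u|) (h * `|w|) => a b; lra.
have QE : h^-1 * (f (x + h *: (u + w)) - f x) =
    'D_w f (x + h *: u + c *: w) + h^-1 * (f (x + h *: u) - f x).
  rewrite scalerDr addrA -(subrKA (f (x + h *: u))) mulrDr fE.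
  by rewrite mulrCA mulVf ?gt_eqF// mulr1.
move: hu huw hz; rewrite QE.
move: ('D_w f (x + h *: u + c *: w)) (h^-1 * (f (x + h *: u) - f x)) => z q.
move: ('D_u f x) ('D_w f x) ('D_(u + w) f x) => a b c'.
rewrite !ler_norml => /andP[? ?] /andP[? ?] /andP[? ?]; apply/andP; split; lra.
Unshelve. all: by end_near. Qed.

Lemma dderive_sum f x (I : Type) (r : seq I) (F : I -> 'rV[R]_N) : smooth f ->
  'D_(\sum_(i <- r) F i) f x = \sum_(i <- r) 'D_(F i) f x.
Proof.
move=> sf; elim: r => [|i r IH]; first by rewrite !big_nil derive0.
by rewrite !big_cons dderiveD// IH.
Qed.

Lemma dderive_le_grad_norm f x v : smooth f -> enorm v = 1 ->
  `|'D_v f x| <= grad_norm f x.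
Proof.
move=> sf v1.
have -> : 'D_v f x = \sum_i v ord0 i * 'D_(delta_mx ord0 i) f x.
  rewrite {1}(row_sum_delta v) dderive_sum//.
  by apply: eq_bigr => i _; rewrite dderiveZ.
rewrite (_ : \sum_i _ = dot v (\row_i 'D_(delta_mx ord0 i) f x)).
  exact: dot_unit_le.
by apply: eq_bigr => i _; rewrite mxE.
Qed.

Lemma continuous_sum_rV (I : Type) (r : seq I) (F : I -> 'rV[R]_N -> R) :
  (forall i, continuous (F i)) -> continuous (fun x => \sum_(i <- r) F i x).
Proof.
move=> cF; elim: r => [|i r IH] x.
  rewrite (_ : (fun y => \sum_(j <- [::]) F j y) = cst 0).
    exact: cst_continuous.
  by apply/funext => y; rewrite big_nil.
rewrite (_ : (fun y => \sum_(j <- i :: r) F j y) = F i \+ (fun y => \sum_(j <- r) F j y)).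
  by apply: continuousD; [exact: cF|exact: IH].
by apply/funext => y; rewrite big_cons.
Qed.

Lemma continuous_enorm_comp (F : 'I_N -> 'rV[R]_N -> R) :
  (forall i, continuous (F i)) -> continuous (fun x => enorm (\row_i F i x)).
Proof.
move=> cF x.
apply: (@continuous_comp _ _ _ (fun x => \sum_(i < N) (\row_i F i x) ord0 i ^+ 2)
  Num.sqrt); last exact: sqrt_continuous.
apply: continuous_sum_rV => i {}x.
rewrite (_ : (fun x => (\row_i F i x) ord0 i ^+ 2) = fun x => F i x * F i x).
  by apply: continuousM; exact: cF.
by apply/funext => y; rewrite mxE expr2.
Qed.

Lemma grad_norm_continuous f : smooth f -> continuous (grad_norm f).
Proof.
move=> sf; apply: continuous_enorm_comp => i.
exact: smooth_continuous (smooth_dderive _ sf).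
Qed.

Lemma enorm_continuous : continuous (@enorm R N).
Proof.
rewrite (_ : @enorm R N = fun x => enorm (\row_i x ord0 i)).
  by apply: continuous_enorm_comp => i; exact: coord_continuous.
by apply/funext => x; congr enorm; apply/rowP => i; rewrite mxE.
Qed.

End directional_derivatives.

                                  

(** * Separating hyperplanes and polytopes between a compact and an open set *)

Section half_spaces.
Context {R : realType}.

Section dot_theory.
Context {n : nat}.
Implicit Types u v w : 'rV[R]_n.

Lemma dotDr u v w : dot u (v + w) = dot u v + dot u w.
Proof. by rewrite -big_split; apply: eq_bigr => i _; rewrite mxE mulrDr. Qed.

Lemma dotZr u (c : R) v : dot u (c *: v) = c * dot u v.
Proof. by rewrite mulr_sumr; apply: eq_bigr => i _; rewrite mxE mulrCA. Qed.

Lemma dotNr u v : dot u (- v) = - dot u v.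
Proof. by rewrite -scaleN1r dotZr mulN1r. Qed.

Lemma dotC u v : dot u v = dot v u.
Proof. by apply: eq_bigr => i _; rewrite mulrC. Qed.

Lemma dotBr u v w : dot u (v - w) = dot u v - dot u w.
Proof. by rewrite dotDr dotNr. Qed.

Lemma dot_sqrB u w (t : R) : dot (u - t *: w) (u - t *: w) =
  dot u u - 2 * t * dot u w + t ^+ 2 * dot w w.
Proof.
rewrite [LHS]dotBr dotZr !(dotC (u - _)) !dotBr !dotZr (dotC w u); ring.
Qed.

Lemma dot_enorm u : dot u u = enorm u ^+ 2.
Proof. by rewrite enorm_sqr; apply: eq_bigr => i _; rewrite -expr2. Qed.

Lemma dot_continuous u : continuous (dot u).
Proof.
apply: continuous_sum_rV => i x.
by apply: continuousM; [exact: cst_continuous|exact: coord_continuous].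
Qed.

Lemma enormZ (c : R) v : enorm (c *: v) = `|c| * enorm v.
Proof.
rewrite /enorm -sqrtr_sqr -sqrtrM ?sqr_ge0//; congr Num.sqrt.
by rewrite mulr_sumr; apply: eq_bigr => i _; rewrite mxE exprMn.
Qed.

Lemma enorm_delta (i : 'I_n) : enorm (delta_mx ord0 i : 'rV[R]_n) = 1.
Proof.
rewrite /enorm (bigD1 i)//= big1 ?addr0; last first.
  by move=> j ji; rewrite mxE eqxx/= (negbTE ji) expr0n.
by rewrite mxE !eqxx expr1n sqrtr1.
Qed.

Lemma coord_le_norm v i : `|v ord0 i| <= `|v|.
Proof.
rewrite -[leRHS]/(mx_norm v) mx_normrE; apply/bigmax_geP; right => /=.
by exists (ord0, i).
Qed.

Lemma coord_le_enorm v i : `|v ord0 i| <= enorm v.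
Proof.
rewrite -sqrtr_sqr ler_wsqrtr// (bigD1 i)//= lerDl sumr_ge0// => j _.
exact: sqr_ge0.
Qed.

Lemma norm_le_enorm v : `|v| <= enorm v.
Proof.
rewrite -[leLHS]/(mx_norm v) mx_normrE; apply/bigmax_leP; split => /=.
  exact: enorm_ge0.
by move=> [i j] _ /=; rewrite ord1; exact: coord_le_enorm.
Qed.

End dot_theory.

Definition convex n (C : set 'rV[R]_n) := forall x y (t : R),
  C x -> C y -> 0 <= t -> t <= 1 -> C (x + t *: (y - x)).

Lemma convex_setP n (C : set 'rV[R]_n) :
  convex_set (C : set (convex_lmodType 'rV[R]_n)) -> convex C.
Proof.
move=> cC x y t Cx Cy t0 t1.
have /set_mem := cC y x (Itv01 t0 t1) (mem_set Cy) (mem_set Cx).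
rewrite /conv /=.
set z := (X in C X -> _); rewrite (_ : z = x + t *: (y - x))//.
transitivity (t *: y + (1 - t) *: x); first by [].
by rewrite scalerBl scale1r scalerBr addrCA addrA.
Qed.

(** The normal a points from y, the point of C nearest to z, to z. Moving from y towards another
    point x of C cannot decrease the distance to z, which forces dot a (x - y) <= 0. *)
Lemma separation_dot n (C : set 'rV[R]_n) (z : 'rV[R]_n) :
  closed C -> bounded_set C -> convex C -> C !=set0 -> ~ C z ->
  exists2 a : 'rV[R]_n, 0 < dot a a & forall x, C x -> dot a x + dot a a <= dot a z.
Proof.
move=> clC bC cC C0 Cz.
have comC := bounded_closed_compact bC clC.
have [|y /set_mem Cy ymin] := @compact_EVT_min _ R (fun x : 'rV[R]_n => enorm (z - x)) C C0 comC.
  apply: continuous_subspaceT => x.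
  apply: (@continuous_comp _ _ _ (fun x : 'rV[R]_n => z - x) (@enorm R n)).
    by apply: continuousB; [exact: cst_continuous|].
  exact: enorm_continuous.
exists (z - y).
  rewrite dot_enorm exprn_gt0// lt_def enorm_ge0 andbT.
  apply/negP => /eqP e0; apply: Cz.
  have : `|z - y| <= 0 by rewrite -e0 norm_le_enorm.
  by rewrite normr_le0 subr_eq0 => /eqP ->.
move=> x Cx; set a := z - y.
have key t : 0 <= t -> t <= 1 -> 2 * t * dot a (x - y) <= t ^+ 2 * dot (x - y) (x - y).
  move=> t0 t1.
  have h : enorm a ^+ 2 <= enorm (z - (y + t *: (x - y))) ^+ 2.
    rewrite lerXn2r ?nnegrE ?enorm_ge0//.
    exact: ymin _ (mem_set (cC _ _ _ Cy Cx t0 t1)).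
  move: h; rewrite -!dot_enorm opprD addrA -/a.
  rewrite dot_sqrB.
  by move: (dot a a) (dot a (x - y)) (dot (x - y) (x - y)) => A B D; lra.
have : dot a (x - y) <= 0.
  rewrite leNgt; apply/negP => B0.
  set B := dot a (x - y) in B0; set D := dot (x - y) (x - y).
  have D0 : 0 <= D by rewrite /D dot_enorm sqr_ge0.
  (* The step t = B/(B + D) lies in [0,1] and satisfies tD < 2B, which contradicts [key]. *)
  have den : 0 < B + D by rewrite ltr_wpDr.
  have t0 : 0 <= B / (B + D) by rewrite divr_ge0// ltW.
  have tp : 0 < B / (B + D) by rewrite divr_gt0.
  have t1 : B / (B + D) <= 1 by rewrite ler_pdivrMr// mul1r lerDl.
  have tD : B / (B + D) * D < B + B by rewrite mulrAC ltr_pdivrMr//; nra.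
  have := key _ t0 t1; rewrite -/B -/D.
  move: (B / (B + D)) tp tD => t tp tD.
  have -> : 2 * t * B = t * (2 * B) by ring.
  by rewrite expr2 -mulrA ler_pM2l//; lra.
rewrite dotBr => h.
have -> : dot a z = dot a y + dot a a by rewrite /a -dotDr addrCA subrr addr0.
by rewrite lerD2r -subr_le0.
Qed.

                                                                      
                                                                     
(** Integration along lines in direction a ([iint_lines]) requires a nonzero first coordinate. A
    strictly separating normal can be tilted slightly towards the first axis and still separates,
    because C is bounded. *)
Lemma separation_transversal n (C : set 'rV[R]_n.+1) (z : 'rV[R]_n.+1) :
  closed C -> bounded_set C -> convex C -> C !=set0 -> ~ C z ->
  exists (a : 'rV[R]_n.+1) (c m : R),
    [/\ enorm a = 1, a ord0 ord0 != 0, 0 < m, c < dot a z &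
      forall x, C x -> dot a x + m <= c].
Proof.
move=> clC bC cC C0 Cz.
have [a a0 aC] := separation_dot clC bC cC C0 Cz.
suff [b [g [b0 g0 bC']]] : exists (b : 'rV[R]_n.+1) (g : R),
    [/\ b ord0 ord0 != 0, 0 < g & forall x, C x -> dot b x + g <= dot b z].
  have nb0 : 0 < enorm b.
    by apply: lt_le_trans (coord_le_enorm b ord0); rewrite normr_gt0.
  pose k := (enorm b)^-1; have k0 : 0 < k by rewrite invr_gt0.
  have kE x : dot (k *: b) x = k * dot b x by rewrite dotC dotZr dotC.
  exists (k *: b), (k * (dot b z - g / 2)), (k * (g / 2)); split.
  - by rewrite enormZ gtr0_norm// mulVf// gt_eqF.
  - by rewrite mxE mulf_neq0// gt_eqF.
  - by rewrite mulr_gt0// divr_gt0.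
  - by rewrite kE ltr_pM2l//; move: g0; lra.
  - move=> x /bC' h; rewrite kE -mulrDr ler_pM2l//; move: h.
    by move: (dot b x) (dot b z) => ? ?; lra.
have [a00|a00] := eqVneq (a ord0 ord0) 0; last by exists a, (dot a a); split.
have [M MC] : exists2 M, 0 < M & forall x, C x -> `|x ord0 ord0| <= M.
  have [M [_ HM]] := bC; exists (`|M| + 1); first by rewrite ltr_wpDl.
  move=> x Cx; apply: le_trans (coord_le_norm x ord0) _.
  by apply: HM => //; rewrite (le_lt_trans (ler_norm _))// ltrDl.
move=> MC'; pose D := M + `|z ord0 ord0|.
have D0 : 0 < D by rewrite ltr_wpDr.
(* D bounds the difference of the first coordinates of z and of any point of C, so a tilt by [eta]
   uses up at most half of the gap [dot a a]. *)
pose eta := dot a a / (2 * D).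
have eta0 : 0 < eta by rewrite divr_gt0// mulr_gt0.
pose e0 : 'rV[R]_n.+1 := delta_mx ord0 ord0.
have e0E x : dot e0 x = x ord0 ord0.
  rewrite /dot (bigD1 ord0)//= big1 ?addr0; last first.
    by move=> i i0; rewrite mxE eqxx/= (negbTE i0) mul0r.
  by rewrite mxE !eqxx mul1r.
have bE x : dot (a + eta *: e0) x = dot a x + eta * x ord0 ord0.
  by rewrite dotC dotDr dotZr !(dotC x) e0E.
exists (a + eta *: e0), (dot a a / 2); split.
- by rewrite !mxE a00 add0r !eqxx mulr1 gt_eqF.
- by rewrite divr_gt0.
- move=> x Cx; rewrite !bE.
  have h1 := aC _ Cx.
  have h2 : eta * (x ord0 ord0 - z ord0 ord0) <= dot a a / 2.
    rewrite (_ : dot a a / 2 = eta * D); last by rewrite /eta; field; rewrite gt_eqF.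
    rewrite ler_pM2l//; apply: le_trans (ler_norm _) _.
    by apply: le_trans (ler_normB _ _) _; rewrite lerD2r MC'.
  move: h1 h2; rewrite mulrBr.
  move: (dot a x) (dot a z) (dot a a) (eta * _) (eta * _) => A B E F G; lra.
Qed.

End half_spaces.

Section polytope.
Context {R : realType} {n : nat}.
Implicit Types (O K C : set 'rV[R]_n.+1) (x y z : 'rV[R]_n.+1).

(** The inner parallel set for the maximum norm. It is closed, inherits convexity from O, and for
    small d it contains a given compact subset of an open O. *)
Definition erosion (d : R) O := [set x | forall y, `|y| < d -> O (x + y)].

Lemma erosion_closed d O : closed (erosion d O).
Proof.
move=> x clx y yd.
have e0 : 0 < d - `|y| by rewrite subr_gt0.
have [x' [Ex' /=]] := clx _ (nbhsx_ballx x _ e0).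
rewrite -ball_normE /ball_ /= => xx'.
have -> : x + y = x' + (y + (x - x')) by rewrite [RHS]addrCA [x' + _]addrC subrK addrC.
apply: Ex'; apply: le_lt_trans (ler_normD _ _) _.
by rewrite -ltrBrDl.
Qed.

Lemma erosion_convex d O : convex O -> convex (erosion d O).
Proof.
move=> cO x y t Ex Ey t0 t1 w wd.
have := cO _ _ t (Ex _ wd) (Ey _ wd) t0 t1.
by rewrite opprD addrACA subrr addr0 addrAC.
Qed.

Lemma sub_erosion d O : 0 < d -> erosion d O `<=` O.
Proof. by move=> d0 x /(_ 0); rewrite normr0 addr0; exact. Qed.

Lemma compact_sub_erosion O K : open O -> compact K -> K `<=` O ->
  exists2 d : R, 0 < d & K `<=` erosion d O.
Proof.
move=> oO /compact_near_coveringP cK KO.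
have near_d : \forall d \near (0 : R)^'+, K `<=` erosion d O.
  apply: (cK R (0^'+) (fun d x => erosion d O x)) => x /KO Ox.
  have /nbhs_ballP[r /= r0 rO] := open_nbhs_nbhs (conj oO Ox).
  have r20 : 0 < r / 2 by rewrite divr_gt0.
  exists (ball x (r / 2), [set d | d < r / 2]).
    split; first exact: nbhsx_ballx.
    exact: nbhs_right_lt.
  move=> [y d] /= [xy dr] w wd; apply: rO; rewrite -ball_normE /ball_ /=.
  move: xy; rewrite -ball_normE /ball_ /= => xy.
  rewrite opprD addrA; apply: le_lt_trans (ler_normB _ _) _.
  by rewrite [ltRHS](splitr r) ltrD// (lt_trans wd).
near (0 : R)^'+ => d.
exists d; first by near: d; exact: nbhs_right_gt.
by near: d.
Unshelve. all: by end_near. Qed.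

Lemma sub_bounded_set O C : bounded_set O -> C `<=` O -> bounded_set C.
Proof. by move=> [M [Mr HM]] CO; exists M; split=> // x Mx y /CO; exact: HM. Qed.

(** At the supremum of the parameters whose points lie in O, the point is a limit of points of O; if
    it belonged to O, openness would allow larger parameters. *)
Lemma boundary_on_segment O x y : open O -> O x -> ~ O y ->
  exists2 t : R, 0 <= t <= 1 & (closure O `\` O) (x + t *: (y - x)).
Proof.
move=> oO Ox Oy.
pose A := [set t : R | 0 <= t <= 1 /\ O (x + t *: (y - x))].
have A0 : A 0 by split; [rewrite lexx ler01|rewrite scale0r addr0].
have Aub : has_ubound A by exists 1 => t [/andP[]].
have supA : has_sup A by split; [exists 0|].
pose s := sup A.
have s0 : 0 <= s by exact: ub_le_sup.
have s1 : s <= 1 by apply: ge_sup => [|t [/andP[]]//]; exists 0.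
have cline : continuous (fun t : R => x + t *: (y - x)).
  move=> t; apply: cvgD; first exact: cvg_cst.
  by apply: cvgZl; exact: cvg_id.
exists s; first by rewrite s0.
split.
  move=> B /cline /nbhs_ballP[e /= e0 eB].
  have [t At ts] := sup_adherent e0 supA.
  have ts' : t <= s by exact: ub_le_sup.
  exists (x + t *: (y - x)); split; first by case: At.
  apply: eB; rewrite /ball /= ger0_norm ?subr_ge0//.
  by rewrite ltrBlDr -ltrBlDl.
move=> Os.
have s1' : s < 1.
  rewrite lt_neqAle s1 andbT; apply/eqP => s1E; apply: Oy.
  by move: Os; rewrite s1E scale1r addrC subrK.
have /nbhs_ballP[e /= e0 eO] := cline s _ (open_nbhs_nbhs (conj oO Os)).
pose t := s + Num.min (e / 2) (1 - s).
have m0 : 0 < Num.min (e / 2) (1 - s) by rewrite lt_min divr_gt0//= subr_gt0.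
have At : A t.
  split.
    rewrite addr_ge0 ?(ltW m0)//= -lerBrDl ge_min lexx orbT//.
  apply: eO; rewrite /ball /= /t opprD addNKr normrN gtr0_norm//.
  by rewrite gt_min; apply/orP; left; rewrite ltr_pdivrMr// ltr_pMr// ltr1n.
have := ub_le_sup Aub At; rewrite -/s /t -subr_ge0 opprD addNKr oppr_ge0.
by rewrite leNgt m0.
Qed.

(** Each boundary point of O is strictly separated from an erosion C of O that contains K, and by
    compactness of the boundary finitely many of these half-spaces exclude all of it. A point
    outside O that satisfied all the inequalities would be joined to a point of K by a segment
    meeting the boundary, yet the whole segment lies in every half-space. *)
Lemma polytope_between O K : open O -> bounded_set O -> convex O ->
  compact K -> K `<=` O -> K !=set0 ->
  exists (k : nat) (a : 'I_k -> 'rV[R]_n.+1) (c m : 'I_k -> R),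
    [/\ forall i, enorm (a i) = 1, forall i, a i ord0 ord0 != 0,
        forall i, 0 < m i, forall i x, K x -> dot (a i) x + m i <= c i &
        forall x, (forall i, dot (a i) x < c i) -> O x].
Proof.
move=> oO bO cO cK KO [x0 Kx0].
have [d d0 Kd] := compact_sub_erosion oO cK KO.
pose C := erosion d O.
have CO : C `<=` O by exact: sub_erosion.
have sep z : ~ C z -> exists p : 'rV[R]_n.+1 * R * R,
    [/\ enorm p.1.1 = 1, p.1.1 ord0 ord0 != 0, 0 < p.2, p.1.2 < dot p.1.1 z &
      forall x, C x -> dot p.1.1 x + p.2 <= p.1.2].
  move=> Cz.
  have [|a [c [m H]]] := separation_transversal (@erosion_closed d O)
    (sub_bounded_set bO CO) (erosion_convex cO) _ Cz.
    by exists x0; exact: Kd.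
  by exists (a, c, m).
pose B := closure O `\` O.
have BC z : B z -> ~ C z by move=> [_ Oz] /CO.
have /choice[H HP] : forall z, exists p : 'rV[R]_n.+1 * R * R, B z ->
    [/\ enorm p.1.1 = 1, p.1.1 ord0 ord0 != 0, 0 < p.2, p.1.2 < dot p.1.1 z &
      forall x, C x -> dot p.1.1 x + p.2 <= p.1.2].
  (* The triple consists of normal, level and margin; off the boundary a dummy value is chosen. *)
  move=> z; have [Bz|Bz] := pselect (B z); last by exists (0, 0, 0).
  by have [p Hp] := sep _ (BC _ Bz); exists p.
have cB : compact B.
  apply: bounded_closed_compact.
    have [M [Mr HM]] := bO.
    exists M; split=> // r Mr' y [cy _].
    have clr : closed [set y : 'rV[R]_n.+1 | `|y| <= r].
      apply: (@closed_comp _ _ (fun y : 'rV[R]_n.+1 => `|y|) [set s | s <= r]).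
        by move=> w _; exact: norm_continuous.
      exact: closed_le.
    suff : [set y : 'rV[R]_n.+1 | `|y| <= r] y by [].
    move/closure_id: clr => ->; apply: closure_subset cy => w Ow.
    exact: HM Ow.
  by apply: closedI; [exact: closed_closure|exact: open_closedC].
move: cB; rewrite compact_cover.
move=> /(_ 'rV[R]_n.+1 B (fun z => [set x | (H z).1.2 < dot (H z).1.1 x])).
case.
- move=> z Bz.
  apply: (@open_comp _ _ (dot (H z).1.1) [set s | (H z).1.2 < s]).
    by move=> w _; exact: dot_continuous.
  exact: open_gt.
- by move=> z Bz; exists z => //=; have [] := HP _ Bz.
move=> D DB Dcov.
pose s := finmap.enum_fset D.
pose h (i : 'I_(size s)) := H (nth 0 s i).
have hB (i : 'I_(size s)) : B (nth 0 s i).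
  by apply/set_mem/DB; exact: mem_nth.
exists (size s), (fun i => (h i).1.1), (fun i => (h i).1.2), (fun i => (h i).2).
split.
- by move=> i; have [] := HP _ (hB i).
- by move=> i; have [] := HP _ (hB i).
- by move=> i; have [] := HP _ (hB i).
- by move=> i x Kx; have [_ _ _ _] := HP _ (hB i); apply; exact: Kd.
move=> x xlt; apply: contrapT => Ox.
have [t /andP[t0 t1] Bt] := boundary_on_segment oO (KO _ Kx0) Ox.
have [z zD /= zlt] := Dcov _ Bt.
have zs : (index z s < size s)%N by rewrite index_mem.
pose i := Ordinal zs.
have hi : h i = H z by rewrite /h /= nth_index.
have Bz : B z by have := hB i; rewrite /= nth_index.
have [_ _ m0 _ /(_ _ (Kd _ Kx0)) hx0] := HP _ Bz.
have := xlt i; rewrite hi => hx.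
(* The affine function is below its level at both ends of the segment, hence also at the boundary
   point. *)
move: zlt; apply/negP; rewrite -leNgt.
rewrite dotDr dotZr dotBr.
have e0 : dot (H z).1.1 x0 <= (H z).1.2 by apply: le_trans hx0; rewrite lerDl ltW.
move: e0 (ltW hx) t0 t1.
move: (dot _ x0) (dot _ x) ((H z).1.2) => p q r; nra.
Qed.

End polytope.

                                    

(** * The inradius *)

Section inradius.
Context {R : realType} {n : nat}.
Implicit Types (O : set 'rV[R]_n.+1) (x : 'rV[R]_n.+1).

Let radii O := [set r : R | 0 < r /\ exists2 x0, O x0 & eball x0 r `<=` O].

Let radii_ub O : bounded_set O -> has_ubound (radii O).
Proof.
move=> [M [_ HM]]; have M1 : M < `|M| + 1 by rewrite (le_lt_trans (ler_norm _))// ltrDl.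
(* The ball also contains the centre shifted by r/2 along the first axis, so r/2 is a difference of
   two coordinates bounded by |M| + 1. *)
exists (4 * (`|M| + 1)) => r [r0 [x Ox xr]].
pose y := x + (r / 2) *: delta_mx ord0 ord0.
have Oy : O y.
  apply: xr; rewrite /eball /= addrC addKr enormZ.
  by rewrite enorm_delta mulr1 gtr0_norm ?divr_gt0// ltr_pdivrMr// ltr_pMr// ltr1n.
have hx := le_trans (coord_le_norm x ord0) (HM _ M1 _ Ox).
have hy := le_trans (coord_le_norm y ord0) (HM _ M1 _ Oy).
have : r / 2 = y ord0 ord0 - x ord0 ord0.
  by rewrite !mxE !eqxx mulr1 addrAC subrr add0r.
move: hx hy; rewrite !ler_norml; move: (`|M| + 1) (y ord0 ord0) => B Y.
by move=> /andP[? ?] /andP[? ?] ?; lra.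
Qed.

Lemma le_inradius O x (r : R) : bounded_set O -> 0 < r -> O x ->
  eball x r `<=` O -> r <= inradius O.
Proof.
by move=> bO r0 Ox xr; apply: (ub_le_sup (radii_ub bO)); split=> //; exists x.
Qed.

Lemma inradius_gt0 O : bounded_set O -> open O -> O !=set0 -> 0 < inradius O.
Proof.
move=> bO oO [x Ox].
have /nbhs_ballP[r /= r0 rO] := open_nbhs_nbhs (conj oO Ox).
apply: (lt_le_trans r0); apply: (@le_inradius _ x) => // y yr; apply: rO.
rewrite -ball_normE /ball_ /= distrC.
exact: le_lt_trans (norm_le_enorm _) yr.
Qed.

Lemma inradius_le O (r : R) : 0 <= r ->
  (forall x s, 0 < s -> O x -> eball x s `<=` O -> s <= r) -> inradius O <= r.
Proof.
move=> r0 H; rewrite /inradius; set A := [set _ | _].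
have [A0|A0] := pselect (A !=set0); last first.
  by rewrite sup_out// => -[].
by apply: ge_sup => // s [s0 [x Ox xs]]; exact: (H x).
Qed.

End inradius.

(** * Cutting a polytope by nearest bounding hyperplane *)

Section polytope_pieces.
Context {R : realType} {n : nat}.
Local Notation mu := (@lebesgue_measure R).

Section pieces.
Variables (k : nat) (a : 'I_k -> 'rV[R]_n.+1) (c : 'I_k -> R).
Implicit Types (i j : 'I_k) (x : 'rV[R]_n.+1).

(** For unit normals this is the signed distance to the i-th hyperplane, positive inside. *)
Definition slack i x : R := c i - dot (a i) x.

                                                                         
                                             
(** The points of the polytope for which the i-th hyperplane is nearest. Ties go to the smallest
    index, which makes the pieces a genuine partition. *)
Definition piece i : set 'rV[R]_n.+1 :=
  [set x | 0 < slack i x] `&`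
  \bigcap_(j in [set: 'I_k]) [set x | slack i x <= slack j x /\
    ((j < i)%N -> slack i x < slack j x)].

Lemma slack_continuous i : continuous (slack i).
Proof.
by move=> x; apply: continuousB; [exact: cst_continuous|exact: dot_continuous].
Qed.

Lemma measurable_lt_continuous (f g : 'rV[R]_n.+1 -> R) :
  continuous f -> continuous g -> measurable [set x | f x < g x].
Proof.
move=> cf cg.
rewrite (_ : [set x | f x < g x] = (fun x => g x - f x) @^-1` [set s | 0 < s]).
  apply: open_rv_measurable; apply: open_comp; last exact: open_gt.
  by move=> x _; apply: continuousB; [exact: cg|exact: cf].
by apply/seteqP; split => x /=; rewrite subr_gt0.
Qed.

Lemma measurable_le_continuous (f g : 'rV[R]_n.+1 -> R) :
  continuous f -> continuous g -> measurable [set x | f x <= g x].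
Proof.
move=> cf cg; rewrite (_ : [set x | f x <= g x] = ~` [set x | g x < f x]).
  by apply: measurableC; exact: measurable_lt_continuous.
by apply/seteqP; split => x /=; [rewrite leNgt => /negP|move/negP; rewrite -leNgt].
Qed.

Lemma piece_measurable i : measurable (piece i).
Proof.
apply: measurableI.
  by apply: measurable_lt_continuous; [exact: cst_continuous|exact: slack_continuous].
apply: fin_bigcap_measurable => // j _.
apply: measurableI.
  by apply: measurable_le_continuous; exact: slack_continuous.
have [ji|ij] := boolP (j < i)%N.
  rewrite [X in measurable X](_ : _ = [set x | slack i x < slack j x]).
    by apply: measurable_lt_continuous; exact: slack_continuous.
  by apply/seteqP; split => x /=; [exact|].
by rewrite [X in measurable X](_ : _ = setT)//; apply/seteqP; split.
Qed.

Lemma piece_disjoint i j x : piece i x -> piece j x -> i = j.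
Proof.
move=> [_ Pi] [_ Pj]; apply/val_inj/eqP; rewrite eqn_leq.
apply/andP; split; rewrite leqNgt; apply/negP => ij.
  have [_ /(_ ij)] := Pi j I; have [+ _] := Pj i I.
  by move=> /le_lt_trans h /h; rewrite ltxx.
have [_ /(_ ij)] := Pj i I; have [+ _] := Pi j I.
by move=> /le_lt_trans h /h; rewrite ltxx.
Qed.

Lemma piece_cover x (i0 : 'I_k) : (forall i, 0 < slack i x) ->
  exists i, piece i x.
Proof.
move=> s0.
have [i1 _ i1min] : extremum_spec <=%O xpredT (fun i => slack i x)
    [arg min_(i < i0) slack i x]%O by exact: arg_minP.
have ex : exists m : nat, [exists i : 'I_k, (val i == m) && (slack i x <= slack i1 x)].
  by exists i1; apply/existsP; exists i1; rewrite eqxx lexx.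
have [m /existsP[i /andP[/eqP im ile]] mmin] := ex_minnP ex.
exists i; split; first exact: s0.
move=> j _; have ij : slack i x <= slack j x by apply: le_trans ile (i1min _ _).
split=> // ji; rewrite lt_neqAle ij andbT; apply/negP => /eqP eij.
have : (m <= j)%N.
  by apply: mmin; apply/existsP; exists j; rewrite eqxx -eij.
by rewrite leqNgt -im ji.
Qed.

Lemma sum_indic_piece x (O : set 'rV[R]_n.+1) :
  (forall y, (forall i, 0 < slack i y) -> O y) ->
  \sum_(i < k) \1_(piece i) x <= \1_O x :> R.
Proof.
move=> PO.
have [[i xi]|nx] := pselect (exists i, piece i x).
  rewrite (bigD1 i)//= big1 => [|j ji]; last first.
    rewrite indicE; case: (boolP (x \in piece j)) => // /set_mem xj.
    by move: ji; rewrite (piece_disjoint xj xi) eqxx.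
  have Ox : O x.
    apply: PO => j; have [x0 /(_ j I)[+ _]] := xi.
    exact: lt_le_trans.
  by rewrite !indicE (mem_set xi) (mem_set Ox) addr0.
rewrite big1// => i _; rewrite indicE; case: (boolP (x \in piece i)) => // /set_mem xi.
by exfalso; apply: nx; exists i.
Qed.

Lemma sum_indic_piece_eq1 x (i0 : 'I_k) : (forall i, 0 < slack i x) ->
  \sum_(i < k) \1_(piece i) x = 1 :> R.
Proof.
move=> /(piece_cover i0)[i xi].
rewrite (bigD1 i)//= big1 => [|j ji]; last first.
  rewrite indicE; case: (boolP (x \in piece j)) => // /set_mem xj.
  by move: ji; rewrite (piece_disjoint xj xi) eqxx.
by rewrite indicE (mem_set xi) addr0.
Qed.

Hypothesis a1 : forall i, enorm (a i) = 1.

Lemma slack_line i j (b : 'rV[R]_n.+1) (t : R) :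
  slack j (b + t *: - a i) = slack j b + t * dot (a j) (a i).
Proof. by rewrite /slack dotDr dotZr dotNr; ring. Qed.

                                                                         
                                  
(** Moving inwards from the i-th hyperplane, its slack grows at speed 1 and any other slack at speed
    [dot (a j) (a i)], which is at most 1. The advantage of hyperplane i over j can only shrink, so
    if it persists at t, it held at every earlier s. *)
Lemma piece_line i (b : 'rV[R]_n.+1) (s t : R) : slack i b = 0 ->
  piece i (b + t *: - a i) -> 0 < s -> s <= t -> piece i (b + s *: - a i).
Proof.
move=> b0 [_ Pi] s0 st.
have aii : dot (a i) (a i) = 1 by rewrite dot_enorm a1 expr1n.
split; first by rewrite /= slack_line b0 aii add0r mulr1.
move=> j _; have := Pi j I; rewrite /= !slack_line b0 aii !mulr1 !add0r.
have aij : dot (a j) (a i) <= 1.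
  apply: le_trans (ler_norm _) _.
  by apply: le_trans (dot_unit_le _ (a1 j)) _; rewrite a1.
move: (dot (a j) (a i)) aij (slack j b) => r r1 B [h1 h2]; split; first by nra.
by move=> /h2 h; nra.
Qed.

End pieces.
End polytope_pieces.

Lemma continuousMl (R : realType) (T : topologicalType) (c : R) (f : T -> R) :
  continuous f -> continuous (fun x => c * f x).
Proof. by move=> cf x; apply: cvgMr; exact: cf. Qed.

Lemma continuousDr (R : realType) (T : topologicalType) (c : R) (f : T -> R) :
  continuous f -> continuous (fun x => f x + c).
Proof. by move=> cf x; apply: cvgD; [exact: cf|exact: cvg_cst]. Qed.

Lemma continuous_powR_rv (R : realType) m (f : 'rV[R]_m -> R) (s : R) :
  0 < s -> continuous f -> continuous (fun x => `|f x| `^ s).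
Proof.
move=> s0 cf x; apply: (@continuous_comp _ _ _ f (fun x => `|x| `^ s)).
  exact: cf.
exact: continuous_norm_powR.
Qed.

Lemma continuous_powR_grad (R : realType) m (psi : 'rV[R]_m -> R) (s : R) :
  0 < s -> smooth psi -> continuous (fun x => grad_norm psi x `^ s).
Proof.
move=> s0 spsi.
rewrite (_ : (fun x => _) = fun x => `|grad_norm psi x| `^ s).
  by apply: continuous_powR_rv => //; exact: grad_norm_continuous.
by apply/funext => x; rewrite ger0_norm// enorm_ge0.
Qed.

Lemma measurable_indic_continuous (R : realType) m (A : set 'rV[R]_m)
    (f : 'rV[R]_m -> R) : measurable A -> continuous f ->
  measurable_fun setT (fun x => (\1_A x * f x)%:E).
Proof.
move=> mA cf; apply/measurable_EFinP; apply: measurable_funM.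
  exact: measurable_indic.
exact: continuous_rv_measurable.
Qed.

Section piece_slice.
Context {R : realType} {n : nat}.
Local Notation mu := (@lebesgue_measure R).
Variables (p q : R) (q1 : 1 <= q) (qp : q < p).
Variables (O : set 'rV[R]_n.+1) (bO : bounded_set O).
Variables (k : nat) (a : 'I_k -> 'rV[R]_n.+1) (c : 'I_k -> R).
Hypothesis a1 : forall i, enorm (a i) = 1.
Hypothesis PO : forall x, (forall i, 0 < slack a c i x) -> O x.
Variables (psi : 'rV[R]_n.+1 -> R) (K : set 'rV[R]_n.+1).
Hypothesis spsi : smooth psi.
Hypothesis psiK : forall x, ~ K x -> psi x = 0.
Variables (M kap : R).
Hypothesis ME : M = (fine (pi_pq p q) / 2) `^ p * inradius O `^ (- p).
Hypothesis kap0 : 0 <= kap.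

Let q0 : 0 < q. Proof. exact: lt_le_trans q1. Qed.
Let p0 : 0 < p. Proof. exact: lt_trans qp. Qed.

                                                                         
                                
(** Together with [tangent_offset], the coefficients of the tangent to M y^(p/q) at [kap], as they
    occur in [slice_ineq]. *)
Definition tangent_slope : R := M * (p / q * kap `^ (p / q - 1)).
Definition tangent_offset : R := M * ((p / q - 1) * kap `^ (p / q)).

Definition piece_mass i x : R := \1_(piece a c i) x * (tangent_slope * `|psi x| `^ q).
Definition piece_energy i x : R :=
  \1_(piece a c i) x * (grad_norm psi x `^ p + tangent_offset).

Let M0 : 0 <= M. Proof. by rewrite ME mulr_ge0 ?powR_ge0. Qed.

Lemma tangent_slope_ge0 : 0 <= tangent_slope.
Proof. by rewrite mulr_ge0// mulr_ge0 ?powR_ge0// divr_ge0// ltW. Qed.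

Lemma tangent_offset_ge0 : 0 <= tangent_offset.
Proof.
rewrite mulr_ge0// mulr_ge0 ?powR_ge0// subr_ge0.
by rewrite ler_pdivlMr// mul1r ltW.
Qed.

Lemma piece_mass_measurable i : measurable_fun setT (fun x => (piece_mass i x)%:E).
Proof.
apply: measurable_indic_continuous; first exact: piece_measurable.
apply: continuousMl; apply: continuous_powR_rv => //.
exact: smooth_continuous.
Qed.

Lemma piece_energy_measurable i : measurable_fun setT (fun x => (piece_energy i x)%:E).
Proof.
apply: measurable_indic_continuous; first exact: piece_measurable.
by apply: continuousDr; exact: (continuous_powR_grad p0 spsi).
Qed.

Lemma piece_mass_ge0 i x : 0 <= piece_mass i x.
Proof. by rewrite mulr_ge0// mulr_ge0 ?tangent_slope_ge0// powR_ge0. Qed.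

Lemma piece_energy_ge0 i x : 0 <= piece_energy i x.
Proof. by rewrite mulr_ge0// addr_ge0 ?tangent_offset_ge0// powR_ge0. Qed.

Lemma measurable_line (b w : 'rV[R]_n.+1) :
  measurable_fun [set: measurableTypeR R] (fun t : R => b + t *: w).
Proof.
apply: measurable_to_rv => i; under eq_fun do rewrite !mxE.
by apply: measurable_funD => //; apply: measurable_funM.
Qed.

(** At a point of the piece all slacks are at least the slack of i, which is t, so the ball of
    radius t around it violates no inequality and lies in O. *)
Lemma piece_radius i b t : slack a c i b = 0 -> piece a c i (b + t *: - a i) ->
  0 < t /\ t <= inradius O.
Proof.
move=> b0 Pt.
have aii : dot (a i) (a i) = 1 by rewrite dot_enorm a1 expr1n.
have st : slack a c i (b + t *: - a i) = t by rewrite slack_line b0 aii add0r mulr1.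
have [] := Pt; rewrite /= st => t0 Pj; split=> //.
have H z : enorm (z - (b + t *: - a i)) < t -> O z.
  move=> zt; apply: PO => j; have [+ _] := Pj j I; rewrite st => tj.
  have -> : slack a c j z = slack a c j (b + t *: - a i) -
      dot (a j) (z - (b + t *: - a i)) by rewrite /slack [in RHS]dotBr; ring.
  rewrite subr_gt0; apply: lt_le_trans tj; apply: le_lt_trans (ler_norm _) _.
  exact: le_lt_trans (dot_unit_le _ (a1 j)) zt.
apply: (@le_inradius _ _ _ (b + t *: - a i)) => //.
by apply: H; rewrite subrr /enorm big1 ?sqrtr0// => j _; rewrite mxE expr0n.
Qed.

(** With l the supremum of the slice, the slice lies in (0,l] and contains (0,l), and l is at most
    the inradius. The margin m keeps K away from the hyperplane, so [psi] restricted to the line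
    vanishes near its start and [slice_ineq] applies. The derivative along the unit vector -a_i is
    at most the norm of the gradient. *)
Lemma piece_slice_le i b (m : R) : slack a c i b = 0 -> 0 < m ->
  (forall x, K x -> m <= slack a c i x) ->
  (\int[mu]_t (piece_mass i (b + t *: - a i))%:E <=
   \int[mu]_t (piece_energy i (b + t *: - a i))%:E)%E.
Proof.
move=> b0 m0 Km.
have aii : dot (a i) (a i) = 1 by rewrite dot_enorm a1 expr1n.
pose y t := b + t *: - a i; pose S := [set t | piece a c i (y t)].
have my := measurable_line b (- a i).
have mmass : measurable_fun [set: measurableTypeR R] (fun t => (piece_mass i (y t))%:E).
  exact: (measurableT_comp (piece_mass_measurable i) my).
have menergy : measurable_fun [set: measurableTypeR R] (fun t => (piece_energy i (y t))%:E).
  exact: (measurableT_comp (piece_energy_measurable i) my).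
have [[s0 Ss0]|nS] := pselect (S !=set0); last first.
  rewrite (_ : (\int[mu]_t (piece_mass i (b + t *: - a i))%:E = 0)%E).
    by apply: integral_ge0 => t _; rewrite lee_fin piece_energy_ge0.
  apply: integral0_eq => t _; congr EFin; rewrite /piece_mass indicE.
  case: (boolP (_ \in _)) => [/set_mem St|]; last by rewrite mul0r.
  by exfalso; apply: nS; exists t.
have Sub : has_ubound S.
  by exists (inradius O) => t /(piece_radius b0)[].
have supS : has_sup S by split; [exists s0|].
pose l := sup S.
have l0 : 0 < l.
  by have [+ _] := piece_radius b0 Ss0; move=> /lt_le_trans; apply; exact: ub_le_sup.
have lr : l <= inradius O.
  by apply: ge_sup; [exists s0|move=> t /(piece_radius b0)[]].
have Sl t : 0 < t -> t < l -> S t.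
  move=> t0 tl; have lt0 : 0 < l - t by rewrite subr_gt0.
  have [t' St'] := sup_adherent lt0 supS; rewrite opprB addrCA subrr addr0 => tt'.
  exact: (piece_line a1 b0 St' t0 (ltW tt')).
pose v t := psi (y t).
have sv : smooth1 v by exact: smooth1_line.
have vm t : t <= m / 2 -> v t = 0.
  move=> tm; apply: psiK => /Km; rewrite slack_line b0 aii add0r mulr1.
  by rewrite leNgt (le_lt_trans tm)// ltr_pdivrMr// ltr_pMr// ltr1n.
have := slice_ineq q1 qp sv (divr_gt0 m0 (ltr0n _ 2)) vm l0 lr kap0 ME.
rewrite -/tangent_slope -/tangent_offset => slice.
have cq := continuous_powR_comp q0 (smooth1_continuous sv).
have cp := continuous_powR_comp p0 (smooth1_continuous (smooth1_derive1 sv)).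
have c1 := tangent_slope_ge0; have c2 := tangent_offset_ge0.
have mI : measurable (`]0, l[%classic : set (measurableTypeR R)) by exact: measurable_itv.
have mIc : measurable (`]0, l]%classic : set (measurableTypeR R)) by exact: measurable_itv.
have cmass : continuous (fun t => tangent_slope * `|v t| `^ q).
  exact: continuousMl.
have cen : continuous (fun t => `|derive1 v t| `^ p + tangent_offset).
  exact: continuousDr.
(* The mass is enlarged to (0,l], the energy below is reduced to (0,l); the endpoint does not affect
   the integrals. *)
have h1 : (\int[mu]_t (piece_mass i (y t))%:E <=
    \int[mu]_(t in `]0%R, l[) (tangent_slope * `|v t| `^ q)%:E)%E.
  rewrite (integral_itv_bndo_bndc (continuous_EFin_measurable mI cmass)).
  rewrite [leRHS]integral_mkcond.
  apply: (@ge0_le_integral _ _ _ mu setT measurableT) => //.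
  - by move=> t _; rewrite lee_fin piece_mass_ge0.
  - apply/(measurable_restrictT _ mIc).
    exact: continuous_EFin_measurable mIc cmass.
  move=> t _; rewrite patchE /piece_mass indicE.
  case: (boolP (y t \in _)) => [/set_mem St|_]; last first.
    rewrite mul0r; case: ifP => // _.
    by rewrite lee_fin mulr_ge0// powR_ge0.
  have [t0 _] := piece_radius b0 St.
  have tl : t <= l by exact: ub_le_sup.
  by rewrite ifT ?mul1r//; apply/mem_set; rewrite /= in_itv /= t0.
have h2 : (\int[mu]_(t in `]0%R, l[) (`|derive1 v t| `^ p + tangent_offset)%:E <=
    \int[mu]_t (piece_energy i (y t))%:E)%E.
  rewrite [leLHS]integral_mkcond.
  apply: (@ge0_le_integral _ _ _ mu setT measurableT) => //.
  - move=> t _; rewrite patchE; case: ifP => // _.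
    by rewrite lee_fin addr_ge0// powR_ge0.
  - apply/(measurable_restrictT _ mI).
    exact: continuous_EFin_measurable mI cen.
  move=> t _; rewrite patchE; case: ifP => [/set_mem|_]; last first.
    by rewrite lee_fin piece_energy_ge0.
  rewrite /= in_itv /= => /andP[t0 tl].
  rewrite lee_fin /piece_energy indicE mem_set ?mul1r ?lerD2r; last exact: Sl.
  rewrite /v (derive1_line _ _ spsi) -/(y t).
  apply: ge0_ler_powR; rewrite ?nnegrE ?normr_ge0 ?enorm_ge0 ?(ltW p0)//.
  by apply: dderive_le_grad_norm => //; rewrite -scaleN1r enormZ normrN1 mul1r.
apply: le_trans h1 (le_trans _ h2).
under eq_integral do rewrite EFinM.
rewrite ge0_integralZl//; last exact: continuous_EFin_measurable mI cq.
apply: le_trans slice _.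
under [leRHS]eq_integral do rewrite EFinD.
rewrite ge0_integralD//; last exact: continuous_EFin_measurable mI cp.
rewrite leeD2l// le_eqVlt; apply/orP; left; apply/eqP.
rewrite integral_cst//.
have muE : mu (`]0%R, l[%classic : set R) = l%:E.
  by rewrite lebesgue_measure_itv /= lte_fin l0 -EFinB subr0.
by rewrite EFinM -muE.
Qed.

End piece_slice.

(** * Integrals of product functions and volumes of boxes *)

Section products.
Context {R : realType}.
Local Notation mu := (@lebesgue_measure R).

Lemma iint_prod n (f : 'I_n -> R -> R) (r : 'I_n -> R) :
  (forall i, measurable_fun [set: measurableTypeR R] (f i)) ->
  (forall i t, 0 <= f i t) ->
  (forall i, (\int[mu]_t (f i t)%:E)%E = (r i)%:E) ->
  iint (fun x : 'rV[R]_n => (\prod_(i < n) f i (x ord0 i))%:E) =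
  (\prod_(i < n) r i)%:E.
Proof.
elim: n f r => [|n IH] f r mf f0 fr; first by rewrite /= !big_ord0.
rewrite big_ord_recl EFinM /=.
rewrite -(IH (fun i => f (lift ord0 i)) (fun i => r (lift ord0 i)))//.
set I := iint _.
have Ifin : I \is a fin_num.
  by rewrite /I (IH (fun i => f (lift ord0 i)) (fun i => r (lift ord0 i))).
have I0 : (0 <= I)%E by apply: iint_ge0 => x; rewrite lee_fin prodr_ge0.
have mprod : measurable_fun setT
    (fun v : 'rV[R]_n => (\prod_(i < n) f (lift ord0 i) (v ord0 i))%:E).
  apply/measurable_EFinP; apply: measurable_prod => i _.
  apply: (@measurableT_comp _ _ _ _ _ _ (f (lift ord0 i))); first exact: mf.
  exact: measurable_coord.
transitivity (\int[mu]_t (I * (f ord0 t)%:E))%E.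
  apply: eq_integral => t _; rewrite muleC -iintZl//; last first.
    by move=> v; rewrite lee_fin prodr_ge0.
  apply: eq_iint => v; rewrite big_ord_recl (rcons_rv0 (t, v)) -EFinM.
  congr EFin; congr *%R; apply: eq_bigr => i _.
  by rewrite (rcons_rvS (t, v)).
have mf0 : measurable_fun [set: measurableTypeR R] (fun t => (f ord0 t)%:E).
  by apply/measurable_EFinP; apply: mf.
have [s sE] : exists s, I = s%:E by exists (fine I); exact: esym (fineK Ifin).
rewrite sE ge0_integralZl//; last by rewrite -sE.
  by rewrite fr muleC.
by move=> t _; rewrite lee_fin.
Qed.

Definition box n (u v : 'I_n -> R) : set 'rV[R]_n :=
  [set x | forall i, u i < x ord0 i < v i].

Lemma measurable_box n (u v : 'I_n -> R) : measurable (box u v).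
Proof.
have -> : box u v = \bigcap_(i in [set: 'I_n])
    ((fun x : 'rV[R]_n => x ord0 i) @^-1` `]u i, v i[%classic).
  apply/seteqP; split => [x bx i _|x bx i]; first by rewrite /= in_itv /= bx.
  by have := bx i I; rewrite /= in_itv.
apply: fin_bigcap_measurable => // i _.
rewrite -[X in measurable X]setTI; apply: measurable_coord => //.
Qed.

Lemma indic_box n (u v : 'I_n -> R) (x : 'rV[R]_n) :
  \1_(box u v) x =
  \prod_(i < n) \1_(`]u i, v i[%classic : set R) (x ord0 i) :> R.
Proof.
rewrite indicE; case: (boolP (x \in _)) => [/set_mem bx|/negP nx].
  rewrite big1// => i _; rewrite indicE mem_set//= in_itv /=; exact: bx.
have [i xi] : exists i, ~~ (u i < x ord0 i < v i).
  apply: contrapT => H; apply: nx; apply/mem_set => i.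
  by apply: contrapT => /negP ui; apply: H; exists i.
rewrite (bigD1 i)//= indicE (memNset _) ?mul0r//= in_itv /=.
exact/negP.
Qed.

Lemma integral_indic_itv (a b : R) : a <= b ->
  (\int[mu]_t (\1_(`]a, b[%classic : set R) t)%:E)%E = (b - a)%:E.
Proof.
move=> ab; rewrite integral_indic// setIT.
have := @lebesgue_measure_itv R `]a, b[; rewrite /= lte_fin.
move=> ->; move: ab; rewrite le_eqVlt => /orP[/eqP ->|->].
  by rewrite ltxx subrr.
by rewrite -EFinB.
Qed.

Lemma volume_box n (u v : 'I_n -> R) : (forall i, u i <= v i) ->
  volume (box u v) = (\prod_(i < n) (v i - u i))%:E.
Proof.
move=> uv; rewrite /volume.
rewrite (eq_iint (fun x => congr1 EFin (indic_box u v x))).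
apply: (@iint_prod _ (fun i => \1_(`]u i, v i[%classic : set R))) => [i|i t|i].
- exact: measurable_indic.
- by rewrite indicE.
- exact: integral_indic_itv.
Qed.

End products.

(** * The lower bound for a convex set *)

Section lower_bound.
Context {R : realType} {n : nat}.
Implicit Types (O : set 'rV[R]_n.+1).

Lemma volume_fin_num O : open O -> bounded_set O -> volume O \is a fin_num.
Proof.
move=> oO [M [_ HM]].
have O0 : (0 <= volume O)%E by apply: iint_ge0 => x; rewrite lee_fin indicE.
rewrite ge0_fin_numE//.
pose B := `|M| + 2.
have M1 : M < `|M| + 1 by rewrite (le_lt_trans (ler_norm _))// ltrDl.
pose C : set 'rV[R]_n.+1 := box (fun=> - B) (fun=> B).
apply: (@le_lt_trans _ _ (volume C)); last first.
  rewrite volume_box ?ltry// => _; have := normr_ge0 M.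
  by rewrite /B; move: `|M| => r r0; lra.
apply: le_iint.
- apply/measurable_EFinP; apply: measurable_indic; exact: open_rv_measurable.
- apply/measurable_EFinP; apply: measurable_indic; exact: measurable_box.
- by move=> x; rewrite lee_fin indicE.
move=> x; rewrite lee_fin !indicE; case: (boolP (x \in O)) => [/set_mem Ox|//].
rewrite mem_set// => i; rewrite -ltr_norml.
apply: le_lt_trans (coord_le_norm _ _) _; apply: le_lt_trans (HM _ M1 _ Ox) _.
by rewrite ltrD2l ltr1n.
Qed.

Lemma volume_gt0 O : open O -> O !=set0 -> (0 < volume O)%E.
Proof.
move=> oO [x Ox].
have /nbhs_ballP[r /= r0 rO] := open_nbhs_nbhs (conj oO Ox).
pose u i := x ord0 i - r; pose v i := x ord0 i + r.
have uv i : u i <= v i by rewrite /u /v; move: (x ord0 i) => y; lra.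
apply: (@lt_le_trans _ _ (volume (box u v))).
  rewrite volume_box// lte_fin prodr_gt0// => i _.
  by rewrite /u /v; move: (x ord0 i) => y; lra.
apply: le_iint.
- apply/measurable_EFinP; apply: measurable_indic; exact: measurable_box.
- apply/measurable_EFinP; apply: measurable_indic; exact: open_rv_measurable.
- by move=> y; rewrite lee_fin indicE.
move=> y; rewrite lee_fin !indicE; case: (boolP (y \in box u v)) => [/set_mem yb|//].
rewrite mem_set//; apply: rO; split=> // i j; rewrite ord1.
rewrite /ball /= distrC ltr_distl; exact: yb.
Qed.

(** The slice inequalities are integrated over the lines perpendicular to each hyperplane and summed
    over the pieces. For the mass the sum is exact, since the pieces cover the support; for the
    energy and the volume it is enough that the pieces are disjoint subsets of O. *)
Lemma integral_piece_le (p q kap M : R) (psi : 'rV[R]_n.+1 -> R) O :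
  1 <= q -> q < p -> open O -> bounded_set O -> convex O -> O !=set0 ->
  Cc_infty O psi -> 0 <= kap ->
  M = (fine (pi_pq p q) / 2) `^ p * inradius O `^ (- p) ->
  ((tangent_slope p q M kap)%:E * integral_on O (fun x => (`|psi x| `^ q)%R) <=
   integral_on O (fun x => (grad_norm psi x `^ p)%R) +
   (tangent_offset p q M kap)%:E * volume O)%E.
Proof.
move=> q1 qp oO bO cO [x0 Ox0] [spsi [K [cK KO] psiK]] kap0 ME.
have q0 : 0 < q by exact: lt_le_trans q1.
have p0 : 0 < p by exact: lt_trans qp.
(* A point of O is added because [K] may be empty, while [polytope_between] needs a starting
   point. *)
pose K' := K `|` [set x0].
have cK' : compact K' by apply: compactU => //; exact: compact_set1.
have K'O : K' `<=` O by move=> x [/KO//|->].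
have psiK' x : ~ K' x -> psi x = 0 by move=> K'x; apply: psiK => Kx; apply: K'x; left.
have K'0 : K' !=set0 by exists x0; right.
have [k [a [c [m [a1 a00 m0 Km PO]]]]] := polytope_between oO bO cO cK' K'O K'0.
have PO' x : (forall i, 0 < slack a c i x) -> O x.
  by move=> H; apply: PO => i; rewrite -subr_gt0; exact: H.
have Km' i x : K' x -> m i <= slack a c i x.
  by move=> /(Km i); rewrite /slack lerBrDr addrC.
(* With no half-space at all, O would be the whole space, against boundedness. *)
have [i0 _] : exists i0 : 'I_k, True.
  case: k a c m a1 a00 m0 Km PO PO' Km' => [|k]; last by move=> *; exists ord0.
  move=> a c m _ _ _ _ PO _ _; exfalso.
  have [B [_ HB]] := bO; have B1 : B < `|B| + 1 by rewrite (le_lt_trans (ler_norm _))// ltrDl.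
  have Oz : O (const_mx (`|B| + 2)) by apply: PO => -[].
  have := le_trans (coord_le_norm _ ord0) (HB _ B1 _ Oz).
  by rewrite mxE ger0_norm ?addr_ge0// lerD2l leNgt ltr1n.
have c1 := tangent_slope_ge0 q1 qp kap ME.
have c2 := tangent_offset_ge0 q1 qp kap ME.
have mO := open_rv_measurable oO.
pose mass i x := (piece_mass p q a c psi M kap i x)%:E.
pose energy i x := (piece_energy p q a c psi M kap i x)%:E.
have mmass i : measurable_fun setT (mass i) by exact: piece_mass_measurable.
have menergy i : measurable_fun setT (energy i) by exact: piece_energy_measurable.
have mass0 i x : (0 <= mass i x)%E by rewrite lee_fin; apply: piece_mass_ge0 ME _ _ => //.
have energy0 i x : (0 <= energy i x)%E by rewrite lee_fin; apply: piece_energy_ge0 ME _ _ => //.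
have piece_le i : (iint (mass i) <= iint (energy i))%E.
  apply: (@le_iint_lines _ _ _ _ (a i) (fun v => slack a c i (rcons_rv (0, v)))) => //.
  move=> v.
  (* Shifting by [A] along the unit normal puts the base point [b] on the i-th hyperplane. *)
  set A := slack a c i (rcons_rv (0, v)).
  pose b := rcons_rv (0, v) + A *: a i.
  have lineE t : rcons_rv (0, v) + (A - t) *: a i = b + t *: - a i.
    by rewrite scalerBl scalerN addrA.
  have b0 : slack a c i b = 0.
    rewrite /slack dotDr dotZr dot_enorm a1 expr1n mulr1 opprD addrA.
    by rewrite -/(slack a c i _) -/A subrr.
  under eq_integral do rewrite lineE.
  under [leRHS]eq_integral do rewrite lineE.
  exact: (piece_slice_le q1 qp bO a1 PO' spsi psiK' ME kap0 b0 (m0 i) (Km' i)).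
have lhs : ((tangent_slope p q M kap)%:E * integral_on O (fun x => (`|psi x| `^ q)%R) =
    \sum_(i < k) iint (mass i))%E.
  have mpsi : measurable_fun setT (fun x => (\1_O x * `|psi x| `^ q)%:E).
    apply: measurable_indic_continuous => //.
    exact: (continuous_powR_rv q0 (smooth_continuous spsi)).
  have psi0 x : (0 <= (\1_O x * `|psi x| `^ q)%:E)%E.
    by rewrite lee_fin mulr_ge0// powR_ge0.
  rewrite -iint_sum// /integral_on -iintZl//.
  apply: eq_iint => x; rewrite -EFinM sumEFin; congr EFin.
  rewrite /piece_mass -mulr_suml.
  have [Kx|Kx] := pselect (K' x); last first.
    by rewrite psiK'// normr0 powR0 ?gt_eqF// !mulr0.
  rewrite sum_indic_piece_eq1//; last first.
    by move=> i; apply: lt_le_trans (Km' i x Kx); exact: m0.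
  by rewrite indicE mem_set ?mul1r//; exact: K'O.
have rhs : (\sum_(i < k) iint (energy i) <=
    integral_on O (fun x => (grad_norm psi x `^ p)%R) +
    (tangent_offset p q M kap)%:E * volume O)%E.
  have mg : measurable_fun setT (fun x => (\1_O x * grad_norm psi x `^ p)%:E).
    apply: measurable_indic_continuous => //.
    exact: (continuous_powR_grad p0 spsi).
  have m1 : measurable_fun setT (fun x => (\1_O x)%:E : \bar R).
    by apply/measurable_EFinP; exact: measurable_indic.
  have m2 : measurable_fun setT (fun x => ((tangent_offset p q M kap)%:E * (\1_O x)%:E)%E).
    exact: measurable_funeM.
  have g0 x : (0 <= (\1_O x * grad_norm psi x `^ p)%:E)%E.
    by rewrite lee_fin mulr_ge0// powR_ge0.
  have g20 x : (0 <= (tangent_offset p q M kap)%:E * (\1_O x)%:E)%E.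
    by rewrite -EFinM lee_fin mulr_ge0.
  rewrite -iint_sum// /integral_on /volume -iintZl// -iintD//.
  apply: le_iint.
  - exact: emeasurable_sum.
  - exact: emeasurable_funD.
  - by move=> x; apply: sume_ge0.
  move=> x; rewrite sumEFin -EFinM -EFinD lee_fin /piece_energy -mulr_suml.
  rewrite [tangent_offset _ _ _ _ * _]mulrC -mulrDr ler_wpM2r//.
    by rewrite addr_ge0// powR_ge0.
  exact: sum_indic_piece.
rewrite lhs; apply: le_trans rhs.
by apply: lee_sum => i _; exact: piece_le.
Qed.

End lower_bound.

                        

Section lambda_lower_bound.
Context {R : realType} {n : nat}.
Variables (p q : R) (q1 : 1 <= q) (qp : q < p).
Variables (O : set 'rV[R]_n.+1).
Hypotheses (oO : open O) (bO : bounded_set O) (cO : convex O) (O0 : O !=set0).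

Let q0 : 0 < q. Proof. exact: lt_le_trans q1. Qed.
Let p0 : 0 < p. Proof. exact: lt_trans qp. Qed.

Let V := fine (volume O).

Let VE : volume O = V%:E.
Proof. exact/esym/fineK/volume_fin_num. Qed.

Let V0 : 0 < V.
Proof. by rewrite -lte_fin -VE; exact: volume_gt0. Qed.

Let M := (fine (pi_pq p q) / 2) `^ p * inradius O `^ (- p).

(** The tangent point 1/V is the mean of |psi|^q over O, the optimal choice. With s = p/q, slope
    minus offset times V is M (s - (s - 1)) V^(1-s) = M V^(-(p-q)/q). *)
Lemma energy_lower_bound (psi : 'rV[R]_n.+1 -> R) : Cc_infty O psi ->
  integral_on O (fun x => `|psi x| `^ q) = 1%E ->
  ((M * V `^ (- ((p - q) / q)))%:E <=
   integral_on O (fun x => (grad_norm psi x `^ p)%R))%E.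
Proof.
move=> cpsi psi1.
have k0 : 0 < V^-1 by rewrite invr_gt0.
have := integral_piece_le q1 qp oO bO cO O0 cpsi (ltW k0) (erefl M).
rewrite psi1 mule1 VE; set E := integral_on _ _.
have E0 : (0 <= E)%E.
  by apply: iint_ge0 => x; rewrite lee_fin mulr_ge0 ?powR_ge0.
have s1 : p / q - 1 = (p - q) / q by rewrite mulrBl divff ?gt_eqF.
have ps : 0 < p / q by rewrite divr_gt0.
case: E E0 => [e|_ _|//]; last by rewrite leey.
move=> _; rewrite -EFinM -EFinD !lee_fin /tangent_slope /tangent_offset.
have -> : V^-1 `^ (p / q) = V^-1 * V^-1 `^ (p / q - 1).
  by rewrite mulr_powRB1// ltW.
have -> : V `^ (- ((p - q) / q)) = V^-1 `^ (p / q - 1).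
  have VN : V^-1 = V `^ (- 1) by rewrite powR_inv1// ltW.
  by rewrite VN -powRrM mulN1r s1.
set X := V^-1 `^ _; set s := p / q.
have -> : M * ((s - 1) * (V^-1 * X)) * V = M * ((s - 1) * X).
  by field; rewrite gt_eqF.
by move: (M) => m h; rewrite -subr_ge0; move: h; rewrite -subr_ge0;
   congr (0 <= _ : bool); ring.
Qed.

Lemma lambda_lower_bound :
  ((pi_pq p q * (2^-1)%:E) `^ p * (inradius O `^ (- p))%:E <=
   lambda_pq p q O * volume O `^ ((p - q) / q))%E.
Proof.
have -> : ((pi_pq p q * (2^-1)%:E) `^ p * (inradius O `^ (- p))%:E = M%:E)%E.
  have PE := esym (fineK (pi_pq_fin_num p0 q0)).
  by rewrite /M; move: (fine _) PE => P ->.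
have -> : (M%:E = (M * V `^ (- ((p - q) / q)))%:E * volume O `^ ((p - q) / q))%E.
  rewrite VE poweR_EFin -EFinM -mulrA powRN mulVf ?mulr1//.
  by rewrite gt_eqF// powR_gt0.
apply: lee_wpmul2r; first exact: poweR_ge0.
apply: le_ereal_inf_tmp => _ [psi [cpsi psi1] <-].
exact: energy_lower_bound.
Qed.

End lambda_lower_bound.

(** * Smooth functions of several variables *)

Section smooth_functions.
Context {R : realType} {N : nat}.
Implicit Types (f g : 'rV[R]_N -> R) (x v : 'rV[R]_N).

(** Continuity is part of every level, because the existence of all directional derivatives does not
    imply it. *)
Fixpoint ndiffk (k : nat) f : Prop := continuous f /\
  if k is k'.+1 then forall v, (forall x, derivable f x v) /\
    ndiffk k' (fun x => 'D_v f x)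
  else True.

Lemma ndiffk_le k f : ndiffk k.+1 f -> ndiffk k f.
Proof.
elim: k f => [|k IH] f [cf fk]; first by split.
by split=> // v; have [df /IH dfk] := fk v.
Qed.

Lemma smoothP f : (forall k, ndiffk k f) -> smooth f.
Proof.
move=> kf vs.
have : ndiffk 1 (iter_dderive vs f).
  suff H k : ndiffk (k + size vs) f -> ndiffk k (iter_dderive vs f) by exact: H.
  elim: vs k => [|v vs IH] k /=; first by rewrite addn0.
  by rewrite addnS -addSn => /IH [_ /(_ v)[]].
by move=> [cf df]; split=> // x v; have [] := df v.
Qed.

Lemma ndiffkD k f g : ndiffk k f -> ndiffk k g -> ndiffk k (fun x => f x + g x).
Proof.
elim: k f g => [|k IH] f g [cf fk] [cg gk].
  by split=> // x; apply: continuousD; [exact: cf|exact: cg].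
split=> [x|v]; first by apply: continuousD; [exact: cf|exact: cg].
have [df dfk] := fk v; have [dg dgk] := gk v; split.
  by move=> x; exact: derivableD.
rewrite [X in ndiffk _ X](_ : _ = fun x => 'D_v f x + 'D_v g x); first exact: IH.
by apply/funext => x; exact: deriveD.
Qed.

Lemma ndiffkM k f g : ndiffk k f -> ndiffk k g -> ndiffk k (fun x => f x * g x).
Proof.
elim: k f g => [|k IH] f g kf kg.
  have [cf _] := kf; have [cg _] := kg.
  by split=> // x; apply: continuousM; [exact: cf|exact: cg].
have [cf fk] := kf; have [cg gk] := kg.
split=> [x|v]; first by apply: continuousM; [exact: cf|exact: cg].
have [df dfk] := fk v; have [dg dgk] := gk v; split.
  by move=> x; exact: derivableM.
rewrite [X in ndiffk _ X](_ : _ = fun x => f x * 'D_v g x + g x * 'D_v f x).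
  exact: (ndiffkD (IH _ _ (ndiffk_le kf) dgk) (IH _ _ (ndiffk_le kg) dfk)).
by apply/funext => x; exact: deriveM.
Qed.

Lemma ndiffk_cst k (c : R) : ndiffk k (fun _ : 'rV[R]_N => c).
Proof.
elim: k c => [|k IH] c; first by split=> // x; exact: cst_continuous.
split=> [x|v]; first exact: cst_continuous.
split=> [x|]; first exact: derivable_cst.
rewrite [X in ndiffk _ X](_ : _ = fun _ => 0); first exact: IH.
by apply/funext => x; exact: derive_cst.
Qed.

Lemma is_derive_of_line f x v (d : R) :
  is_derive (0 : R) (1 : R) (fun s => f (x + s *: v)) d -> is_derive x v f d.
Proof.
move=> [df fd].
have E : (fun h : R => h^-1 *: (((fun s => f (x + s *: v)) \o shift 0) (h *: 1) -
      f (x + 0 *: v))) =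
    (fun h : R => h^-1 *: ((f \o shift x) (h *: v) - f x)).
  apply/funext => h /=; rewrite scale0r !addr0.
  by congr (_ *: (f _ - _)); rewrite [h *: 1]mulr1 addrC.
by apply: DeriveDef; [move: df; rewrite /derivable E|rewrite -fd /derive E].
Qed.

Lemma is_derive_coord (u : R -> R) (j : 'I_N) x v : smooth1 u ->
  is_derive x v (fun x => u (x ord0 j)) (derive1 u (x ord0 j) * v ord0 j).
Proof.
move=> su; apply: is_derive_of_line.
rewrite (_ : (fun s => _) = u \o (fun s : R => x ord0 j + s * v ord0 j)); last first.
  by apply/funext => s /=; rewrite !mxE.
apply: is_derive1_comp.
  by rewrite mul0r addr0; exact: smooth1_is_derive.
have d1 : is_derive (0 : R) (1 : R) (fun s : R => s * v ord0 j) (v ord0 j).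
  have := is_deriveM (is_derive_id (0 : R) (1 : R)) (is_derive_cst (v ord0 j) (0 : R) (1 : R)).
  by rewrite /GRing.scale /= mulr0 add0r mulr1.
have := is_deriveD (is_derive_cst (x ord0 j) (0 : R) (1 : R)) d1.
by rewrite add0r.
Qed.

Lemma ndiffk_coord k (u : R -> R) (j : 'I_N) : smooth1 u ->
  ndiffk k (fun x => u (x ord0 j)).
Proof.
have cu (w : R -> R) : smooth1 w -> continuous (fun x : 'rV[R]_N => w (x ord0 j)).
  move=> sw x; apply: (@continuous_comp _ _ _ (fun x : 'rV[R]_N => x ord0 j) w).
    exact: coord_continuous.
  exact: smooth1_continuous.
elim: k u => [|k IH] u su; first by split=> //; exact: cu.
split=> [|v]; first exact: cu.
split=> [x|]; first by have [] := is_derive_coord j x v su.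
rewrite [X in ndiffk _ X](_ : _ = fun x => derive1 u (x ord0 j) * v ord0 j).
  by apply: ndiffkM; [apply: IH; exact: smooth1_derive1|exact: ndiffk_cst].
by apply/funext => x; have [] := is_derive_coord j x v su.
Qed.

Lemma ndiffk_prod k (I : Type) (r : seq I) (F : I -> 'rV[R]_N -> R) :
  (forall i, ndiffk k (F i)) -> ndiffk k (fun x => \prod_(i <- r) F i x).
Proof.
move=> kF; elim: r => [|i r IH].
  rewrite [X in ndiffk _ X](_ : _ = fun=> 1); first exact: ndiffk_cst.
  by apply/funext => x; rewrite big_nil.
rewrite [X in ndiffk _ X](_ : _ = fun x => F i x * \prod_(j <- r) F j x).
  exact: ndiffkM.
by apply/funext => x; rewrite big_cons.
Qed.

Lemma ndiffk_smooth k f : smooth f -> ndiffk k f.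
Proof.
elim: k f => [|k IH] f sf; first by split=> //; exact: smooth_continuous.
split=> [|v]; first exact: smooth_continuous.
split=> [x|]; first exact: smooth_derivable.
by apply: IH; exact: smooth_dderive.
Qed.

End smooth_functions.

                           

(** * Homogeneity of the Rayleigh quotient *)

Section lambda_scaling.
Context {R : realType} {N : nat}.
Implicit Types (O : set 'rV[R]_N) (psi : 'rV[R]_N -> R).

Lemma dderive_scale (k : R) psi x v : smooth psi ->
  'D_v (fun y => k * psi y) x = k * 'D_v psi x.
Proof.
by move=> sp; have := @deriveZ _ _ _ psi k x v (smooth_derivable sp).
Qed.

Lemma smooth_scale (k : R) psi : smooth psi -> smooth (fun x => k * psi x).
Proof.
move=> sp; apply: smoothP => j.
by apply: ndiffkM; [exact: ndiffk_cst|exact: ndiffk_smooth].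
Qed.

Lemma grad_norm_scale (k : R) psi x : smooth psi ->
  grad_norm (fun y => k * psi y) x = `|k| * grad_norm psi x.
Proof.
move=> sp; rewrite /grad_norm -enormZ; congr enorm.
by apply/rowP => i; rewrite !mxE dderive_scale.
Qed.

(** The counterpart of [pi_pq_le] in several variables: the test function is normalised by the
    factor A^(-1/q), which multiplies the energy by A^(-p/q). *)
Lemma lambda_pq_le (p q A : R) O psi : 1 <= q -> q < p -> open O ->
  Cc_infty O psi -> 0 < A ->
  integral_on O (fun x => `|psi x| `^ q) = A%:E ->
  (lambda_pq p q O <=
   (A `^ (- (p / q)))%:E * integral_on O (fun x => (grad_norm psi x `^ p)%R))%E.
Proof.
move=> q1 qp oO [spsi [K cK psiK]] A0 psiA.
have q0 : 0 < q by exact: lt_le_trans q1.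
have p0 : 0 < p by exact: lt_trans qp.
pose k := A `^ (- q^-1); have k0 : 0 < k by exact: powR_gt0.
have mO := open_rv_measurable oO.
have scaleE (r : R) (g : 'rV[R]_N -> R) : 0 < r -> (forall x, 0 <= g x) ->
    continuous (fun x => g x `^ r) ->
    integral_on O (fun x => (k * g x) `^ r) =
    ((k `^ r)%:E * integral_on O (fun x => (g x `^ r)%R))%E.
  move=> r0 g0 cg; rewrite /integral_on -iintZl ?powR_ge0//.
  - by apply: eq_iint => x; rewrite powRM// ?(ltW k0)// -EFinM mulrCA.
  - exact: measurable_indic_continuous.
  - by move=> x; rewrite lee_fin mulr_ge0// powR_ge0.
apply: (@ge_ereal_inf _ _ _); exists (integral_on O (fun x => (k * grad_norm psi x) `^ p)).
  exists (fun x => k * psi x).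
    split.
      split; first exact: smooth_scale.
      by exists K => // x /psiK ->; rewrite mulr0.
    rewrite (_ : (fun x => _) = fun x => (k * `|psi x|) `^ q); last first.
      by apply/funext => x; rewrite normrM (gtr0_norm k0).
    rewrite scaleE//; last first.
      by apply: continuous_powR_rv => //; exact: smooth_continuous.
    rewrite psiA -EFinM /k -powRrM mulNr mulVf ?gt_eqF// powR_inv1 ?(ltW A0)//.
    by rewrite mulVf ?gt_eqF.
  congr integral_on; apply/funext => x.
  by rewrite grad_norm_scale// (gtr0_norm k0).
rewrite scaleE//; last 2 first.
- by move=> x; exact: enorm_ge0.
- exact: (continuous_powR_grad p0 spsi).
by rewrite /k -powRrM mulNr [q^-1 * p]mulrC.
Qed.

End lambda_scaling.

(** * Boxes as convex domains, and their inradius *)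

Section boxes.
Context {R : realType} {n : nat}.
Implicit Types (u v : 'I_n -> R).

Lemma convex_convex_set (C : set 'rV[R]_n) : convex C ->
  convex_set (C : set (convex_lmodType 'rV[R]_n)).
Proof.
move=> cC x y l /set_mem Cx /set_mem Cy; apply/mem_set.
have l0 : 0 <= l%:inum by [].
have l1 : l%:inum <= 1 by [].
have := cC y x l%:inum Cy Cx l0 l1.
set z := (X in C X -> _); move=> Cz.
suff -> : conv l x y = z by [].
transitivity (l%:inum *: x + (1 - l%:inum) *: y); first by [].
by rewrite /z scalerBl scale1r scalerBr addrCA addrA.
Qed.

Lemma box_convex u v : convex (box u v).
Proof.
move=> x y t bx bY t0 t1 i; have /andP[x1 x2] := bx i; have /andP[y1 y2] := bY i.
rewrite !mxE; move: (x ord0 i) (y ord0 i) (u i) (v i) x1 x2 y1 y2 => X Y a b ? ? ? ?.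
have [XY|/ltW YX] := leP X Y.
  have h1 : 0 <= t * (Y - X) by rewrite mulr_ge0// subr_ge0.
  have h2 : 0 <= (1 - t) * (Y - X) by rewrite mulr_ge0// subr_ge0.
  by apply/andP; split; lra.
have h1 : 0 <= t * (X - Y) by rewrite mulr_ge0// subr_ge0.
have h2 : 0 <= (1 - t) * (X - Y) by rewrite mulr_ge0// subr_ge0.
by apply/andP; split; lra.
Qed.

Lemma box_bounded u v (B : R) : (forall i, - B <= u i /\ v i <= B) -> 0 <= B ->
  bounded_set (box u v).
Proof.
move=> uvB B0; exists B; split; first exact: num_real.
move=> r Br x bx.
suff : mx_norm x <= r by [].
rewrite mx_normrE; apply/bigmax_leP; split => /=.
  exact: le_trans (ltW Br).
move=> [i j] _ /=; rewrite ord1; apply: le_trans (ltW Br).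
have /andP[x1 x2] := bx j; have [u1 v1] := uvB j.
by rewrite ler_norml (le_trans u1 (ltW x1)) (le_trans (ltW x2) v1).
Qed.

Lemma box_open u v : open (box u v).
Proof.
rewrite (_ : box u v = \big[setI/setT]_(i < n)
  ((fun x : 'rV[R]_n => x ord0 i) @^-1` `]u i, v i[%classic)).
  elim/big_ind : _ => [|A B|i _]; first exact: openT.
    exact: openI.
  apply: open_comp; last exact: interval_open.
  by move=> x _; exact: coord_continuous.
rewrite -bigcap_seq; apply/seteqP; split => [x bx i _|x bx i].
  by rewrite /= in_itv /= bx.
by have := bx i (mem_index_enum i); rewrite /= in_itv.
Qed.

End boxes.

(** A ball of larger radius would reach both ends of the first side, or beyond, along the first
    axis. *)
Lemma inradius_box (R : realType) n (u v : 'I_n.+1 -> R) :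
  u ord0 <= v ord0 -> inradius (box u v) <= (v ord0 - u ord0) / 2.
Proof.
move=> uv; apply: inradius_le; first by rewrite divr_ge0// subr_ge0.
move=> x s s0 bx sbox; rewrite leNgt; apply/negP => hs.
set d := (v ord0 - u ord0) / 2 in hs.
have d0 : 0 <= d by rewrite divr_ge0// subr_ge0.
have H (c : R) : `|c| <= d -> u ord0 < x ord0 ord0 + c < v ord0.
  move=> cd.
  have /sbox/(_ ord0) : eball x s (x + c *: delta_mx ord0 ord0).
    by rewrite /eball /= addrC addKr enormZ enorm_delta mulr1 (le_lt_trans cd).
  by rewrite !mxE !eqxx mulr1.
have /andP[h1 _] : u ord0 < x ord0 ord0 + (- d) < v ord0.
  by apply: H; rewrite normrN ger0_norm.
have /andP[_ h2] : u ord0 < x ord0 ord0 + d < v ord0 by apply: H; rewrite ger0_norm.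
by move: h1 h2; rewrite /d; move: (x ord0 ord0) (u ord0) (v ord0) => X a b; lra.
Qed.

Section product_functions.
Context {R : realType}.
Local Notation mu := (@lebesgue_measure R).

Lemma smooth_prod N (f : 'I_N -> R -> R) : (forall i, smooth1 (f i)) ->
  smooth (fun x : 'rV[R]_N => \prod_(i < N) f i (x ord0 i)).
Proof.
by move=> sf; apply: smoothP => k; apply: ndiffk_prod => i; exact: ndiffk_coord.
Qed.

Lemma dderive_prod N (f : 'I_N -> R -> R) (j : 'I_N) (x : 'rV[R]_N) :
  (forall i, smooth1 (f i)) ->
  'D_(delta_mx ord0 j) (fun x : 'rV[R]_N => \prod_(i < N) f i (x ord0 i)) x =
  derive1 (f j) (x ord0 j) * \prod_(i < N | i != j) f i (x ord0 i).
Proof.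
move=> sf; apply: derive_val; apply: is_derive_of_line.
set c := \prod_(i < N | i != j) _.
rewrite [X in is_derive _ _ X _](_ : _ =
    (fun s : R => (f j \o (fun s : R => x ord0 j + s)) s * c)); last first.
  apply/funext => s; rewrite (bigD1 j)//= !mxE !eqxx mulr1; congr *%R.
  by apply: eq_bigr => i ij; rewrite !mxE eqxx (negbTE ij) mulr0 addr0.
have d1 : is_derive (0 : R) (1 : R) (f j \o (fun s : R => x ord0 j + s))
    (derive1 (f j) (x ord0 j) * (0 + 1)).
  apply: is_derive1_comp; first by rewrite addr0; exact: smooth1_is_derive.
apply: is_derive_eq (is_deriveM d1 (is_derive_cst c (0 : R) (1 : R))) _.
by rewrite /GRing.scale /=; ring.
Qed.

Lemma enorm_le N (v w : 'rV[R]_N) : (forall i, `|v ord0 i| <= w ord0 i) ->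
  enorm v <= enorm w.
Proof.
move=> vw; rewrite ler_wsqrtr//; apply: ler_sum => i _.
rewrite -(real_normK (num_real (v ord0 i))) lerXn2r ?nnegrE//.
exact: le_trans (normr_ge0 _) (vw i).
Qed.

Lemma integral_on_box_prod N (u v : 'I_N -> R) (g : 'I_N -> R -> R) (r : 'I_N -> R) :
  (forall i, continuous (g i)) -> (forall i t, 0 <= g i t) ->
  (forall i, (\int[mu]_(t in `]u i, v i[) (g i t)%:E)%E = (r i)%:E) ->
  integral_on (box u v) (fun x => \prod_(i < N) g i (x ord0 i)) =
  (\prod_(i < N) r i)%:E.
Proof.
move=> cg g0 gr; rewrite /integral_on.
pose h i t := \1_(`]u i, v i[%classic : set R) t * g i t.
rewrite (@eq_iint _ _ _ (fun x => (\prod_(i < N) h i (x ord0 i))%:E)); last first.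
  by move=> x; rewrite indic_box -big_split.
apply: iint_prod => [i|i t|i].
- by apply: measurable_funM; [exact: measurable_indic|exact: continuous_measurable_fun].
- by rewrite mulr_ge0// indicE.
- rewrite -gr [RHS]integral_mkcond; apply: eq_integral => t _.
  by rewrite patchE /h indicE; case: ifP => _; rewrite ?mul1r ?mul0r.
Qed.

Lemma powR_prod (I : Type) (r : seq I) (P : pred I) (F : I -> R) (s : R) :
  (forall i, 0 <= F i) ->
  (\prod_(i <- r | P i) F i) `^ s = \prod_(i <- r | P i) F i `^ s.
Proof.
move=> F0.
suff [] : 0 <= \prod_(i <- r | P i) F i /\
  (\prod_(i <- r | P i) F i) `^ s = \prod_(i <- r | P i) F i `^ s by [].
elim/big_ind2 : _ => [|x x' y y' [x0 xE] [y0 yE]|i _]; first by rewrite powR1.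
- by rewrite mulr_ge0// powRM// xE yE.
- by split.
Qed.

Lemma derive1_plateau_eq0 (L x : R) : 2 < x -> x < L - 2 ->
  derive1 (plateau L) x = 0.
Proof.
move=> x2 xL; rewrite derive1E; apply: derive_val.
apply: near_eq_is_derive (is_derive_cst (1 : R) x (1 : R)).
near=> y; rewrite plateau_eq1//.
apply/andP; split; first by apply: ltW; near: y; exact: lt_nbhsr.
by apply: ltW; near: y; exact: lt_nbhsl.
Unshelve. all: by end_near. Qed.

End product_functions.

(** * Sharpness: test functions on long slabs *)

Section sharpness.
Context {R : realType} {n : nat}.
Local Notation mu := (@lebesgue_measure R).
Variables (p q : R) (q1 : 1 <= q) (qp : q < p).
Variables (u : R -> R) (cu : Cc_infty1 `]0, 1[ u).
Variable b : R.
Hypothesis u1 : (\int[mu]_(x in `]0%R, 1%R[) (`|u x| `^ q)%:E)%E = 1%E.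
Hypothesis ub : (\int[mu]_(x in `]0%R, 1%R[) (`|derive1 u x| `^ p)%:E)%E = b%:E.

Let q0 : 0 < q. Proof. exact: lt_le_trans q1. Qed.
Let p0 : 0 < p. Proof. exact: lt_trans qp. Qed.

Definition slab_end (s t : R) (i : 'I_n.+1) : R := if i == ord0 then s else t.
(** The box (0,1) x (0,L)^n: its width is 1 in the first direction while the others grow. *)
Definition slab (L : R) : set 'rV[R]_n.+1 := box (fun=> 0) (slab_end 1 L).
(** The part (0,1) x (2,L-2)^n, on which every cut-off is locally constant and equal to 1. *)
Definition slab_core (L : R) : set 'rV[R]_n.+1 :=
  box (slab_end 0 2) (slab_end 1 (L - 2)).
Definition slab_factor (L : R) (i : 'I_n.+1) : R -> R :=
  if i == ord0 then u else plateau L.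
Definition slab_test (L : R) (x : 'rV[R]_n.+1) : R :=
  \prod_(i < n.+1) slab_factor L i (x ord0 i).

Lemma smooth1_slab_factor L i : smooth1 (slab_factor L i).
Proof.
by rewrite /slab_factor; case: ifP => _; [case: cu|exact: smooth1_plateau].
Qed.

Lemma smooth_slab_test L : smooth (slab_test L).
Proof. exact: smooth_prod (smooth1_slab_factor L). Qed.

Lemma slab_test_Cc L : Cc_infty (slab L) (slab_test L).
Proof.
split; first exact: smooth_slab_test.
have [_ [K [cK KI] uK]] := cu.
exists [set x : 'rV[R]_n.+1 | forall i, (if i == ord0 then K else `[1, L - 1]%classic) (x ord0 i)].
  split.
    apply: (@rV_compact _ _ (fun i => if i == ord0 then K else `[1, L - 1]%classic)) => i.
    by case: ifP => // _; exact: segment_compact.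
  move=> x Kx i; have := Kx i; rewrite /slab_end; case: ifP => _.
    by move=> /KI; rewrite /= in_itv.
  by rewrite /= in_itv /= => /andP[? ?]; apply/andP; split; lra.
move=> x nK.
have [i ni] : exists i, ~ (if i == ord0 then K else `[1, L - 1]%classic) (x ord0 i).
  by apply: contrapT => H; apply: nK => i; apply: contrapT => ni; apply: H; exists i.
rewrite /slab_test (bigD1 i)//= /slab_factor.
case: ifP ni => _ ni; first by rewrite uK// mul0r.
by rewrite plateau_eq0 ?mul0r.
Qed.

Lemma volume_slab L : 0 <= L -> volume (slab L) = (L ^+ n)%:E.
Proof.
move=> L0; rewrite volume_box; last first.
  by move=> i; rewrite /slab_end; case: ifP.
congr EFin; rewrite big_ord_recl /slab_end eqxx subr0 mul1r.
by rewrite (eq_bigr (fun=> L)) ?prodr_const ?card_ord// => i _; rewrite subr0.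
Qed.

Lemma volume_slab_core L : 4 <= L -> volume (slab_core L) = ((L - 4) ^+ n)%:E.
Proof.
move=> L4; rewrite volume_box; last first.
  by move=> i; rewrite /slab_end; case: ifP => _; lra.
congr EFin; rewrite big_ord_recl /slab_end eqxx subr0 mul1r.
rewrite (eq_bigr (fun=> L - 4)) ?prodr_const ?card_ord// => i _ /=; ring.
Qed.

(** The integral factorises; the factor of u is 1 by normalisation, and each cut-off contributes at
    least the length L - 4 of the interval where it equals 1. *)
Lemma slab_mass L : 4 <= L -> exists2 A : R, (L - 4) ^+ n <= A &
  integral_on (slab L) (fun x => `|slab_test L x| `^ q) = A%:E.
Proof.
move=> L4.
have cpl := continuous_powR_comp q0 (smooth1_continuous (@smooth1_plateau R L)).
have cuq := continuous_powR_comp q0 (smooth1_continuous (cu.1)).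
have [c cE] : exists c, (\int[mu]_(t in `]0%R, L[) (`|plateau L t| `^ q)%:E)%E = c%:E.
  by eexists; apply/esym/fineK; exact: (continuous_integral_fin _ _ cpl).
have cL : L - 4 <= c.
  have L2 : 2 <= L - 2 by lra.
  have L42 : L - 4 = L - 2 - 2 by ring.
  rewrite L42 -lee_fin -cE.
  rewrite -(integral_indic_itv L2).
  rewrite [X in (_ <= X)%E]integral_mkcond.
  apply: (@ge0_le_integral _ _ _ mu setT measurableT).
  - by move=> t _; rewrite lee_fin indicE.
  - by apply/measurable_EFinP; exact: measurable_indic.
  - apply/(measurable_restrictT _ (measurable_itv _)).
    exact: continuous_EFin_measurable (measurable_itv _) cpl.
  move=> t _; rewrite patchE indicE.
  have [/set_mem|_] := boolP (t \in (`]2, (L - 2)[%classic : set R)); last first.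
    by case: ifP => // _; rewrite lee_fin powR_ge0.
  rewrite /= in_itv /= => /andP[t2 tL].
  rewrite ifT; last by apply/mem_set; rewrite /= in_itv /=; apply/andP; split; lra.
  by rewrite plateau_eq1 ?normr1 ?powR1// (ltW t2) (ltW tL).
exists (c ^+ n); first by rewrite lerXn2r ?nnegrE//; lra.
rewrite (_ : c ^+ n = \prod_(i < n.+1) (if i == ord0 then 1 else c)); last first.
  by rewrite big_ord_recl eqxx mul1r (eq_bigr (fun=> c)) ?prodr_const ?card_ord.
rewrite -(@integral_on_box_prod R n.+1 (fun=> 0) (slab_end 1 L)
  (fun i t => `|slab_factor L i t| `^ q)).
- congr integral_on; apply/funext => x; rewrite /slab_test.
  by rewrite normr_prod powR_prod.
- by move=> i; rewrite /slab_factor; case: ifP.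
- by move=> i t; exact: powR_ge0.
- by move=> i; rewrite /slab_factor /slab_end; case: ifP.
Qed.

(** On the core the gradient norm is |u'(x_0)|, and on the rest of the slab its p-th power is at
    most a constant G independent of L. Hence the energy is at most b L^n + G (L^n - (L-4)^n); the
    negative term stands on the left so that only nonnegative functions are integrated. *)
Lemma slab_energy : exists2 G : R, 0 <= G & forall L, 4 <= L ->
  (integral_on (slab L) (fun x => (grad_norm (slab_test L) x `^ p)%R) +
     (G * (L - 4) ^+ n)%:E <= (b * L ^+ n + G * L ^+ n)%:E)%E.
Proof.
have [C [C0 uC]] := continuous_bounded_itv 0 1 (smooth1_continuous cu.1).
have [D [D0 uD]] := continuous_bounded_itv 0 1
  (smooth1_continuous (smooth1_derive1 cu.1)).
have [D' plD] := @derive1_plateau_bounded R.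
have D'0 : 0 <= D' by apply: le_trans (plD 0 0).
(* A bound for each partial derivative: D + D' dominates the derivative of any factor, be it u or a
   cut-off, and C + 1 dominates the value of any factor. *)
pose w : 'rV[R]_n.+1 := \row_j ((D + D') * \prod_(i < n.+1 | i != j) (C + 1)).
exists (enorm w `^ p) => [|L L4]; first exact: powR_ge0.
set G := enorm w `^ p; have G0 : 0 <= G by exact: powR_ge0.
have L0 : 0 <= L by lra.
have mslab : measurable (slab L) by exact: measurable_box.
have mcore : measurable (slab_core L) by exact: measurable_box.
have cgrad := continuous_powR_grad p0 (smooth_slab_test L).
pose g (i : 'I_n.+1) (t : R) := if i == ord0 then `|derive1 u t| `^ p else 1.
have cg i : continuous (g i).
  rewrite /g; case: (i == ord0); last by move=> x; exact: cst_continuous.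
  exact: (continuous_powR_comp p0 (smooth1_continuous (smooth1_derive1 cu.1))).
have g0 i t : 0 <= g i t by rewrite /g; case: ifP => _ //; exact: powR_ge0.
have gE x : \prod_(i < n.+1) g i (x ord0 i) = `|derive1 u (x ord0 ord0)| `^ p.
  by rewrite big_ord_recl /g eqxx big1 ?mulr1.
have gint : integral_on (slab L) (fun x => `|derive1 u (x ord0 ord0)| `^ p) =
    (b * L ^+ n)%:E.
  rewrite (_ : b * L ^+ n = \prod_(i < n.+1) slab_end b L i); last first.
    rewrite big_ord_recl /slab_end eqxx.
    by rewrite (eq_bigr (fun=> L)) ?prodr_const ?card_ord.
  rewrite -(@integral_on_box_prod R n.+1 (fun=> 0) (slab_end 1 L) g)//.
    by congr integral_on; apply/funext => x; rewrite gE.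
  move=> i; rewrite /g /slab_end; case: ifP => _; first exact: ub.
  have := integral_indic_itv L0; rewrite subr0 => <-.
  rewrite integral_mkcond; apply: eq_integral => t _.
  by rewrite patchE indicE; case: ifP.
rewrite EFinD EFinM -(volume_slab_core L4) [(G * L ^+ n)%:E]EFinM -(volume_slab L0).
rewrite -gint /volume /integral_on.
have m1 (A : set 'rV[R]_n.+1) : measurable A ->
    measurable_fun setT (fun x => (\1_A x)%:E : \bar R).
  by move=> mA; apply/measurable_EFinP; exact: measurable_indic.
have m2 (A : set 'rV[R]_n.+1) : measurable A ->
    measurable_fun setT (fun x => (G%:E * (\1_A x)%:E)%E).
  by move=> mA; apply: measurable_funeM; exact: m1.
have i0 (A : set 'rV[R]_n.+1) x : (0 <= (\1_A x)%:E :> \bar R)%E.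
  by rewrite lee_fin indicE.
have i2 (A : set 'rV[R]_n.+1) x : (0 <= G%:E * (\1_A x)%:E)%E.
  by rewrite mule_ge0// lee_fin.
have mgr : measurable_fun setT
    (fun x => (\1_(slab L) x * grad_norm (slab_test L) x `^ p)%:E).
  exact: measurable_indic_continuous.
have gr0 x : (0 <= (\1_(slab L) x * grad_norm (slab_test L) x `^ p)%:E)%E.
  by rewrite lee_fin mulr_ge0 ?powR_ge0// indicE.
have mu' : measurable_fun setT
    (fun x => (\1_(slab L) x * `|derive1 u (x ord0 ord0)| `^ p)%:E).
  apply: measurable_indic_continuous => // x.
  rewrite (_ : (fun x => _) =
    (fun t => `|derive1 u t| `^ p) \o (fun x : 'rV[R]_n.+1 => x ord0 ord0))//.
  apply: continuous_comp; first exact: coord_continuous.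
  exact: (continuous_powR_comp p0 (smooth1_continuous (smooth1_derive1 cu.1))).
have u'0 x : (0 <= (\1_(slab L) x * `|derive1 u (x ord0 ord0)| `^ p)%:E)%E.
  by rewrite lee_fin mulr_ge0 ?powR_ge0// indicE.
have mcore1 := m1 _ mcore; have mcore2 := m2 _ mcore.
have mslab1 := m1 _ mslab; have mslab2 := m2 _ mslab.
rewrite -!iintZl// -!iintD//.
apply: le_iint.
- exact: emeasurable_funD.
- exact: emeasurable_funD.
- by move=> x; apply: adde_ge0.
move=> x; rewrite -!EFinM -!EFinD lee_fin.
have core_slab : slab_core L x -> slab L x.
  move=> H i; have := H i; rewrite /slab_end; case: ifP => // _ /andP[? ?].
  by apply/andP; split; lra.
have gradE : grad_norm (slab_test L) x =
    enorm (\row_j (derive1 (slab_factor L j) (x ord0 j) *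
      \prod_(i < n.+1 | i != j) slab_factor L i (x ord0 i))).
  congr enorm; apply/rowP => j; rewrite !mxE.
  exact: dderive_prod (smooth1_slab_factor L).
rewrite !indicE; have [xc|xc] := boolP (x \in slab_core L).
  rewrite mem_set; last exact/core_slab/set_mem.
  rewrite !mul1r mulr1 lerD2r; apply: ge0_ler_powR; rewrite ?nnegrE ?enorm_ge0 ?(ltW p0)//.
  rewrite gradE /enorm (bigD1 ord0)//= big1 ?addr0; last first.
    move=> j j0; have /set_mem/(_ j) := xc.
    rewrite /slab_end (negbTE j0) => /andP[x2 xL].
    by rewrite mxE /slab_factor (negbTE j0) derive1_plateau_eq0// mul0r expr0n.
  rewrite mxE big1 ?mulr1; last first.
    move=> j j0; have /set_mem/(_ j) := xc.
    rewrite /slab_end /slab_factor (negbTE j0) => /andP[x2 xL].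
    by rewrite plateau_eq1// (ltW x2) (ltW xL).
  by rewrite sqrtr_sqr /slab_factor eqxx.
rewrite mulr0 addr0; have [xs|xs] := boolP (x \in slab L); last first.
  by rewrite !mul0r mulr0 addr0.
rewrite !mul1r mulr1; apply: (@le_trans _ _ G); last first.
  by rewrite lerDr powR_ge0.
apply: ge0_ler_powR; rewrite ?nnegrE ?enorm_ge0 ?(ltW p0)// gradE.
have /set_mem xs' := xs.
have x01 : 0 < x ord0 ord0 < 1 by have := xs' ord0; rewrite /slab_end eqxx.
have /andP[/ltW x0 /ltW x1] := x01.
apply: enorm_le => j; rewrite !mxE normrM normr_prod; apply: ler_pM => //.
- exact: prodr_ge0.
- rewrite /slab_factor; case: eqP => [->|_].
    by apply: le_trans (uD _ x0 x1) _; rewrite lerDl.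
  by apply: le_trans (plD _ _) _; rewrite lerDr.
- apply: ler_prod => i _; rewrite normr_ge0 /= /slab_factor.
  case: eqP => [->|_]; first by apply: le_trans (uC _ x0 x1) _; rewrite lerDl.
  by rewrite ger0_norm ?plateau_ge0// (le_trans (plateau_le1 _ _))// lerDr.
Qed.

End sharpness.

Section sharp_constant.
Context {R : realType} {n : nat}.
Local Notation mu := (@lebesgue_measure R).
Variables (p q : R) (q1 : 1 <= q) (qp : q < p).

Let q0 : 0 < q. Proof. exact: lt_le_trans q1. Qed.
Let p0 : 0 < p. Proof. exact: lt_trans qp. Qed.

Definition hersch_quotient (O : set 'rV[R]_n.+1) : \bar R :=
  (lambda_pq p q O * volume O `^ ((p - q) / q) * (inradius O `^ p)%:E)%E.

Lemma slab_admissible (L : R) : 0 < L -> [/\ open (@slab R n L), bounded_set (@slab R n L),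
  convex (@slab R n L) & @slab R n L !=set0].
Proof.
move=> L0; split.
- exact: box_open.
- apply: (@box_bounded _ _ _ _ (L + 1)) => [i|]; last by lra.
  by rewrite /slab_end; case: ifP => _; split; lra.
- exact: box_convex.
- exists (\row_i slab_end (1 / 2) (L / 2) i) => i; rewrite mxE /slab_end.
  by case: ifP => _; apply/andP; split; lra.
Qed.

(** The number th is the fraction of the slab's volume occupied by the core. Since (L-4)^n = th L^n,
    all powers of L cancel and the bound depends on L only through th, which tends to 1. *)
Lemma hersch_quotient_slab_le (u : R -> R) (b : R) : Cc_infty1 `]0, 1[ u ->
  (\int[mu]_(x in `]0%R, 1%R[) (`|u x| `^ q)%:E)%E = 1%E ->
  (\int[mu]_(x in `]0%R, 1%R[) (`|derive1 u x| `^ p)%:E)%E = b%:E ->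
  exists2 G : R, 0 <= G & forall L th, 4 < L -> th = ((L - 4) / L) ^+ n ->
    (hersch_quotient (slab L) <=
      ((b + G * (1 - th)) * th `^ (- (p / q)) * 2 `^ (- p))%:E)%E.
Proof.
move=> cu u1 ub; have [G G0 HG] := @slab_energy R n p q q1 qp u cu b ub.
exists G => // L th L4 thE.
have L0 : 0 < L by lra.
have [oS bS cS S0] := slab_admissible L0.
pose y := L ^+ n; pose z := (L - 4) ^+ n; pose s := p / q.
have y0 : 0 < y by exact: exprn_gt0.
have z0 : 0 < z by rewrite exprn_gt0// subr_gt0.
have s0 : 0 < s by rewrite divr_gt0.
have zE : z = th * y by rewrite thE expr_div_n divfK// gt_eqF.
have th0 : 0 < th by rewrite thE exprn_gt0// divr_gt0// subr_gt0.
have [A zA AE] := @slab_mass R n q q1 u cu u1 L (ltW L4).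
have A0 : 0 < A by exact: lt_le_trans zA.
have := lambda_pq_le q1 qp oS (slab_test_Cc cu L) A0 AE.
have := HG L (ltW L4); rewrite -/y -/z.
set E := integral_on _ _ => EG lE.
have E0 : (0 <= E)%E.
  by apply: iint_ge0 => x; rewrite lee_fin mulr_ge0 ?powR_ge0// indicE.
case: E E0 EG lE => [e|//|//]; last first.
rewrite lee_fin -EFinD lee_fin -EFinM => e0 eG le.
pose K := b + G * (1 - th).
have eK : e <= y * K.
  have -> : y * K = b * y + G * y - G * z by rewrite /K zE; ring.
  by rewrite lerBrDr.
have K0 : 0 <= K by rewrite -(pmulr_rge0 _ y0); exact: le_trans eK.
have s1 : (p - q) / q = s - 1 by rewrite /s mulrBl divff ?gt_eqF.
have rp : inradius (@slab R n L) `^ p <= 2 `^ (- p).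
  have -> : 2 `^ (- p) = (2^-1 : R) `^ p.
    have tN : 2^-1 = 2 `^ (- 1) :> R by rewrite powR_inv1.
    by rewrite tN -powRrM mulN1r.
  apply: ge0_ler_powR; rewrite ?nnegrE ?(ltW p0)//.
    exact/ltW/inradius_gt0.
  have -> : 2^-1 = (slab_end 1 L (ord0 : 'I_n.+1) - 0) / 2 :> R.
    by rewrite /slab_end eqxx subr0 mul1r.
  by apply: inradius_box; rewrite /slab_end eqxx.
have Az : A `^ (- s) <= z `^ (- s).
  rewrite !powRN lef_pV2 ?posrE ?powR_gt0//.
  by apply: ge0_ler_powR; rewrite ?nnegrE ?(ltW s0) ?(ltW z0) ?(ltW A0).
rewrite /hersch_quotient (volume_slab (ltW L0)) poweR_EFin s1 -/y.
apply: (@le_trans _ _ ((A `^ (- s) * e * y `^ (s - 1) * inradius (@slab R n L) `^ p)%:E)).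
  rewrite !EFinM; apply: lee_wpmul2r; first by rewrite lee_fin powR_ge0.
  by apply: lee_wpmul2r; rewrite ?lee_fin ?powR_ge0// -EFinM.
rewrite lee_fin -/K.
have -> : K * th `^ (- s) * 2 `^ (- p) =
    z `^ (- s) * (y * K) * y `^ (s - 1) * 2 `^ (- p).
  rewrite zE powRM ?ltW// (powRN y) -(mulr_powRB1 (ltW y0) s0).
  have yy : y `^ (s - 1) != 0 by rewrite gt_eqF// powR_gt0.
  by field; rewrite yy gt_eqF.
have h1 : A `^ (- s) * e <= z `^ (- s) * (y * K).
  by apply: ler_pM => //; exact: powR_ge0.
have h2 : A `^ (- s) * e * y `^ (s - 1) <= z `^ (- s) * (y * K) * y `^ (s - 1).
  by apply: ler_wpM2r h1; exact: powR_ge0.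
apply: ler_pM => //; last exact: powR_ge0.
by rewrite mulr_ge0 ?powR_ge0// mulr_ge0 ?powR_ge0.
Qed.

End sharp_constant.

Theorem theorem5p7 (R : realType) (N : nat) (p q : R) :
  (0 < N)%N -> 1 <= q -> q < p ->
  (forall O : set 'rV[R]_N,
     open O -> bounded_set O -> convex_set (O : set (convex_lmodType 'rV[R]_N)) ->
     O !=set0 ->
     (lambda_pq p q O * volume O `^ ((p - q) / q) >=
       (pi_pq p q * (2^-1)%:E) `^ p * (inradius O `^ (- p))%:E)%E) /\
  ereal_inf [set (lambda_pq p q O * volume O `^ ((p - q) / q)
                   * (inradius O `^ p)%:E)%E |
             O in [set O : set 'rV[R]_N | open O /\ bounded_set O /\
                     convex_set (O : set (convex_lmodType 'rV[R]_N)) /\ O !=set0]]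
  = ((pi_pq p q * (2^-1)%:E) `^ p)%E.
Proof.
case: N => [//|n] _ q1 qp.
have q0 : 0 < q by exact: lt_le_trans q1.
have p0 : 0 < p by exact: lt_trans qp.
have part1 (O : set 'rV[R]_n.+1) : open O -> bounded_set O ->
    convex_set (O : set (convex_lmodType 'rV[R]_n.+1)) -> O !=set0 ->
    ((pi_pq p q * (2^-1)%:E) `^ p * (inradius O `^ (- p))%:E <=
     lambda_pq p q O * volume O `^ ((p - q) / q))%E.
  by move=> oO bO cO O0; apply: lambda_lower_bound => //; exact: convex_setP.
split=> //; apply/eqP; rewrite eq_le; apply/andP; split; last first.
  apply: le_ereal_inf_tmp => _ [D [oD [bD [cD D0]]] <-].
  have r0 := inradius_gt0 bD oD D0.
  have -> : ((pi_pq p q * (2^-1)%:E) `^ p =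
      (pi_pq p q * (2^-1)%:E) `^ p * (inradius D `^ (- p))%:E * (inradius D `^ p)%:E)%E.
    by rewrite -muleA -EFinM powRN mulVf ?mule1// gt_eqF// powR_gt0.
  by apply: lee_wpmul2r; [rewrite lee_fin powR_ge0|exact: part1].
(* What remains is the upper bound. Long slabs will give X <= b 2^-p for every normalised u of
   energy b, and the infimum over u is then taken. *)
set X := ereal_inf _.
have PE := esym (fineK (pi_pq_fin_num p0 q0)).
have X0 : (0 <= X)%E.
  apply: le_ereal_inf_tmp => _ [D _ <-].
  rewrite mule_ge0 ?lee_fin ?powR_ge0// mule_ge0 ?poweR_ge0//.
  apply: le_ereal_inf_tmp => _ [psi _ <-].
  by apply: iint_ge0 => x; rewrite lee_fin mulr_ge0 ?powR_ge0// indicE.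
have Xslab (L : R) : 0 < L -> (X <= hersch_quotient p q (@slab R n L))%E.
  move=> L0; apply: ereal_inf_lbound; exists (slab L) => //.
  have [oS bS cS S0] := @slab_admissible R n L L0.
  by split=> //; split=> //; split=> //; exact: convex_convex_set.
have Xb (u : R -> R) (b : R) : Cc_infty1 `]0, 1[ u ->
    (\int[@lebesgue_measure R]_(x in `]0%R, 1%R[) (`|u x| `^ q)%:E)%E = 1%E ->
    (\int[@lebesgue_measure R]_(x in `]0%R, 1%R[) (`|derive1 u x| `^ p)%:E)%E = b%:E ->
    (X <= (b * 2 `^ (- p))%:E)%E.
  move=> cu u1 ub.
  have [G G0 HG] := @hersch_quotient_slab_le R n p q q1 qp u b cu u1 ub.
  (* The volume fraction for L = k + 5, so that L > 4 and L - 4 = k + 1. *)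
  pose th k : R := ((k.+1%:R) / (k.+1%:R + 4)) ^+ n.
  have XG k : (X <= ((b + G * (1 - th k)) * `|th k| `^ (- (p / q)) * 2 `^ (- p))%:E)%E.
    have L4 : 4 < k.+1%:R + 4 :> R by rewrite ltrDr.
    have := HG _ (th k) L4; rewrite addrK => /(_ erefl) h.
    rewrite ger0_norm; last by rewrite exprn_ge0// divr_ge0// addr_ge0.
    by apply: le_trans h; apply: Xslab; rewrite addr_gt0.
  have hth : th k @[k --> \oo] --> (1 : R).
    have h1 : (1 + 4 * k.+1%:R^-1 : R) @[k --> \oo] --> (1 : R).
      rewrite -[X in _ --> X]addr0; apply: cvgD; first exact: cvg_cst.
      rewrite -[X in _ --> X](mulr0 4); apply: cvgM; first exact: cvg_cst.
      exact: cvg_harmonic.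
    have h2 : ((1 + 4 * k.+1%:R^-1)^-1 : R) @[k --> \oo] --> (1^-1 : R).
      by apply: cvgV => //; exact: oner_neq0.
    have h3 : (((1 + 4 * k.+1%:R^-1)^-1) ^+ n : R) @[k --> \oo] --> ((1^-1) ^+ n : R).
      exact: (continuous_cvg _ (@exprn_continuous R n 1^-1) h2).
    rewrite invr1 expr1n in h3.
    rewrite (_ : th = fun k => ((1 + 4 * k.+1%:R^-1)^-1) ^+ n)//.
    apply/funext => k; rewrite /th; congr (_ ^+ _).
    have k0 : k.+1%:R != 0 :> R by rewrite pnatr_eq0.
    have k4 : k.+1%:R + 4 != 0 :> R by rewrite gt_eqF// addr_gt0.
    move: (k.+1%:R) k0 k4 => K K0 K4; field.
    by rewrite K0 K4.
  have hF : ((b + G * (1 - th k)) * (`|th k| `^ (p / q))^-1 * 2 `^ (- p)) @[k --> \oo]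
      --> ((b + G * (1 - 1)) * (`|1 : R| `^ (p / q))^-1 * 2 `^ (- p) : R).
    apply: cvgM; last exact: cvg_cst.
    apply: cvgM.
      apply: cvgD; first exact: cvg_cst.
      apply: cvgM; first exact: cvg_cst.
      by apply: cvgB => //; exact: cvg_cst.
    apply: cvgV; first by rewrite normr1 powR1 oner_neq0.
    exact: (continuous_cvg _ (@continuous_norm_powR R _ (divr_gt0 p0 q0) 1) hth).
  rewrite subrr mulr0 addr0 normr1 powR1 invr1 mulr1 in hF.
  have Xfin : X \is a fin_num by rewrite ge0_fin_numE// (le_lt_trans (XG 0%N))// ltry.
  rewrite -(fineK Xfin) lee_fin; apply: (ler_cvg_to (cvg_cst (fine X)) hF).
  by apply: nearW => k; have := XG k; rewrite -{1}(fineK Xfin) lee_fin powRN.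
have adm (u : R -> R) : Cc_infty1 `]0, 1[ u -> Lnorm01 q u = 1%E ->
    exists b : R, [/\ 0 <= b, (X <= (b * 2 `^ (- p))%:E)%E &
      Lnorm01 p (derive1 u) = (b `^ p^-1)%:E].
  move=> cu uq.
  have cq := continuous_powR_comp q0 (smooth1_continuous cu.1).
  have cp := continuous_powR_comp p0 (smooth1_continuous (smooth1_derive1 cu.1)).
  have [a aE] : exists a, (\int[@lebesgue_measure R]_(x in `]0%R, 1%R[)
      (`|u x| `^ q)%:E)%E = a%:E.
    by eexists; apply/esym/fineK; exact: (continuous_integral_fin _ _ cq).
  have [b bE] : exists b, (\int[@lebesgue_measure R]_(x in `]0%R, 1%R[)
      (`|derive1 u x| `^ p)%:E)%E = b%:E.
    by eexists; apply/esym/fineK; exact: (continuous_integral_fin _ _ cp).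
  have a0 : 0 <= a.
    by rewrite -lee_fin -aE; apply: integral_ge0 => x _; rewrite lee_fin powR_ge0.
  have a1 : a = 1.
    move: uq; rewrite /Lnorm01 aE poweR_EFin => -[h].
    have := congr1 (fun x => x `^ q) h.
    by rewrite -powRrM mulVf ?gt_eqF// powRr1// powR1.
  exists b; split.
  - by rewrite -lee_fin -bE; apply: integral_ge0 => x _; rewrite lee_fin powR_ge0.
  - by apply: (Xb u b cu) => //; rewrite aE a1.
  - by rewrite /Lnorm01 bE poweR_EFin.
(* Finiteness of [pi_pq] supplies at least one competitor, and with it the finiteness of X. *)
have pilty : (pi_pq p q < +oo :> \bar R)%E by rewrite PE ltry.
have [_ [u0 [cu0 u0q] <-] _] := ereal_inf_lt pilty.
have [b0 [_ Xb0 _]] := adm _ cu0 u0q.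
have Xfin : X \is a fin_num by rewrite ge0_fin_numE// (le_lt_trans Xb0)// ltry.
have [x xE] : exists x, X = x%:E by exists (fine X); exact: esym (fineK Xfin).
rewrite xE in X0 adm *.
(* Solving X <= b 2^-p for the norm b^(1/p) of u' gives 2 X^(1/p) as a lower bound for every
   competitor, hence for their infimum; this rearranges to X <= (pi/2)^p. *)
have xpi : ((2 * x `^ p^-1)%:E <= pi_pq p q)%E.
  apply: le_ereal_inf_tmp => _ [u [cu uq] <-].
  have [b [bge0 xb ->]] := adm _ cu uq.
  move: xb; rewrite !lee_fin powRN ler_pdivlMr ?powR_gt0// => xb.
  have -> : 2 = (2 `^ p) `^ p^-1 :> R by rewrite -powRrM mulfV ?gt_eqF// powRr1.
  rewrite -powRM ?powR_ge0//; apply: ge0_ler_powR.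
  - by rewrite invr_ge0 ltW.
  - by rewrite nnegrE mulr_ge0 ?powR_ge0.
  - by rewrite nnegrE.
  - by rewrite mulrC.
move: xpi; rewrite PE; move: (fine _) => P; rewrite -EFinM poweR_EFin !lee_fin => xP.
have x0 : 0 <= x by rewrite -lee_fin.
have xP2 : x `^ p^-1 <= P * 2^-1 by rewrite ler_pdivlMr// mulrC.
have -> : x = (x `^ p^-1) `^ p by rewrite -powRrM mulVf ?gt_eqF// powRr1.
apply: ge0_ler_powR; rewrite ?nnegrE ?powR_ge0 ?(ltW p0)//.
exact: le_trans (powR_ge0 _ _) xP2.
Qed.
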